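(* Fix a prime number $p$ and a field $k$ of characteristic zero, and let $\mathscr{A}(p)$ be the family of finite abelian $p$-groups. The Balmer spectrum $\mathrm{Spc}(\mathsf{D}(\mathscr{A}(p))^c)$ has infinite Krull dimension and infinite Cantor--Bendixson rank (that is, Cantor--Bendixson rank at least $\omega$).
   Context: Let $\mathscr{G}$ be the category of finite groups whose morphisms are conjugacy classes of surjective group homomorphisms. For a full subcategory $\mathscr{U}\subseteq\mathscr{G}$ closed under isomorphism, $\mathsf{D}(\mathscr{U})$ is the derived category of $\mathsf{A}(\mathscr{U})=\mathrm{Fun}(\mathscr{U}^{\mathrm{op}},\mathrm{Mod}_k)$, with the pointwise tensor product over $k$, and $\mathsf{D}(\mathscr{U})^c$ is its full subcategory of compact objects. For $\mathscr{U}=\mathscr{A}(p)$ (a full subcategory of $\mathscr{G}$), $\mathsf{D}(\mathscr{U})^c$ is an essentially small tensor-triangulated category. The Balmer spectrum $\mathrm{Spc}(\mathscr{K})$ of an essentially small tensor-triangulated category $\mathscr{K}$ is the set of prime thick ideals of $\mathscr{K}$ (thick = triangulated and closed under retracts; ideal = closed under tensoring with any object; prime = proper and $X\otimes Y\in\mathfrak{p}$ implies $X\in\mathfrak{p}$ or $Y\in\mathfrak{p}$), with the topology having the sets $\mathrm{supp}(X)=\{\mathfrak{p}\mid X\notin\mathfrak{p}\}$ as a basis of closed sets. Its Krull dimension is the supremum of lengths of chains of strict inclusions of prime thick ideals (equivalently, of chains of irreducible closed subsets). Cantor--Bendixson rank: for a topological space $X$ let $\delta X$ be the subspace of non-isolated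 points; put $\delta^0X=X$, $\delta^{\alpha+1}X=\delta\delta^{\alpha}X$ and $\delta^\alpha X=\bigcap_{\beta<\alpha}\delta^\beta X$ for limit ordinals $\alpha$. For non-empty $X$ the Cantor--Bendixson rank is $\sup\{\alpha\mid\delta^\alpha X\neq\varnothing\}$ if this supremum exists and $\infty$ otherwise, where $\infty$ is regarded as larger than every ordinal. *)

(* Defs.v *)
From HB Require Import structures.
From mathcomp Require Import all_boot all_order all_algebra all_fingroup all_solvable.
From mathcomp Require Import boolp classical_sets cardinality generic_quotient.
Set Implicit Arguments.
Unset Strict Implicit.
Unset Printing Implicit Defensive.
Import GRing.Theory.
Local Open Scope ring_scope.

(* Several carriers below (complexes, primes) live in a universe above the one
   on which [classical_sets.set] and [topologicalType] are defined, whence the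
   bare predicates [T -> Prop]. *)

Definition mklin (k : fieldType) (V W : lmodType k) (f : V -> W)
    (fL : linear f) : {linear V -> W} :=
  HB.pack f (GRing.isLinear.Build k V W *:%R f fL).

Section DirectSum.
Variables (k : fieldType) (I : Type) (P : pred I) (V : I -> lmodType k).

Definition dsum_pred (x : forall i, V i) :=
  finite_set [set i | x i != 0]%classic /\ (forall i, ~~ P i -> x i = 0).

(* The predicate P serves to cut the degree n part out of the family of all
   X i (x) Y j without indexing by a sigma-type. *)
Record dsum := DSum { dval :> forall i, V i ; dvalP : dsum_pred dval }.

Lemma dsum_inj (x y : dsum) : (forall i, x i = y i) -> x = y.
Proof.
case: x y => x xP [y yP] /= xy.
have e : x = y by apply/functional_extensionality_dep.
by subst y; congr DSum; apply: Prop_irrelevance.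
Qed.

HB.instance Definition _ := gen_eqMixin dsum.
HB.instance Definition _ := gen_choiceMixin dsum.

Lemma dsum0_subproof : dsum_pred (fun i => 0).
Proof.
by split=> //; apply: sub_finite_set _ (finite_set0 _) => i /=; rewrite eqxx.
Qed.

Lemma dsumD_subproof (x y : dsum) : dsum_pred (fun i => x i + y i).
Proof.
case: x y => x [xf x0] [y [yf y0]]; split => /= [|i Pi].
  have := conj xf yf; rewrite -finite_setU; apply: sub_finite_set => i /=; case: (eqVneq (x i) 0) => [->|]; last by left.
  by rewrite add0r; right.
by rewrite x0 // y0 // addr0.
Qed.

Lemma dsumZ_subproof (a : k) (x : dsum) : dsum_pred (fun i => a *: x i).
Proof.
case: x => x [xf x0]; split => /= [|i Pi]; last by rewrite x0 // scaler0.
by apply: sub_finite_set _ xf => i /=; apply: contraNneq => ->; rewrite scaler0.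
Qed.

Definition dsum0 := DSum dsum0_subproof.
Definition dsumD x y := DSum (dsumD_subproof x y).
Definition dsumZ a x := DSum (dsumZ_subproof a x).

Fact dsumA : associative dsumD.
Proof. by move=> x y z; apply: dsum_inj => i /=; rewrite addrA. Qed.
Fact dsumC : commutative dsumD.
Proof. by move=> x y; apply: dsum_inj => i /=; rewrite addrC. Qed.
Fact dsum0D : left_id dsum0 dsumD.
Proof. by move=> x; apply: dsum_inj => i /=; rewrite add0r. Qed.
Fact dsumND : left_inverse dsum0 (dsumZ (-1)) dsumD.
Proof. by move=> x; apply: dsum_inj => i /=; rewrite scaleN1r addNr. Qed.
HB.instance Definition _ :=
  GRing.isZmodule.Build dsum dsumA dsumC dsum0D dsumND.

Fact dsumZA a b x : dsumZ a (dsumZ b x) = dsumZ (a * b) x.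
Proof. by apply: dsum_inj => i /=; rewrite scalerA. Qed.
Fact dsum1Z : left_id 1 dsumZ.
Proof. by move=> x; apply: dsum_inj => i /=; rewrite scale1r. Qed.
Fact dsumZDr : right_distributive dsumZ +%R.
Proof. by move=> a x y; apply: dsum_inj => i /=; rewrite scalerDr. Qed.
Fact dsumZDl x : {morph dsumZ^~ x : a b / a + b}.
Proof. by move=> a b; apply: dsum_inj => i /=; rewrite scalerDl. Qed.
HB.instance Definition _ :=
  GRing.Zmodule_isLmodule.Build k dsum dsumZA dsum1Z dsumZDr dsumZDl.

Lemma dsumDE (x y : dsum) i : (x + y) i = x i + y i. Proof. by []. Qed.
Lemma dsumZE (a : k) (x : dsum) i : (a *: x) i = a *: x i. Proof. by []. Qed.

End DirectSum.

Section DirectSumMap.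
Variables (k : fieldType) (I : Type) (P : pred I) (V W : I -> lmodType k).
Variable f : forall i, {linear V i -> W i}.

Lemma dsum_map_subproof (x : dsum P V) : dsum_pred P (fun i => f i (x i)).
Proof.
case: x => x [xf x0]; split => /= [|i Pi]; last by rewrite x0 // linear0.
by apply: sub_finite_set _ xf => i /=; apply: contraNneq => ->; rewrite linear0.
Qed.

Fact dsum_map_linear : linear (fun x => DSum (dsum_map_subproof x)).
Proof.
by move=> a x y; apply: dsum_inj => i /=; rewrite linearD linearZ.
Qed.
Definition dsum_map : {linear dsum P V -> dsum P W} := mklin dsum_map_linear.

End DirectSumMap.

Section DirectSumIn.
Variables (k : fieldType) (I : Type) (V : I -> lmodType k) (i : I).

Definition dsum_in_fun (v : V i) (j : I) : V j :=
  match pselect (i = j) with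
  | left e => eq_rect i (fun l => V l : Type) v j e
  | right _ => 0
  end.

Lemma dsum_in_subproof v : dsum_pred predT (dsum_in_fun v).
Proof.
split=> //; apply: sub_finite_set _ (finite_set1 i) => j /=.
by rewrite /dsum_in_fun; case: pselect => // _; rewrite eqxx.
Qed.

Fact dsum_in_linear : linear (fun v => DSum (dsum_in_subproof v)).
Proof.
move=> a x y; apply: dsum_inj => j; rewrite dsumDE dsumZE /= /dsum_in_fun.
by case: pselect => [e|_]; [case: j / e|rewrite scaler0 addr0].
Qed.
Definition dsum_in : {linear V i -> dsum predT V} := mklin dsum_in_linear.

End DirectSumIn.

Section Tensor.
Variables (k : fieldType) (V W : lmodType k).

(* The sequence [:: (v1, w1); ...; (vn, wn)] stands for the formal sum
   v1 (x) w1 + ... + vn (x) wn. *)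
Inductive tens_rel : seq (V * W) -> seq (V * W) -> Prop :=
| tens_refl s : tens_rel s s
| tens_sym s t : tens_rel s t -> tens_rel t s
| tens_trans s t u : tens_rel s t -> tens_rel t u -> tens_rel s u
| tens_cat s s' t t' :
    tens_rel s s' -> tens_rel t t' -> tens_rel (s ++ t) (s' ++ t')
| tens_catC s t : tens_rel (s ++ t) (t ++ s)
| tens_Dl v v' w : tens_rel [:: (v + v', w)] [:: (v, w); (v', w)]
| tens_Dr v w w' : tens_rel [:: (v, w + w')] [:: (v, w); (v, w')]
| tens_Z a v w : tens_rel [:: (a *: v, w)] [:: (v, a *: w)]
| tens_0 w : tens_rel [:: (0, w)] [::].

Definition tens_relb (s t : seq (V * W)) : bool := `[< tens_rel s t >].

Lemma tens_relb_equiv : equiv_class_of tens_relb.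
Proof.
split=> [s|s t|t s u].
- by apply/asboolP; exact: tens_refl.
- by apply/asboolP/asboolP; exact: tens_sym.
- by move=> /asboolP st /asboolP tu; apply/asboolP; apply: tens_trans st tu.
Qed.
Canonical tens_equiv := EquivRelPack tens_relb_equiv.
Definition tens := {eq_quot tens_equiv}%qT.

HB.instance Definition _ := Choice.on tens.
HB.instance Definition _ := EqQuotient.on tens.

Definition tpi (s : seq (V * W)) : tens := (\pi_tens s)%qT.

Lemma tpi_eq s t : tens_rel s t -> tpi s = tpi t.
Proof. by move=> st; apply/eqmodP/asboolP. Qed.
Lemma tpi_rel s t : tpi s = tpi t -> tens_rel s t.
Proof. by move=> /eqmodP/asboolP. Qed.
Lemma tens_ind (Q : tens -> Prop) : (forall s, Q (tpi s)) -> forall x, Q x.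
Proof. by move=> Qpi x; rewrite -[x]reprK. Qed.
Lemma repr_tpi s : tens_rel (repr (tpi s)) s.
Proof. by apply: tpi_rel; rewrite /tpi reprK. Qed.

Definition tscale (a : k) (s : seq (V * W)) := [seq (a *: p.1, p.2) | p <- s].

Lemma tscale_rel a s t : tens_rel s t -> tens_rel (tscale a s) (tscale a t).
Proof.
elim=> [u|u v _|u v w _ uv _|u u' v v' _ IHu _ IHv|u v|v v' w|v w w'|b v w|w].
- exact: tens_refl.
- exact: tens_sym.
- exact: tens_trans uv.
- by rewrite /tscale !map_cat; apply: tens_cat.
- by rewrite /tscale !map_cat; apply: tens_catC.
- by rewrite /tscale /= scalerDr; apply: tens_Dl.
- exact: tens_Dr.
- by rewrite /tscale /= scalerA mulrC -scalerA; apply: tens_Z.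
- by rewrite /tscale /= scaler0; apply: tens_0.
Qed.

Definition tens0 : tens := tpi [::].
Definition tensD (x y : tens) : tens := tpi (repr x ++ repr y).
Definition tensZ (a : k) (x : tens) : tens := tpi (tscale a (repr x)).

Lemma tensDE s t : tensD (tpi s) (tpi t) = tpi (s ++ t).
Proof. by apply: tpi_eq; apply: tens_cat; apply: repr_tpi. Qed.
Lemma tensZE a s : tensZ a (tpi s) = tpi (tscale a s).
Proof. by apply: tpi_eq; apply: tscale_rel; apply: repr_tpi. Qed.

Fact tensA : associative tensD.
Proof.
elim/tens_ind=> s; elim/tens_ind=> t; elim/tens_ind=> u.
by rewrite !tensDE catA.
Qed.
Fact tensC : commutative tensD.
Proof.
elim/tens_ind=> s; elim/tens_ind=> t; rewrite !tensDE.
by apply: tpi_eq; apply: tens_catC.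
Qed.
Fact tens0D : left_id tens0 tensD.
Proof. by elim/tens_ind=> s; rewrite tensDE. Qed.

Fact tensZDl x : {morph tensZ^~ x : a b / a + b >-> tensD a b}.
Proof.
move=> a b; elim/tens_ind: x => s; rewrite !tensZE tensDE; apply: tpi_eq.
elim: s => [|[v w] s IHs] /=; first exact: tens_refl.
change (tens_rel ([:: ((a + b) *: v, w)] ++ tscale (a + b) s)
  (([:: (a *: v, w)] ++ tscale a s) ++ [:: (b *: v, w)] ++ tscale b s)).
rewrite scalerDl; apply: tens_trans (tens_cat (tens_Dl _ _ _) IHs) _.
rewrite -[[:: _; _]]/([:: _] ++ [:: _]) -!catA; apply: tens_cat (tens_refl _) _.
by rewrite !catA; apply: tens_cat (tens_catC _ _) (tens_refl _).
Qed.
Fact tens0Z x : tensZ 0 x = tens0.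
Proof.
elim/tens_ind: x => s; rewrite tensZE; apply: tpi_eq.
elim: s => [|[v w] s IHs] /=; first exact: tens_refl.
rewrite scale0r -cat1s -[[::]]cat0s; exact: tens_cat (tens_0 w) IHs.
Qed.
Fact tens1Z : left_id 1 tensZ.
Proof.
elim/tens_ind=> s; rewrite tensZE /tscale; congr tpi.
by apply: map_id_in => -[v w] _ /=; rewrite scale1r.
Qed.
Fact tensND : left_inverse tens0 (tensZ (-1)) tensD.
Proof. by move=> x; rewrite -[x in tensD _ x]tens1Z -tensZDl addNr tens0Z. Qed.
HB.instance Definition _ :=
  GRing.isZmodule.Build tens tensA tensC tens0D tensND.

Fact tensZA a b x : tensZ a (tensZ b x) = tensZ (a * b) x.
Proof.
elim/tens_ind: x => s; rewrite !tensZE /tscale -map_comp; congr tpi.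
by apply: eq_map => -[v w] /=; rewrite scalerA.
Qed.
Fact tensZDr : right_distributive tensZ +%R.
Proof.
move=> a; elim/tens_ind=> s; elim/tens_ind=> t.
by rewrite -[LHS]/(tensZ a (tensD _ _)) tensDE !tensZE -[RHS]/(tensD _ _) tensDE /tscale map_cat.
Qed.
HB.instance Definition _ :=
  GRing.Zmodule_isLmodule.Build k tens tensZA tens1Z tensZDr tensZDl.

End Tensor.

Section TensorMap.
Variables (k : fieldType) (V V' W W' : lmodType k).
Variables (f : {linear V -> V'}) (g : {linear W -> W'}).

Definition tens_map_fun (x : tens V W) : tens V' W' :=
  tpi [seq (f p.1, g p.2) | p <- repr x].

Lemma tens_map_rel s t : tens_rel s t ->
  tens_rel [seq (f p.1, g p.2) | p <- s] [seq (f p.1, g p.2) | p <- t].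
Proof.
elim=> [u|u v _|u v w _ uv _|u u' v v' _ IHu _ IHv|u v|v v' w|v w w'|b v w|w] /=.
- exact: tens_refl.
- exact: tens_sym.
- exact: tens_trans uv.
- by rewrite !map_cat; apply: tens_cat.
- by rewrite !map_cat; apply: tens_catC.
- by rewrite linearD; apply: tens_Dl.
- by rewrite linearD; apply: tens_Dr.
- by rewrite !linearZ; apply: tens_Z.
- by rewrite linear0; apply: tens_0.
Qed.

Lemma tens_map_tpi s :
  tens_map_fun (tpi s) = tpi [seq (f p.1, g p.2) | p <- s].
Proof. by apply: tpi_eq; apply: tens_map_rel; apply: repr_tpi. Qed.

Fact tens_map_linear : linear tens_map_fun.
Proof.
move=> a; elim/tens_ind=> s; elim/tens_ind=> t.
rewrite -[a *: _]/(tensZ a _) tensZE -[_ + _ in LHS]/(tensD _ _) tensDE.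
rewrite !tens_map_tpi -[a *: _]/(tensZ a _) tensZE.
rewrite -[RHS]/(tensD _ _) tensDE map_cat; congr (tpi (_ ++ _)).
by rewrite /tscale -!map_comp; apply: eq_map => -[v w] /=; rewrite linearZ.
Qed.
Definition tens_map : {linear tens V W -> tens V' W'} := mklin tens_map_linear.

Lemma tens_mapE s : tens_map (tpi s) = tpi [seq (f p.1, g p.2) | p <- s].
Proof. exact: tens_map_tpi. Qed.

End TensorMap.

Lemma tens_map_ext (k : fieldType) (V V' W W' : lmodType k)
    (f f' : {linear V -> V'}) (g g' : {linear W -> W'}) :
  f =1 f' -> g =1 g' -> tens_map f g =1 tens_map f' g'.
Proof.
move=> fE gE x; congr tpi.
by apply: eq_map => -[v w] /=; rewrite fE gE.
Qed.

Lemma tens_map_id (k : fieldType) (V W : lmodType k)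
    (f : {linear V -> V}) (g : {linear W -> W}) x :
  f =1 id -> g =1 id -> tens_map f g x = x.
Proof.
move=> fE gE; elim/tens_ind: x => s; rewrite tens_mapE; congr tpi.
by apply: map_id_in => -[v w] _ /=; rewrite fE gE.
Qed.

Lemma tens_map_comp (k : fieldType) (V V' V'' W W' W'' : lmodType k)
    (f : {linear V -> V'}) (f' : {linear V' -> V''}) (f'' : {linear V -> V''})
    (g : {linear W -> W'}) (g' : {linear W' -> W''}) (g'' : {linear W -> W''}) x :
    (forall v, f'' v = f' (f v)) -> (forall w, g'' w = g' (g w)) ->
  tens_map f'' g'' x = tens_map f' g' (tens_map f g x).
Proof.
move=> fE gE; elim/tens_ind: x => s.
rewrite !tens_mapE -map_comp; congr tpi.
by apply: eq_map => -[v w] /=; rewrite fE gE.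
Qed.

Lemma tens_map_sq (k : fieldType) (V V1 V2 V' W W1 W2 W' : lmodType k)
    (f1 : {linear V -> V1}) (f1' : {linear V1 -> V'})
    (f2 : {linear V -> V2}) (f2' : {linear V2 -> V'})
    (g1 : {linear W -> W1}) (g1' : {linear W1 -> W'})
    (g2 : {linear W -> W2}) (g2' : {linear W2 -> W'}) x :
    (forall v, f1' (f1 v) = f2' (f2 v)) ->
    (forall w, g1' (g1 w) = g2' (g2 w)) ->
  tens_map f1' g1' (tens_map f1 g1 x) = tens_map f2' g2' (tens_map f2 g2 x).
Proof.
move=> fE gE; elim/tens_ind: x => s.
rewrite !tens_mapE -!map_comp; congr tpi.
by apply: eq_map => -[v w] /=; rewrite fE gE.
Qed.

Lemma tens_map0l (k : fieldType) (V V' W W' : lmodType k)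
    (f : {linear V -> V'}) (g : {linear W -> W'}) x :
  (forall v, f v = 0) -> tens_map f g x = 0.
Proof.
move=> fE; elim/tens_ind: x => s; rewrite tens_mapE.
apply: tpi_eq; elim: s => [|[v w] s IHs] /=; first exact: tens_refl.
by rewrite fE -cat1s -[[::]]cat0s; exact: tens_cat (tens_0 _ _) IHs.
Qed.

Lemma tens_map0r (k : fieldType) (V V' W W' : lmodType k)
    (f : {linear V -> V'}) (g : {linear W -> W'}) x :
  (forall w, g w = 0) -> tens_map f g x = 0.
Proof.
move=> gE; elim/tens_ind: x => s; rewrite tens_mapE.
apply: tpi_eq; elim: s => [|[v w] s IHs] /=; first exact: tens_refl.
rewrite gE -cat1s -[[::]]cat0s; apply: tens_cat _ IHs.
rewrite -[0](scale0r (0 : W')); apply: tens_trans (tens_sym (tens_Z _ _ _)) _.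
by rewrite scale0r; exact: tens_0.
Qed.

Record epi (G H : finGroupType) := Epi {
  epi_fun :> {multiplicative G -> H};
  epi_surj : forall y, exists x, epi_fun x = y }.

Lemma epi_id_subproof (G : finGroupType) (y : G) :
  exists x, (idfun : {multiplicative G -> G}) x = y.
Proof. by exists y. Qed.
Definition epi_id (G : finGroupType) : epi G G :=
  Epi (@epi_id_subproof G).

Lemma epi_comp_subproof (G H K : finGroupType) (b : epi H K) (a : epi G H) y :
  exists x, (b \o a : {multiplicative G -> K}) x = y.
Proof.
by have [z <-] := epi_surj b y; have [x <-] := epi_surj a z; exists x.
Qed.
Definition epi_comp (G H K : finGroupType) (b : epi H K) (a : epi G H) :
  epi G K := Epi (epi_comp_subproof b a).

Record grp (U : finGroupType -> Prop) :=
  Grp { grp_sort :> finGroupType; grpP : U grp_sort }.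

Definition abelian_pgroup (p : nat) (G : finGroupType) : Prop :=
  (abelian [set: G] /\ p.-group [set: G])%g.

Section Derived.
Variables (k : fieldType) (U : finGroupType -> Prop).

(* [ract_conj] says that the value on an epimorphism depends only on its
   conjugacy class. *)
Record rep := Rep {
  rsort :> grp U -> lmodType k;
  ract : forall G H : grp U, epi G H -> {linear rsort H -> rsort G};
  ract_id : forall (G : grp U) x, ract (epi_id G) x = x;
  ract_comp : forall (G H K : grp U) (b : epi H K) (a : epi G H) x,
    ract (epi_comp b a) x = ract a (ract b x);
  ract_conj : forall (G H : grp U) (a b : epi G H) (h : H),
    (forall g, b g = (a g ^ h)%g) -> ract a =1 ract b }.

Record rhom (X Y : rep) := RHom {
  rfun :> forall G, {linear X G -> Y G};
  rnat : forall (G H : grp U) (a : epi G H) x,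
    rfun G (ract X a x) = ract Y a (rfun H x) }.

Definition rid (X : rep) : rhom X X :=
  @RHom X X (fun G => idfun) (fun G H a x => erefl).

Fact rcomp_nat (X Y Z : rep) (g : rhom Y Z) (f : rhom X Y)
    (G H : grp U) (a : epi G H) x :
  (g G \o f G) (ract X a x) = ract Z a ((g H \o f H) x).
Proof. by rewrite /= !rnat. Qed.
Definition rcomp (X Y Z : rep) (g : rhom Y Z) (f : rhom X Y) : rhom X Z :=
  @RHom X Z (fun G => g G \o f G) (rcomp_nat g f).

Fact rzero_nat (X Y : rep) (G H : grp U) (a : epi G H) x :
  (\0 : {linear X G -> Y G}) (ract X a x) =
  ract Y a ((\0 : {linear X H -> Y H}) x).
Proof. by rewrite /= linear0. Qed.
Definition rzero (X Y : rep) : rhom X Y :=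
  @RHom X Y (fun G => \0) (@rzero_nat X Y).

Fact radd_nat (X Y : rep) (f g : rhom X Y) (G H : grp U) (a : epi G H) x :
  (f G \+ g G) (ract X a x) = ract Y a ((f H \+ g H) x).
Proof. by rewrite /= !rnat linearD. Qed.
Definition radd (X Y : rep) (f g : rhom X Y) : rhom X Y :=
  @RHom X Y (fun G => f G \+ g G) (radd_nat f g).

Section Sums.
Variables (I : Type) (P : pred I) (X : I -> rep).
Let S (G : grp U) : lmodType k := dsum P (fun i => X i G).
Let act (G H : grp U) (a : epi G H) : {linear S H -> S G} :=
  dsum_map P (fun i => ract (X i) a).
Fact rsum_id (G : grp U) x : act (epi_id G) x = x.
Proof. by apply: dsum_inj => i /=; rewrite ract_id. Qed.
Fact rsum_comp (G H K : grp U) (b : epi H K) (a : epi G H) x :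
  act (epi_comp b a) x = act a (act b x).
Proof. by apply: dsum_inj => i /=; rewrite ract_comp. Qed.
Fact rsum_conj (G H : grp U) (a b : epi G H) (h : H) :
  (forall g, b g = (a g ^ h)%g) -> act a =1 act b.
Proof.
by move=> ab x; apply: dsum_inj => i /=; exact: ract_conj ab _.
Qed.
Definition rsum : rep := Rep rsum_id rsum_comp rsum_conj.
End Sums.

Section Product.
Variables X Y : rep.
Let S (G : grp U) : lmodType k := (X G * Y G)%type.
Let act_fun (G H : grp U) (a : epi G H) (x : S H) : S G :=
  (ract X a x.1, ract Y a x.2).
Let act_linear (G H : grp U) (a : epi G H) : linear (act_fun a).
Proof. by move=> c x y; rewrite /act_fun /= !linearP. Qed.
Let act (G H : grp U) (a : epi G H) := mklin (act_linear a).
Fact rprod_id (G : grp U) x : act (epi_id G) x = x.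
Proof. by case: x => x y; rewrite /= /act_fun !ract_id. Qed.
Fact rprod_comp (G H K : grp U) (b : epi H K) (a : epi G H) x :
  act (epi_comp b a) x = act a (act b x).
Proof. by rewrite /= /act_fun !ract_comp. Qed.
Fact rprod_conj (G H : grp U) (a b : epi G H) (h : H) :
  (forall g, b g = (a g ^ h)%g) -> act a =1 act b.
Proof.
by move=> ab x; congr pair; exact: ract_conj ab _.
Qed.
Definition rprod : rep := Rep rprod_id rprod_comp rprod_conj.
End Product.

Section TensorRep.
Variables X Y : rep.
Let S (G : grp U) : lmodType k := tens (X G) (Y G).
Let act (G H : grp U) (a : epi G H) : {linear S H -> S G} :=
  tens_map (ract X a) (ract Y a).
Fact rtens_id (G : grp U) x : act (epi_id G) x = x.
Proof. by apply: tens_map_id => y; apply: ract_id. Qed.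
Fact rtens_comp (G H K : grp U) (b : epi H K) (a : epi G H) x :
  act (epi_comp b a) x = act a (act b x).
Proof. by apply: tens_map_comp => y; apply: ract_comp. Qed.
Fact rtens_conj (G H : grp U) (a b : epi G H) (h : H) :
  (forall g, b g = (a g ^ h)%g) -> act a =1 act b.
Proof.
by move=> ab; apply: tens_map_ext; apply: ract_conj ab.
Qed.
Definition rtens : rep := Rep rtens_id rtens_comp rtens_conj.
End TensorRep.

(* Homological grading. *)
Record cplx := Cplx {
  cx :> int -> rep;
  cd : forall n : int, rhom (cx (n + 1)) (cx n);
  cdd : forall n G x, cd n G (cd (n + 1) G x) = 0 }.

Record cmap (X Y : cplx) := CMap {
  cf :> forall n : int, rhom (X n) (Y n);
  cfd : forall n G x, cf n G (cd X n G x) = cd Y n G (cf (n + 1) G x) }.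

Definition cmap_id (X : cplx) : cmap X X :=
  @CMap X X (fun n => rid (X n)) (fun n G x => erefl).

Fact ccomp_d (X Y Z : cplx) (g : cmap Y Z) (f : cmap X Y) n G x :
  rcomp (g n) (f n) G (cd X n G x) =
  cd Z n G (rcomp (g (n + 1)) (f (n + 1)) G x).
Proof. by rewrite /= !cfd. Qed.
Definition cmap_comp (X Y Z : cplx) (g : cmap Y Z) (f : cmap X Y) : cmap X Z :=
  CMap (ccomp_d g f).

Fact czero_d (X Y : cplx) n G x :
  rzero (X n) (Y n) G (cd X n G x) =
  cd Y n G (rzero (X (n + 1)) (Y (n + 1)) G x).
Proof. by rewrite /= linear0. Qed.
Definition cmap_zero (X Y : cplx) : cmap X Y := CMap (@czero_d X Y).

Fact cadd_d (X Y : cplx) (f g : cmap X Y) n G x :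
  radd (f n) (g n) G (cd X n G x) =
  cd Y n G (radd (f (n + 1)) (g (n + 1)) G x).
Proof. by rewrite /= !cfd linearD. Qed.
Definition cmap_add (X Y : cplx) (f g : cmap X Y) : cmap X Y := CMap (cadd_d f g).

(* f induces a bijection on the homology of every X(G) in every degree;
   as n ranges over int, so does the degree n + 1. *)
Definition quasi_iso (X Y : cplx) (f : cmap X Y) : Prop :=
  forall (n : int) (G : grp U),
    (forall x : X (n + 1) G, cd X n G x = 0 ->
       (exists y, f (n + 1) G x = cd Y (n + 1) G y) ->
       exists x', x = cd X (n + 1) G x') /\
    (forall y : Y (n + 1) G, cd Y n G y = 0 ->
       exists2 x, cd X n G x = 0 &
       exists y', y = f (n + 1) G x + cd Y (n + 1) G y').

Section CoproductCplx.
Variables (I : Type) (X : I -> cplx).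
Let S (n : int) := rsum predT (fun i => X i n).
Let d_fun (n : int) (G : grp U) : {linear S (n + 1) G -> S n G} :=
  dsum_map predT (fun i => cd (X i) n G).
Fact coprod_d_nat n (G H : grp U) (a : epi G H) x :
  d_fun n G (ract (S (n + 1)) a x) = ract (S n) a (d_fun n H x).
Proof. by apply: dsum_inj => i /=; rewrite rnat. Qed.
Let d (n : int) : rhom (S (n + 1)) (S n) := RHom (@coprod_d_nat n).
Fact coprod_dd n G x : d n G (d (n + 1) G x) = 0.
Proof. by apply: dsum_inj => i /=; rewrite cdd. Qed.
Definition coprod : cplx := Cplx coprod_dd.

Fact coprod_in_nat i n (G H : grp U) (a : epi G H) x :
  dsum_in (fun j => X j n G) i (ract (X i n) a x) =
  ract (coprod n) a (dsum_in (fun j => X j n H) i x).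
Proof.
apply: dsum_inj => j /=; rewrite /dsum_in_fun.
by case: pselect => [e|_]; [case: j / e|rewrite linear0].
Qed.
Let in_map i (n : int) : rhom (X i n) (coprod n) :=
  @RHom _ (coprod n) (fun G => dsum_in (fun j => X j n G) i)
    (@coprod_in_nat i n).
Fact coprod_in_d i n G x :
  in_map i n G (cd (X i) n G x) = cd coprod n G (in_map i (n + 1) G x).
Proof.
apply: dsum_inj => j /=; rewrite /dsum_in_fun.
by case: pselect => [e|_]; [case: j / e|rewrite linear0].
Qed.
Definition coprod_in i : cmap (X i) coprod := CMap (@coprod_in_d i).
End CoproductCplx.

Section Fibre.
Variables (X Y : cplx) (f : cmap X Y).
Let S (n : int) := rprod (X n) (Y (n + 1)).
Let d_fun (n : int) (G : grp U) (x : S (n + 1) G) : S n G :=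
  (cd X n G x.1, f (n + 1) G x.1 - cd Y (n + 1) G x.2).
Fact fib_d_linear n G : linear (@d_fun n G).
Proof.
move=> a x y; congr pair; first by rewrite /= linearP.
by rewrite /= !linearP scalerDr addrACA.
Qed.
Fact fib_d_nat n (G H : grp U) (a : epi G H) x :
  mklin (@fib_d_linear n G) (ract (S (n + 1)) a x) =
  ract (S n) a (mklin (@fib_d_linear n H) x).
Proof. by rewrite /= /d_fun /= !rnat -linearB. Qed.
Let d (n : int) : rhom (S (n + 1)) (S n) := RHom (@fib_d_nat n).
Fact fib_dd n G x : d n G (d (n + 1) G x) = 0.
Proof.
congr pair; rewrite /= ?cdd //.
by rewrite linearB cdd subr0 cfd subrr.
Qed.
(* The mapping fibre, i.e. the desuspension of the mapping cone; it is used in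
   place of the cone because the indices then match definitionally. *)
Definition fib : cplx := Cplx fib_dd.
End Fibre.

Section TensorCplx.
Variables X Y : cplx.
Let P (n : int) : pred (int * int) := fun ij => ij.1 + ij.2 == n.
Let T (ij : int * int) : rep := rtens (X ij.1) (Y ij.2).
Let S (n : int) := rsum (P n) T.
(* d (x (x) y) = dx (x) y + (-1)^i x (x) dy for x of degree i. *)
Let d_val (n : int) (G : grp U) (x : S (n + 1) G) (ij : int * int) : T ij G :=
  (tens_map (cd X ij.1 G) idfun (x (ij.1 + 1, ij.2)) : T ij G) +
  (-1) ^ ij.1 *: (tens_map idfun (cd Y ij.2 G) (x (ij.1, ij.2 + 1)) : T ij G).
Let d_valE (n : int) (G : grp U) (x : S (n + 1) G) (i j : int) :
  d_val x (i, j) = tens_map (cd X i G) idfun (x (i + 1, j)) +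
                   (-1) ^ i *: tens_map idfun (cd Y j G) (x (i, j + 1)).
Proof. by []. Qed.
Fact ctens_d_subproof (n : int) (G : grp U) (x : S (n + 1) G) :
  dsum_pred (P n) (d_val x).
Proof.
case: (dvalP x) => xf x0; split=> [|[i j] Pij]; last first.
  rewrite d_valE !x0 ?linear0 ?scaler0 ?addr0 //; apply: contraNN Pij.
    by rewrite /P /= addrA => /eqP/addIr ->.
  by rewrite /P /= addrAC => /eqP/addIr ->.
have f1 : finite_set [set ij : int * int | x (ij.1 + 1, ij.2) != 0]%classic.
  apply: (@finite_preimage _ _ _ (fun ij => (ij.1 + 1, ij.2)) _ xf).
  by move=> [i j] [i' j'] _ _ [/addIr -> ->].
have f2 : finite_set [set ij : int * int | x (ij.1, ij.2 + 1) != 0]%classic.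
  apply: (@finite_preimage _ _ _ (fun ij => (ij.1, ij.2 + 1)) _ xf).
  by move=> [i j] [i' j'] _ _ [-> /addIr ->].
have := conj f1 f2; rewrite -finite_setU; apply: sub_finite_set => -[i j].
rewrite /mkset d_valE => h.
case: (eqVneq (x (i + 1, j)) 0) => [x10|]; last by left.
right; apply: contraNneq h => x01; rewrite x10.
by rewrite [x (i, j + 1)]x01 !linear0 addr0.
Qed.
Let d_fun (n : int) (G : grp U) (x : S (n + 1) G) : S n G :=
  DSum (ctens_d_subproof x).
Let d_funE (n : int) (G : grp U) (x : S (n + 1) G) i j :
  d_fun x (i, j) = d_val x (i, j).
Proof. by []. Qed.
Fact ctens_d_linear n G : linear (@d_fun n G).
Proof.
move=> a x y; apply: dsum_inj => -[i j].
rewrite dsumDE dsumZE !d_funE !d_valE !dsumDE !dsumZE !linearP.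
by rewrite scalerDr addrACA.
Qed.
Let ractE (m : int) (G H : grp U) (a : epi G H) (x : S m H) i j :
  ract (S m) a x (i, j) = tens_map (ract (X i) a) (ract (Y j) a) (x (i, j)).
Proof. by []. Qed.
Fact ctens_d_nat n (G H : grp U) (a : epi G H) x :
  mklin (@ctens_d_linear n G) (ract (S (n + 1)) a x) =
  ract (S n) a (mklin (@ctens_d_linear n H) x).
Proof.
apply: dsum_inj => -[i j]; rewrite ractE [LHS]d_valE !ractE.
rewrite [X in _ = tens_map _ _ X]d_valE linearD linearZ.
by congr (_ + _ *: _); apply: tens_map_sq => v //; rewrite rnat.
Qed.
Let d (n : int) : rhom (S (n + 1)) (S n) := RHom (@ctens_d_nat n).
Let dE (n : int) (G : grp U) (x : S (n + 1) G) i j : d n G x (i, j) =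
  tens_map (cd X i G) idfun (x (i + 1, j)) +
  (-1) ^ i *: tens_map idfun (cd Y j G) (x (i, j + 1)).
Proof. by []. Qed.
Fact ctens_dd n G x : d n G (d (n + 1) G x) = 0.
Proof.
apply: dsum_inj => -[i j]; rewrite !dE !linearD !linearZ.
rewrite -(@tens_map_comp _ _ _ _ _ _ _ _ _ \0 _ _ idfun) => [|v|//]; last first.
  by rewrite cdd.
rewrite -(@tens_map_comp _ _ _ _ _ _ _ _ _ idfun _ _ \0) => [|//|v]; last first.
  by rewrite cdd.
rewrite [tens_map \0 _ _]tens_map0l // [tens_map _ \0 _]tens_map0r //.
rewrite [X in _ + (_ + X)](_ : _ = 0); last by rewrite linear0; exact: scaler0.
rewrite add0r addr0 expfzDr ?oppr_eq0 ?oner_eq0 // expr1z mulrN1.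
rewrite [X in X + _]scaleNr; apply/eqP; rewrite addrC subr_eq0; apply/eqP.
by congr (_ *: _); apply: tens_map_sq.
Qed.
Definition ctens : cplx := Cplx ctens_dd.
End TensorCplx.

(* The derived category is the localization of the category of complexes at
   the quasi-isomorphisms, given here by generators [dhom] and relations [deq].
   Sums of morphisms are added as generators together with the relations that
   make the composition bilinear and the localization functor additive: as the
   localization is additive, and so is the functor to it, this presents the
   same category. *)
Inductive dhom : cplx -> cplx -> Type :=
| dmap X Y : cmap X Y -> dhom X Y
| dinv X Y (s : cmap X Y) : quasi_iso s -> dhom Y X
| dcomp X Y Z : dhom Y Z -> dhom X Y -> dhom X Z
| dzero X Y : dhom X Y
| dadd X Y : dhom X Y -> dhom X Y -> dhom X Y.

Definition did X : dhom X X := dmap (cmap_id X).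

Inductive deq : forall X Y, dhom X Y -> dhom X Y -> Prop :=
| deq_refl X Y (f : dhom X Y) : deq f f
| deq_sym X Y (f g : dhom X Y) : deq f g -> deq g f
| deq_trans X Y (f g h : dhom X Y) : deq f g -> deq g h -> deq f h
| deq_comp X Y Z (g g' : dhom Y Z) (f f' : dhom X Y) :
    deq g g' -> deq f f' -> deq (dcomp g f) (dcomp g' f')
| deq_add X Y (f f' g g' : dhom X Y) :
    deq f f' -> deq g g' -> deq (dadd f g) (dadd f' g')
| deq_compA X Y Z T (h : dhom Z T) (g : dhom Y Z) (f : dhom X Y) :
    deq (dcomp h (dcomp g f)) (dcomp (dcomp h g) f)
| deq_idl X Y (f : dhom X Y) : deq (dcomp (did Y) f) f
| deq_idr X Y (f : dhom X Y) : deq (dcomp f (did X)) f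
| deq_map_comp X Y Z (g : cmap Y Z) (f : cmap X Y) :
    deq (dmap (cmap_comp g f)) (dcomp (dmap g) (dmap f))
| deq_invl X Y (s : cmap X Y) (sq : quasi_iso s) :
    deq (dcomp (dinv sq) (dmap s)) (did X)
| deq_invr X Y (s : cmap X Y) (sq : quasi_iso s) :
    deq (dcomp (dmap s) (dinv sq)) (did Y)
| deq_addA X Y (f g h : dhom X Y) :
    deq (dadd f (dadd g h)) (dadd (dadd f g) h)
| deq_addC X Y (f g : dhom X Y) : deq (dadd f g) (dadd g f)
| deq_add0 X Y (f : dhom X Y) : deq (dadd (dzero X Y) f) f
| deq_compDl X Y Z (g g' : dhom Y Z) (f : dhom X Y) :
    deq (dcomp (dadd g g') f) (dadd (dcomp g f) (dcomp g' f))
| deq_compDr X Y Z (g : dhom Y Z) (f f' : dhom X Y) :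
    deq (dcomp g (dadd f f')) (dadd (dcomp g f) (dcomp g f'))
| deq_comp0l X Y Z (f : dhom X Y) : deq (dcomp (dzero Y Z) f) (dzero X Z)
| deq_comp0r X Y Z (g : dhom Y Z) : deq (dcomp g (dzero X Y)) (dzero X Z)
| deq_map_add X Y (f g : cmap X Y) :
    deq (dmap (cmap_add f g)) (dadd (dmap f) (dmap g))
| deq_map_zero X Y : deq (dmap (cmap_zero X Y)) (dzero X Y).

Definition retract (X Y : cplx) : Prop :=
  exists (i : dhom X Y) (r : dhom Y X), deq (dcomp r i) (did X).

Definition diso (X Y : cplx) : Prop :=
  exists (f : dhom X Y) (g : dhom Y X),
    deq (dcomp g f) (did X) /\ deq (dcomp f g) (did Y).

(* There is a distinguished triangle X -> Y -> Z -> X[1]. *)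
Definition triangle (X Y Z : cplx) : Prop :=
  exists (Y' Z' : cplx) (f : cmap Y' Z'),
    [/\ diso X (fib f), diso Y Y' & diso Z Z'].

(* The canonical map from the direct sum of the Hom(X, Y i) to
   Hom(X, coprod Y) is bijective; an element of this direct sum is a family
   h j in Hom(X, Y (c j)) indexed by finitely many distinct indices c j. *)
Definition compact (X : cplx) : Prop :=
  forall (I : Type) (Y : I -> cplx),
  let sum n (c : 'I_n -> I) (h : forall j, dhom X (Y (c j))) :=
    \big[@dadd X (coprod Y)/@dzero X (coprod Y)]_(j < n)
      dcomp (dmap (coprod_in Y (c j))) (h j) in
  (forall g : dhom X (coprod Y), exists n (c : 'I_n -> I) h,
     injective c /\ deq g (sum n c h)) /\
  (forall n (c : 'I_n -> I) h, injective c ->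
     deq (sum n c h) (dzero X (coprod Y)) -> forall j, deq (h j) (dzero _ _)).

(* Closure under isomorphisms is a consequence of closure under retracts. *)
Record thick_ideal (P : cplx -> Prop) : Prop := ThickIdeal {
  thick_compact : forall X, P X -> compact X;
  thick_zero : forall X, deq (did X) (dzero X X) -> P X;
  thick_tri1 : forall X Y Z, triangle X Y Z -> P Y -> P Z -> P X;
  thick_tri2 : forall X Y Z, triangle X Y Z -> P X -> P Z -> P Y;
  thick_tri3 : forall X Y Z, triangle X Y Z -> P X -> P Y -> P Z;
  thick_retract : forall X Y, retract X Y -> P Y -> P X;
  thick_tensor : forall X Y, P X -> compact Y -> P (ctens X Y) }.

Record prime_ideal (P : cplx -> Prop) : Prop := PrimeIdeal {
  prime_thick : thick_ideal P;
  prime_proper : exists2 X, compact X & ~ P X;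
  prime_tensor : forall X Y, compact X -> compact Y ->
    P (ctens X Y) -> P X \/ P Y }.

Record Spc := MkSpc { spc_pred :> cplx -> Prop; spcP : prime_ideal spc_pred }.

Definition spc_supp (X : cplx) (P : Spc) : Prop := ~ P X.

(* The topology with the supports of compact objects as a basis of closed
   sets. *)
Definition spc_open (O : Spc -> Prop) : Prop :=
  forall P, O P -> exists X, [/\ compact X, ~ spc_supp X P
    & forall Q, ~ spc_supp X Q -> O Q].

Definition spc_lt (P Q : Spc) : Prop :=
  (forall X, P X -> Q X) /\ ~ (forall X, Q X -> P X).

Definition krull_dim_ge (n : nat) : Prop :=
  exists P : 'I_n.+1 -> Spc, forall i j : 'I_n.+1, (i < j)%N -> spc_lt (P i) (P j).

Definition krull_dim_infinite : Prop := forall n, krull_dim_ge n.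

End Derived.

(* Tree notations for ordinals: [olim f] is the supremum of an arbitrary family
   f, so that one ordinal has many notations; [ole] compares the ordinals
   denoted. *)
Inductive ord : Type :=
| ozero
| osucc (a : ord)
| olim (A : Type) (f : A -> ord).

Fixpoint ole (a : ord) : ord -> Prop :=
  match a with
  | ozero => fun _ => True
  | osucc a' => fix lt (b : ord) : Prop :=
      match b with
      | ozero => False
      | osucc b' => ole a' b'
      | olim B g => exists j, lt (g j)
      end
  | olim A f => fun b => forall i, ole (f i) b
  end.

Definition oomega : ord := olim (fun n : nat => iter n osucc ozero).

Section CantorBendixson.
Variables (T : Type) (opn : (T -> Prop) -> Prop).

Definition isolated_in (A : T -> Prop) (x : T) : Prop :=
  A x /\ exists2 O, opn O & O x /\ forall y, A y -> O y -> y = x.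

Definition cb_derived (A : T -> Prop) (x : T) : Prop :=
  A x /\ ~ isolated_in A x.

Fixpoint cb_iter (a : ord) : T -> Prop :=
  match a with
  | ozero => fun _ => True
  | osucc a' => cb_derived (cb_iter a')
  | olim A f => fun x => forall i, cb_iter (f i) x
  end.

Definition cb_nonempty (a : ord) : Prop := exists x, cb_iter a x.

Definition is_cb_rank (r : ord) : Prop :=
  (forall a, cb_nonempty a -> ole a r) /\
  (forall b, (forall a, cb_nonempty a -> ole a b) -> ole r b).

(* [None] is the value infinity, which is above every ordinal. *)
Definition cb_rank : option ord :=
  match pselect (exists r, is_cb_rank r) with
  | left e => Some (sval (cid e))
  | right _ => None
  end.

Definition cb_rank_ge (a : ord) : Prop :=
  if cb_rank is Some r then ole a r else True.

End CantorBendixson.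

(* Main.v *)
(** The primes are those of the compact complexes X with X(G) acyclic for all
    G of exponent dividing p^n; they are strictly decreasing in n, which gives
    the Krull dimension. An open set containing the n-th one contains the
    previous one, so the n-th one survives n derivations.

    That these thick ideals are prime follows from the Kuenneth formula at the
    groups V_b = (Z/p^n)^b once it is known that a compact X acyclic at V_b for
    infinitely many b is acyclic at every G of exponent dividing p^n. Replace X
    by a complex T of projectives. A class not killed at G gives a map f from
    T_m to the coinduced diagram of functions on Epi(G, -), vanishing on
    boundaries and not factoring through the differential. In characteristic
    zero a diagram Z supported on boundedly many groups of exponent dividing p^n
    is a quotient of the coinduced diagram I of E-valued functions on
    Epi(V_b, -) for b large: lift f to T_m -> I and compose with the
    differential to get a map from T_(m+1) to the kernel Z' of I -> Z. As maps
    into I only see T(V_b), which is acyclic, the new map does not factor either.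
    Iterating gives maps from T in infinitely many degrees, hence one to an
    infinite coproduct, none of whose components is null; so T is not compact.

    Compact objects are handled through a cellular resolution: X is compact if
    and only if its resolution is a homotopy retract of a bounded complex of
    finitely generated projectives. This passes to tensor products because the
    tensor product of two representables is a finite sum of representables. *)

From HB Require Import structures.
From mathcomp Require Import all_boot all_order all_algebra all_fingroup all_solvable.
From mathcomp Require Import zify.
From mathcomp Require Import boolp classical_sets cardinality generic_quotient.
Require Import Defs.
Set Implicit Arguments.
Unset Strict Implicit.
Unset Printing Implicit Defensive.
Import Order.TTheory GRing.Theory Num.Theory.
Local Open Scope ring_scope.

(** The Hom sets of the derived category are given by generators and relations, so a relation can be
    derived but not refuted directly. The way out is a model: chain maps out of a K-projective
    complex, taken up to homotopy, interpret the generators and satisfy the relations. Compactness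
    of a complex thereby becomes a statement about null homotopies of maps from its resolution.

    The ranks b have to be unbounded because the bounds grow: a diagram bounded by s is covered from
    V_b once b >= s * s, and the kernel of the covering is then bounded only by the order of V_b.
    Unboundedness also yields primality: a compact object outside the ideal fails to be acyclic at
    every V_b from some rank on, so two such objects fail at a common V_b.

    The covering rests on Gaschuetz's lemma. An epimorphism from V_b is a generating b-tuple, and
    the number of generating tuples of a group above a given generating tuple of a quotient does not
    depend on the latter. Averaging over such fibres, possible in characteristic zero, is what makes
    the map out of the coinduced diagram natural. *)

(** * Identities in abelian groups *)

Inductive zexp := ZVar of nat | ZZero | ZAdd of zexp & zexp | ZOpp of zexp.

Fixpoint zcoef (e : zexp) (i : nat) : int :=
  match e with
  | ZVar j => (i == j)%:Z
  | ZZero => 0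
  | ZAdd a b => zcoef a i + zcoef b i
  | ZOpp a => - zcoef a i
  end.

Fixpoint zval (V : zmodType) (env : seq V) (e : zexp) : V :=
  match e with
  | ZVar j => env`_j
  | ZZero => 0
  | ZAdd a b => zval env a + zval env b
  | ZOpp a => - zval env a
  end.

Lemma zval_coef (V : zmodType) (env : seq V) e :
  zval env e = \sum_(i < size env) env`_i *~ zcoef e i.
Proof.
elim: e => [j||a IHa b IHb|a IHa] /=.
- case: (ltnP j (size env)) => [lj|gj].
    rewrite (bigD1 (Ordinal lj)) //= eqxx big1 ?addr0 // => i /negPf ij.
    by rewrite (_ : (i == j :> nat) = false) //.
  rewrite nth_default // big1 // => i _.
  by rewrite (_ : (i == j :> nat) = false) //; apply/negP => /eqP ij; move: (ltn_ord i); rewrite ij ltnNge gj.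
- by rewrite big1.
- by rewrite IHa IHb -big_split; apply: eq_bigr => i _; rewrite mulrzDr.
- by rewrite IHa -sumrN; apply: eq_bigr => i _; rewrite mulrNz.
Qed.

Lemma zval_eq (V : zmodType) (env : seq V) a b :
  all (fun i => zcoef a i == zcoef b i) (iota 0 (size env)) ->
  zval env a = zval env b.
Proof.
move=> /allP h; rewrite !zval_coef; apply: eq_bigr => i _; congr (_ *~ _).
by apply/eqP/h; rewrite mem_iota /=.
Qed.

(** Derives a goal from one known equation c = d: the remaining identity a + d = b + c is left to
    [zmod]. *)
Lemma zmod_from (V : zmodType) (a b c d : V) : c = d -> a + d = b + c -> a = b.
Proof. by move=> -> /addIr. Qed.

(** Atoms are compared by unification, so that convertible presentations of one term count as a
    single atom. *)
Ltac zm_mem x l :=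
  match l with
  | @nil _ => constr:(@None nat)
  | ?y :: ?l' =>
    let r := match goal with
      | _ => let _ := match goal with _ => unify x y end in constr:(Some 0%N)
      | _ => let r' := zm_mem x l' in
             match r' with Some ?n => constr:(Some (S n)) | None => constr:(@None nat) end
      end in r
  end.
Ltac zm_atoms l t :=
  match t with
  | @GRing.add _ ?a ?b => let l1 := zm_atoms l a in zm_atoms l1 b
  | @GRing.opp _ ?a => zm_atoms l a
  | @GRing.zero _ => l
  | _ => let r := zm_mem t l in
         match r with Some _ => l | None => constr:(t :: l) end
  end.
Ltac zm_reify l t :=
  match t with
  | @GRing.add _ ?a ?b => let x := zm_reify l a in let y := zm_reify l b in constr:(ZAdd x y)
  | @GRing.opp _ ?a => let x := zm_reify l a in constr:(ZOpp x)
  | @GRing.zero _ => constr:(ZZero)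
  | _ => let r := zm_mem t l in match r with Some ?n => constr:(ZVar n) end
  end.
Ltac zmod :=
  match goal with
  | |- @eq ?T ?a ?b =>
    let l := zm_atoms (@nil T) a in let l := zm_atoms l b in
    let x := zm_reify l a in let y := zm_reify l b in
    exact: (@zval_eq _ l x y isT)
  end.

(** * Homotopies and the derived category *)

(* A family indexed by the integers is given by its terms at n + 1, the only ones
   in which differentials and homotopies are type-correct. *)
Lemma desc (T : int -> Type) (f : forall n, T (n + 1)) :
  {g : forall n, T n | forall n, g (n + 1) = f n}.
Proof.
exists (fun n => eq_rect (n - 1 + 1) T (f (n - 1)) n (subrK 1 n)) => n.
have E : forall n' (e : n' = n) (e' : n' + 1 = n + 1), eq_rect (n' + 1) T (f n') (n + 1) e' = f n.
  by move=> n' e; subst n' => e'; rewrite (Prop_irrelevance e' erefl).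
exact: E (addrK 1 n) _.
Qed.

Lemma intS_ind (P : int -> Prop) : (forall n, P (n + 1)) -> forall n, P n.
Proof. by move=> P1 n; rewrite -(subrK 1 n). Qed.

Section Basics.
Variables (k : fieldType) (U : finGroupType -> Prop).

Lemma linear_ext (V W : lmodType k) (f g : {linear V -> W}) : f =1 g -> f = g.
Proof.
case: f g => [f cf] [g cg] /= /funext fg; subst g; congr GRing.Linear.Pack.
case: cf cg => [[a1] [b1]] [[a2] [b2]].
rewrite (Prop_irrelevance a1 a2) (Prop_irrelevance b1 b2); reflexivity.
Qed.

Lemma rhom_ext (X Y : rep k U) (f g : rhom X Y) : (forall G, f G =1 g G) -> f = g.
Proof.
case: f g => [f fn] [g gn] /= fg.
have e : f = g by apply: functional_extensionality_dep => G; apply: linear_ext => x; apply: fg.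
by subst g; congr RHom; apply: Prop_irrelevance.
Qed.

Lemma cmap_ext (X Y : cplx k U) (f g : cmap X Y) : (forall n G, f n G =1 g n G) -> f = g.
Proof.
case: f g => [f fn] [g gn] /= fg.
have e : f = g by apply: functional_extensionality_dep => n; apply: rhom_ext; apply: fg.
by subst g; congr CMap; apply: Prop_irrelevance.
Qed.

Definition mkrhom (X Y : rep k U) (f : forall G, X G -> Y G)
  (fL : forall G, linear (f G))
  (fN : forall (G H : grp U) (a : epi G H) x, f G (ract X a x) = ract Y a (f H x)) : rhom X Y :=
  @RHom k U X Y (fun G => mklin (fL G)) fN.

Fact rscale_nat (X Y : rep k U) (c : k) (f : rhom X Y) (G H : grp U) (a : epi G H) x :
  c *: f G (ract X a x) = ract Y a (c *: f H x).
Proof. by rewrite rnat linearZ. Qed.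
Fact rscale_lin (X Y : rep k U) (c : k) (f : rhom X Y) (G : grp U) :
  linear (fun x => c *: f G x).
Proof. by move=> a x y; rewrite linearP scalerDr !scalerA mulrC. Qed.
Definition rscale (X Y : rep k U) (c : k) (f : rhom X Y) : rhom X Y :=
  mkrhom (@rscale_lin X Y c f) (@rscale_nat X Y c f).

Fact cscale_d (X Y : cplx k U) (c : k) (f : cmap X Y) n G x :
  rscale c (f n) G (cd X n G x) = cd Y n G (rscale c (f (n + 1)) G x).
Proof. by rewrite /= cfd linearZ. Qed.
Definition cscale (X Y : cplx k U) c (f : cmap X Y) : cmap X Y := CMap (@cscale_d X Y c f).
Definition csub (X Y : cplx k U) (f g : cmap X Y) := cmap_add f (cscale (-1) g).

Lemma csubE (X Y : cplx k U) (f g : cmap X Y) n G x : csub f g n G x = f n G x - g n G x.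
Proof. by rewrite /= scaleN1r. Qed.

Definition null (X Y : cplx k U) (f : cmap X Y) : Prop :=
  exists h : forall n, rhom (X n) (Y (n + 1)), forall n G (x : X (n + 1) G),
    f (n + 1) G x = cd Y (n + 1) G (h (n + 1) G x) + h n G (cd X n G x).

Definition htpy (X Y : cplx k U) (f g : cmap X Y) := null (csub f g).

Lemma null0 (X Y : cplx k U) : null (cmap_zero X Y).
Proof. by exists (fun n => rzero (X n) (Y (n + 1))) => n G x /=; rewrite linear0 addr0. Qed.

Lemma null_ext (X Y : cplx k U) (f g : cmap X Y) :
  (forall n G x, f n G x = g n G x) -> null f -> null g.
Proof. by move=> /cmap_ext ->. Qed.

Lemma null_eq0 (X Y : cplx k U) (f : cmap X Y) : (forall n G x, f n G x = 0) -> null f.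
Proof. by move=> f0; apply: null_ext (null0 X Y) => n G x; rewrite f0. Qed.

Lemma null_add (X Y : cplx k U) (f g : cmap X Y) : null f -> null g -> null (cmap_add f g).
Proof.
move=> [h hE] [l lE]; exists (fun n => radd (h n) (l n)) => n G x.
by rewrite /= hE lE linearD addrACA.
Qed.

Lemma null_scale (X Y : cplx k U) c (f : cmap X Y) : null f -> null (cscale c f).
Proof.
move=> [h hE]; exists (fun n => rscale c (h n)) => n G x.
by rewrite /= hE linearZ scalerDr.
Qed.

Lemma null_compl (X Y Z : cplx k U) (g : cmap Y Z) (f : cmap X Y) :
  null f -> null (cmap_comp g f).
Proof.
move=> [h hE]; exists (fun n => rcomp (g (n + 1)) (h n)) => n G x.
by rewrite /= hE linearD cfd.
Qed.

Lemma null_compr (X Y Z : cplx k U) (g : cmap Y Z) (f : cmap X Y) :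
  null g -> null (cmap_comp g f).
Proof.
move=> [h hE]; exists (fun n => rcomp (h n) (f n)) => n G x.
by rewrite /= hE cfd.
Qed.

Lemma htpy_refl (X Y : cplx k U) (f : cmap X Y) : htpy f f.
Proof. by apply: null_eq0 => n G x; rewrite csubE subrr. Qed.

Lemma htpy_sym (X Y : cplx k U) (f g : cmap X Y) : htpy f g -> htpy g f.
Proof.
move=> /(null_scale (-1)); apply: null_ext => n G x.
by rewrite /= !scaleN1r opprB.
Qed.

Lemma htpy_trans (X Y : cplx k U) (f g h : cmap X Y) : htpy f g -> htpy g h -> htpy f h.
Proof.
move=> fg gh; apply: null_ext (null_add fg gh) => n G x.
by rewrite /= !scaleN1r addrA subrK.
Qed.

Lemma htpy_compl (X Y Z : cplx k U) (g : cmap Y Z) (f f' : cmap X Y) :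
  htpy f f' -> htpy (cmap_comp g f) (cmap_comp g f').
Proof.
move=> /(null_compl g); apply: null_ext => n G x.
by rewrite /= !scaleN1r linearB.
Qed.

Lemma htpy_add (X Y : cplx k U) (f f' g g' : cmap X Y) :
  htpy f f' -> htpy g g' -> htpy (cmap_add f g) (cmap_add f' g').
Proof.
move=> ff gg; apply: null_ext (null_add ff gg) => n G x.
by rewrite /= !scaleN1r opprD addrACA.
Qed.

Lemma htpy_null (X Y : cplx k U) (f g : cmap X Y) : htpy f g -> null g -> null f.
Proof.
move=> fg ng; apply: null_ext (null_add fg ng) => n G x.
by rewrite /= scaleN1r subrK.
Qed.

Lemma null_htpy0 (X Y : cplx k U) (f : cmap X Y) : null f <-> htpy f (cmap_zero X Y).
Proof.
split=> [nf|/htpy_null]; last by apply; apply: null0.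
by apply: null_ext nf => n G x; rewrite csubE subr0.
Qed.

Definition acyclic (A : cplx k U) := forall n G (x : A (n + 1) G), cd A n G x = 0 ->
  exists y, x = cd A (n + 1) G y.

Lemma fib_id_acyclic (X : cplx k U) : acyclic (fib (cmap_id X)).
Proof.
move=> n G [x y] /= [dx /eqP]; rewrite subr_eq0 => /eqP xy.
by exists (y, 0); rewrite /= linear0 subr0 -xy.
Qed.

Lemma acyclic_qis0 (A : cplx k U) : acyclic A -> quasi_iso (cmap_zero A A).
Proof.
move=> acA n G; split=> [x /acA //|y /acA [y' ->]].
by exists 0; [rewrite linear0|exists y'; rewrite linear0 add0r].
Qed.

(** On an acyclic complex the zero map is a quasi-isomorphism; its formal inverse composed with it
    is both the identity and zero. *)
Lemma deq_acyclic (A : cplx k U) : acyclic A -> deq (did A) (dzero A A).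
Proof.
move=> /acyclic_qis0 sq; apply: deq_trans (deq_sym (deq_invl sq)) _.
apply: deq_trans (deq_comp (deq_refl _) (deq_map_zero _ _)) _.
exact: deq_comp0r.
Qed.

Fact rpair_lin (Z X Y : rep k U) (f : rhom Z X) (g : rhom Z Y) G :
  linear (fun z => (f G z, g G z) : rprod X Y G).
Proof. by move=> a x y; congr pair; rewrite /= linearP. Qed.
Fact rpair_nat (Z X Y : rep k U) (f : rhom Z X) (g : rhom Z Y) (G H : grp U) (a : epi G H) x :
  (f G (ract Z a x), g G (ract Z a x)) = ract (rprod X Y) a (f H x, g H x).
Proof. by rewrite !rnat. Qed.
Definition rpair (Z X Y : rep k U) (f : rhom Z X) (g : rhom Z Y) : rhom Z (rprod X Y) :=
  mkrhom (@rpair_lin Z X Y f g) (@rpair_nat Z X Y f g).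

Definition rfst (X Y : rep k U) : rhom (rprod X Y) X :=
  @mkrhom (rprod X Y) X (fun G x => x.1) (fun G a x y => erefl) (fun G H a x => erefl).
Definition rsnd (X Y : rep k U) : rhom (rprod X Y) Y :=
  @mkrhom (rprod X Y) Y (fun G x => x.2) (fun G a x y => erefl) (fun G H a x => erefl).

Fact fib_fst_d (X Y : cplx k U) (f : cmap X Y) n G x :
  rfst (X n) (Y (n + 1)) G (cd (fib f) n G x) =
  cd X n G (rfst (X (n + 1)) (Y (n + 1 + 1)) G x).
Proof. by []. Qed.
Definition fib_fst (X Y : cplx k U) (f : cmap X Y) : cmap (fib f) X := CMap (@fib_fst_d X Y f).

(** A null homotopy h makes (f, h) a chain map to the fibre of the identity of [Y]. So f factors
    through an acyclic complex, whose identity is already zero. *)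
Lemma null_deq0 (X Y : cplx k U) (f : cmap X Y) : null f -> deq (dmap f) (dzero X Y).
Proof.
move=> [h hE].
have Fd n G x : rpair (f n) (h n) G (cd X n G x) =
   cd (fib (cmap_id Y)) n G (rpair (f (n + 1)) (h (n + 1)) G x).
  by rewrite /= cfd hE [X in (_, X - _)]addrC addrK.
pose F := @CMap k U X (fib (cmap_id Y)) (fun n => rpair (f n) (h n)) Fd.
have -> : f = cmap_comp (fib_fst (cmap_id Y)) F by apply: cmap_ext.
apply: deq_trans (deq_map_comp _ _) _.
apply: deq_trans (deq_comp (deq_sym (deq_idr _)) (deq_refl _)) _.
apply: deq_trans (deq_comp (deq_comp (deq_refl _) (deq_acyclic (@fib_id_acyclic Y))) (deq_refl _)) _.
apply: deq_trans (deq_comp (deq_comp0r _ _) (deq_refl _)) _.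
exact: deq_comp0l.
Qed.

Lemma htpy_deq (X Y : cplx k U) (f g : cmap X Y) : htpy f g -> deq (dmap f) (dmap g).
Proof.
move=> fg; have -> : f = cmap_add (csub f g) g.
  by apply: cmap_ext => n G x; rewrite /= scaleN1r subrK.
apply: deq_trans (deq_map_add _ _) _.
apply: deq_trans (deq_add (null_deq0 fg) (deq_refl _)) _.
exact: deq_add0.
Qed.

End Basics.

(** * K-projective complexes *)

Section Kproj.
Variables (k : fieldType) (U : finGroupType -> Prop).

(** A chain map as a bigraded family supported on the diagonal, the form in which [Kproj] takes its
    input. *)
Definition rdiag (T A : cplx k U) (u : forall n, rhom (T n) (A n)) m n : rhom (T m) (A n) :=
  match pselect (m = n) with
  | left e => eq_rect m (fun n => rhom (T m) (A n)) (u m) n e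
  | right _ => rzero (T m) (A n)
  end.

Lemma rdiagE (T A : cplx k U) (u : forall n, rhom (T n) (A n)) n : rdiag u n n = u n.
Proof.
by rewrite /rdiag; case: pselect => // e; rewrite (Prop_irrelevance e erefl).
Qed.

Lemma rdiag_ne (T A : cplx k U) (u : forall n, rhom (T n) (A n)) m n :
  m <> n -> rdiag u m n = rzero _ _.
Proof. by rewrite /rdiag; case: pselect. Qed.

Lemma rdiag_d (T A : cplx k U) (u : cmap T A) m n G x :
  rdiag u m n G (cd T m G x) = cd A n G (rdiag u (m + 1) (n + 1) G x).
Proof.
case: (eqVneq m n) => [e|/eqP mn]; first by subst n; rewrite !rdiagE cfd.
by rewrite !rdiag_ne //= ?linear0 // => /addIr.
Qed.

(* A single sign e covers maps of all degrees at once: c m n is the part of c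
   going from degree m to degree n, so that no shift of complexes is needed. *)
Definition Kproj (T : cplx k U) := forall A : cplx k U, acyclic A ->
  forall e : k, e * e = 1 -> forall c : (forall m n, rhom (T m) (A n)),
  (forall m n G x, c m n G (cd T m G x) = e *: cd A n G (c (m + 1) (n + 1) G x)) ->
  exists h : forall m n, rhom (T m) (A n), forall m n G x,
    c (m + 1) n G x = cd A n G (h (m + 1) (n + 1) G x) + e *: h m n G (cd T m G x).

Lemma Kproj_null (T A : cplx k U) (u : cmap T A) : Kproj T -> acyclic A -> null u.
Proof.
move=> KT acA; case: (KT A acA 1 (mul1r 1) (rdiag u)) => [m n G x|h hE].
  by rewrite scale1r rdiag_d.
by exists (fun n => h n (n + 1)) => n G x; rewrite -rdiagE hE scale1r.
Qed.

Lemma qis_fib (X Y : cplx k U) (s : cmap X Y) : quasi_iso s -> acyclic (fib s).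
Proof.
move=> sq n G [x y] /= [dx /eqP]; rewrite subr_eq0 => /eqP sx.
have [x1 x1E] := (sq n G).1 x dx (ex_intro _ y sx).
have dy : cd Y (n + 1) G (y - s (n + 1 + 1) G x1) = 0.
  by rewrite linearB -sx x1E cfd subrr.
have [x' dx' [y' y'E]] := (sq (n + 1) G).2 _ dy.
exists (x1 + x', - y'); congr pair => /=; first by rewrite linearD dx' addr0.
by rewrite linearD linearN opprK -[y in LHS](subrK (s (n + 1 + 1) G x1)) y'E [LHS]addrC addrA.
Qed.

Lemma fib_qis (X Y : cplx k U) (s : cmap X Y) : acyclic (fib s) -> quasi_iso s.
Proof.
move=> ac n G; split=> [x dx [y sx]|y dy].
  have [[x' y'] [-> _]] : exists z, (x, y) = cd (fib s) (n + 1) G z.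
    by apply: ac; rewrite /= dx sx subrr.
  by exists x'.
move: n y dy; apply: intS_ind => n y dy.
have [[x' y'] [dx' yE]] : exists z, (0, y) = cd (fib s) (n + 1) G z.
  by apply: ac; rewrite /= dy subr0 !linear0.
by exists x' => //; exists (- y'); rewrite linearN.
Qed.

(** The family (0, u) into the acyclic fibre of s lowers the degree by one, hence the sign -1. In a
    contraction of it, the first component is the lift v and the second the homotopy from s v to
    u. *)
Lemma Kproj_lift (T X Y : cplx k U) (s : cmap X Y) (u : cmap T Y) :
  Kproj T -> quasi_iso s -> exists v : cmap T X, htpy (cmap_comp s v) u.
Proof.
move=> KT /qis_fib ac.
pose c m n : rhom (T m) (fib s n) := rpair (rzero (T m) (X n)) (rdiag u m (n + 1)).
case: (KT _ ac (-1) _ c) => [|m n G x|h hE]; first by rewrite mulrNN mulr1.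
  by rewrite /= !linear0 sub0r rdiag_d scaleN1r; congr pair; rewrite /= ?opprK ?oppr0.
have h1 n G x : (h n n G (cd T n G x)).1 = cd X n G (h (n + 1) (n + 1) G x).1.
  have /(congr1 (fun z : fib s n G => z.1)) /= := hE n n G x.
  by rewrite scaleN1r => /eqP; rewrite eq_sym subr_eq0 => /eqP.
exists (@CMap k U T X (fun n => rcomp (rfst _ _) (h n n)) h1).
exists (fun n => rcomp (rsnd _ _) (h n n)) => n G x.
have /(congr1 (fun z : fib s n G => z.2)) /= := hE n n G x.
rewrite rdiagE scaleN1r => ->; rewrite scaleN1r !opprD !opprK.
by rewrite addrA addrA subrr add0r.
Qed.

(** A null homotopy of s v lifts v to the acyclic fibre of s, and every map from [T] to an acyclic
    complex is null. *)
Lemma Kproj_inj (T X Y : cplx k U) (s : cmap X Y) (v : cmap T X) :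
  Kproj T -> quasi_iso s -> null (cmap_comp s v) -> null v.
Proof.
move=> KT /qis_fib ac [h hE].
have Fd n G x : rpair (v n) (h n) G (cd T n G x) =
   cd (fib s) n G (rpair (v (n + 1)) (h (n + 1)) G x).
  by rewrite /= cfd; have /= -> := hE n G x; rewrite [X in (_, X - _)]addrC addrK.
pose F := @CMap k U T (fib s) (fun n => rpair (v n) (h n)) Fd.
by have := null_compl (fib_fst s) (Kproj_null F KT ac); apply: null_ext.
Qed.

Section Act.
Variables (T : cplx k U) (KT : Kproj T).

(** The functor of homotopy classes of maps from [T] inverts quasi-isomorphisms, so it interprets
    formal morphisms; [act_deq] is its soundness. An inverse acts by a chosen lift, which is why all
    laws hold only up to homotopy. *)
Fixpoint act X Y (f : dhom X Y) : cmap T X -> cmap T Y :=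
  match f with
  | dmap X Y g => fun u => cmap_comp g u
  | dinv X Y s sq => fun u => sval (cid (Kproj_lift u KT sq))
  | dcomp X Y Z g f => fun u => act g (act f u)
  | dzero X Y => fun u => cmap_zero T Y
  | dadd X Y f g => fun u => cmap_add (act f u) (act g u)
  end.

Lemma act_inv X Y (s : cmap X Y) (sq : quasi_iso s) u :
  htpy (cmap_comp s (act (dinv sq) u)) u.
Proof. by rewrite /=; case: cid. Qed.

Lemma act_inj X Y (s : cmap X Y) (v v' : cmap T X) : quasi_iso s ->
  htpy (cmap_comp s v) (cmap_comp s v') -> htpy v v'.
Proof.
move=> sq e; apply: (Kproj_inj KT sq); apply: null_ext e => n G x.
by rewrite /= !scaleN1r linearB.
Qed.

Lemma act_htpy X Y (f : dhom X Y) u u' : htpy u u' -> htpy (act f u) (act f u').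
Proof.
elim: f u u' => {X Y} [X Y g|X Y s sq|X Y Z g IHg f IHf|X Y|X Y f IHf g IHg] u u' uu.
- exact: htpy_compl.
- apply: (act_inj sq); apply: htpy_trans (act_inv sq _) _.
  by apply: htpy_trans uu (htpy_sym (act_inv sq _)).
- exact/IHg/IHf.
- exact: htpy_refl.
- exact: htpy_add (IHf _ _ uu) (IHg _ _ uu).
Qed.

Lemma cmap_comp_addr X Y (g : cmap X Y) (u v : cmap T X) :
  cmap_comp g (cmap_add u v) = cmap_add (cmap_comp g u) (cmap_comp g v).
Proof. by apply: cmap_ext => n G x; rewrite /= linearD. Qed.

Lemma act_add X Y (f : dhom X Y) u u' :
  htpy (act f (cmap_add u u')) (cmap_add (act f u) (act f u')).
Proof.
elim: f u u' => {X Y} [X Y g|X Y s sq|X Y Z g IHg f IHf|X Y|X Y f IHf g IHg] u u'.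
- by rewrite /= cmap_comp_addr; apply: htpy_refl.
- apply: (act_inj sq); apply: htpy_trans (act_inv sq _) _; rewrite cmap_comp_addr.
  by apply: htpy_sym; apply: htpy_add; apply: act_inv.
- exact: htpy_trans (act_htpy g (IHf _ _)) (IHg _ _).
- by apply: null_eq0 => n G x; rewrite csubE /= addr0 subr0.
- apply: htpy_trans (htpy_add (IHf _ _) (IHg _ _)) _; apply: null_eq0 => n G x.
  by rewrite csubE /= addrACA subrr.
Qed.

Lemma act_zero X Y (f : dhom X Y) : htpy (act f (cmap_zero T X)) (cmap_zero T Y).
Proof.
have := act_add f (cmap_zero T X) (cmap_zero T X).
have -> : cmap_add (cmap_zero T X) (cmap_zero T X) = cmap_zero T X.
  by apply: cmap_ext => n G x; rewrite /= addr0.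
move=> /(null_scale (-1)); apply: null_ext => n G x.
by rewrite /= !scaleN1r opprB addrK subr0.
Qed.

Lemma act_deq X Y (f g : dhom X Y) : deq f g -> forall u, htpy (act f u) (act g u).
Proof.
elim=> {X Y f g} [X Y f|X Y f g _ IH|X Y f g h _ IH1 _ IH2|X Y Z g g' f f' _ IHg _ IHf
  |X Y f f' g g' _ IHf _ IHg|X Y Z T' h g f|X Y f|X Y f|X Y Z g f|X Y s sq|X Y s sq
  |X Y f g h|X Y f g|X Y f|X Y Z g g' f|X Y Z g f f'|X Y Z f|X Y Z g|X Y f g|X Y] u /=.
- exact: htpy_refl.
- exact: htpy_sym.
- exact: htpy_trans (IH1 u) (IH2 u).
- exact: htpy_trans (act_htpy g (IHf u)) (IHg _).
- exact: htpy_add.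
- exact: htpy_refl.
- by apply: null_eq0 => n G x; rewrite csubE subrr.
- by apply: act_htpy; apply: null_eq0 => n G x; rewrite csubE subrr.
- by apply: null_eq0 => n G x; rewrite csubE subrr.
- by apply: (act_inj sq); apply: htpy_trans (act_inv sq _) _; apply: null_eq0 => n G x; rewrite csubE subrr.
- apply: htpy_trans (act_inv sq u) _.
  by apply: null_eq0 => n G x; rewrite csubE subrr.
- by apply: null_eq0 => n G x; rewrite csubE /= addrA subrr.
- by apply: null_eq0 => n G x; rewrite csubE /= [X in _ - X]addrC subrr.
- by apply: null_eq0 => n G x; rewrite csubE /= add0r subrr.
- exact: htpy_refl.
- exact: act_add.
- exact: htpy_refl.
- exact: act_zero.
- by apply: null_eq0 => n G x; rewrite csubE /= subrr.
- by apply: null_eq0 => n G x; rewrite csubE /= subrr.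
Qed.

(** With u the identity: every morphism out of [T] is represented by a chain map, unique up to
    homotopy by [act_deq]. *)
Lemma act_dmap X Y (f : dhom X Y) (u : cmap T X) : deq (dcomp f (dmap u)) (dmap (act f u)).
Proof.
elim: f u => {X Y} [X Y g|X Y s sq|X Y Z g IHg f IHf|X Y|X Y f IHf g IHg] u.
- exact/deq_sym/deq_map_comp.
- have := htpy_deq (act_inv sq u); move: (act _ u) => v e.
  apply: deq_trans (deq_comp (deq_refl _) (deq_sym e)) _.
  apply: deq_trans (deq_comp (deq_refl _) (deq_map_comp _ _)) _.
  apply: deq_trans (deq_compA _ _ _) _.
  apply: deq_trans (deq_comp (deq_invl _) (deq_refl _)) _.
  exact: deq_idl.
- apply: deq_trans (deq_sym (deq_compA _ _ _)) _.
  exact: deq_trans (deq_comp (deq_refl _) (IHf _)) (IHg _).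
- exact: deq_trans (deq_comp0l _ _) (deq_sym (deq_map_zero _ _)).
- apply: deq_trans (deq_compDl _ _ _) _.
  exact: deq_trans (deq_add (IHf _) (IHg _)) (deq_sym (deq_map_add _ _)).
Qed.

Lemma dmap_null Y (u : cmap T Y) : deq (dmap u) (dzero T Y) <-> null u.
Proof.
split=> [/act_deq/(_ (cmap_id T)) /= e|]; last exact: null_deq0.
by apply/null_htpy0; apply: null_ext e.
Qed.

End Act.
End Kproj.

(** * Coproducts and compactness *)

Section Dsum.
Variables (k : fieldType).

Section Out.
Variables (I : choiceType) (P : pred I) (V : I -> lmodType k) (W : lmodType k).
Variable (F : forall i, {linear V i -> W}).

Fact dsum_seq (x : dsum P V) : exists s : seq I, uniq s /\ forall i, i \notin s -> x i = 0.
Proof.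
have [/finite_seqP [s sE] _] := dvalP x; exists (undup s); split; first exact: undup_uniq.
move=> i; rewrite mem_undup => si; case: (eqVneq (x i) 0) => // xi.
have : [set i | x i != 0]%classic i by [].
by rewrite sE /= (negPf si).
Qed.

Definition dsum_out_fun (x : dsum P V) : W := \sum_(i <- sval (cid (dsum_seq x))) F i (x i).

Lemma dsum_outE (x : dsum P V) (s : seq I) : uniq s ->
  (forall i, i \notin s -> x i = 0) -> dsum_out_fun x = \sum_(i <- s) F i (x i).
Proof.
rewrite /dsum_out_fun; case: cid => t [ut xt] /= us xs.
have sumE r : (forall i, i \notin r -> x i = 0) ->
    \sum_(i <- r) F i (x i) = \sum_(i <- r | (i \in s) && (i \in t)) F i (x i).
  move=> xr; rewrite [LHS](bigID (fun i => (i \in s) && (i \in t))) /= [X in _ + X]big1 ?addr0 //.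
  by move=> i; rewrite negb_and => /orP [/xs|/xt] ->; rewrite linear0.
rewrite [LHS](sumE _ xt) [RHS](sumE _ xs) -big_filter -[RHS]big_filter.
apply: perm_big; apply: uniq_perm; rewrite ?filter_uniq // => i.
by rewrite !mem_filter; case: (i \in s); case: (i \in t).
Qed.

Fact dsum_out_linear : linear dsum_out_fun.
Proof.
move=> a x y; have [s [us xs]] := dsum_seq x; have [t [ut yt]] := dsum_seq y.
have ur : uniq (undup (s ++ t)) by apply: undup_uniq.
have nr i : i \notin undup (s ++ t) -> i \notin s /\ i \notin t.
  by rewrite mem_undup mem_cat negb_or => /andP.
rewrite !(dsum_outE ur) => [|i /nr [_ /yt] //|i /nr [/xs] //|i /nr [si ti]]; last first.
  by rewrite dsumDE dsumZE xs // yt // scaler0 addr0.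
rewrite scaler_sumr -big_split; apply: eq_bigr => i _ /=.
by rewrite linearD linearZ.
Qed.
Definition dsum_out : {linear dsum P V -> W} := mklin dsum_out_linear.

End Out.
End Dsum.

Section RepSum.
Variables (k : fieldType) (U : finGroupType -> Prop).
Implicit Types (A B : rep k U).

Section Gen.
Variables (I : Type) (P : pred I) (X : I -> rep k U).

Definition rproj i : rhom (rsum P X) (X i) :=
  @mkrhom k U (rsum P X) (X i) (fun G x => x i) (fun G a x y => erefl) (fun G H a x => erefl).

Variables (Z : rep k U) (f : forall i, rhom Z (X i)).
Hypothesis fP : forall G z, dsum_pred P (fun i => f i G z).
Fact rinto_lin G : linear (fun z => DSum (fP z) : rsum P X G).
Proof. by move=> a x y; apply: dsum_inj => i /=; rewrite linearP. Qed.
Fact rinto_nat (G H : grp U) (a : epi G H) z :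
  (DSum (fP (ract Z a z)) : rsum P X G) = ract (rsum P X) a (DSum (fP z) : rsum P X H).
Proof. by apply: dsum_inj => i /=; rewrite rnat. Qed.
Definition rinto : rhom Z (rsum P X) := @mkrhom k U Z (rsum P X) _ rinto_lin rinto_nat.
End Gen.

Lemma rtrunc_subproof (I : Type) (P : pred I) (X : I -> rep k U) (Q : I -> Prop) G (x : rsum P X G) :
  dsum_pred P (fun i => (if `[< Q i >] then rid (X i) else rzero (X i) (X i)) G (rproj P X i G x)).
Proof.
case: (dvalP x) => xf x0; split=> [|i Pi]; last by rewrite /= x0 // linear0.
apply: sub_finite_set xf => i /=; case: ifP => //= _; by rewrite eqxx.
Qed.
Definition rtrunc (I : Type) (P : pred I) (X : I -> rep k U) (Q : I -> Prop) : rhom (rsum P X) (rsum P X) :=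
  rinto (f := fun i => rcomp (if `[< Q i >] then rid (X i) else rzero (X i) (X i)) (rproj P X i))
    (@rtrunc_subproof I P X Q).

Lemma rtruncE (I : Type) (P : pred I) (X : I -> rep k U) (Q : I -> Prop) G (x : rsum P X G) i :
  rtrunc P X Q G x i = if `[< Q i >] then x i else 0.
Proof. by rewrite /=; case: ifP. Qed.

Section OutRep.
Variables (I : choiceType) (P : pred I) (X : I -> rep k U) (A : rep k U).
Variable (f : forall i, rhom (X i) A).
Fact rout_nat (G H : grp U) (a : epi G H) x :
  dsum_out P (fun i => f i G) (ract (rsum P X) a x) =
  ract A a (dsum_out P (fun i => f i H) x).
Proof.
have [s [us xs]] := dsum_seq x.
rewrite /= (dsum_outE _ us) => [|i /xs /= ->]; last by rewrite linear0.
rewrite (dsum_outE _ us xs) linear_sum; apply: eq_bigr => i _ /=.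
by rewrite rnat.
Qed.
Definition rout : rhom (rsum P X) A := @RHom k U (rsum P X) A _ rout_nat.

Lemma routE G (x : rsum P X G) (s : seq I) : uniq s ->
  (forall i, i \notin s -> x i = 0) -> rout G x = \sum_(i <- s) f i G (x i).
Proof. exact: dsum_outE. Qed.

Lemma rout1 G (x : rsum P X G) i : (forall j, j != i -> x j = 0) -> rout G x = f i G (x i).
Proof.
move=> xi; rewrite (@routE _ _ [:: i]) // ?big_seq1 // => j.
by rewrite inE => /xi.
Qed.
End OutRep.

Section In.
Variables (I : Type) (X : I -> rep k U) (i : I).
Fact rin_nat (G H : grp U) (a : epi G H) x :
  dsum_in (fun j => X j G) i (ract (X i) a x) =
  ract (rsum predT X) a (dsum_in (fun j => X j H) i x).
Proof.
apply: dsum_inj => j /=; rewrite /dsum_in_fun.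
by case: pselect => [e|_]; [case: j / e|rewrite linear0].
Qed.
Definition rin : rhom (X i) (rsum predT X) :=
  @RHom k U (X i) (rsum predT X) (fun G => dsum_in (fun j => X j G) i) rin_nat.
End In.

Lemma dsum_in_id (I : Type) (V : I -> lmodType k) i (v : V i) : dsum_in_fun v i = v.
Proof. by rewrite /dsum_in_fun; case: pselect => // e; rewrite (Prop_irrelevance e erefl). Qed.
Lemma dsum_in_ne (I : Type) (V : I -> lmodType k) i j (v : V i) : i <> j -> dsum_in_fun v j = 0.
Proof. by rewrite /dsum_in_fun; case: pselect. Qed.

Lemma rin_out (I : choiceType) (X : I -> rep k U) A (f : forall i, rhom (X i) A) i G (x : X i G) :
  rout predT f G (rin X i G x) = f i G x.
Proof.
rewrite (@rout1 _ _ _ _ _ _ _ i) ?[X in f i G X]dsum_in_id //.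
by move=> j /eqP ji; rewrite [LHS]dsum_in_ne // => /esym.
Qed.

End RepSum.

Section CplxSum.
Variables (k : fieldType) (U : finGroupType -> Prop).

Section Gen.
Variables (I : Type) (Z : I -> cplx k U).
Fact cproj_d i n G x : rproj predT (fun i => Z i n) i G (cd (coprod Z) n G x) =
  cd (Z i) n G (rproj predT (fun i => Z i (n + 1)) i G x).
Proof. by []. Qed.
Definition cproj i : cmap (coprod Z) (Z i) := @CMap k U (coprod Z) (Z i) (fun n => rproj predT _ i) (@cproj_d i).

Fact ctrunc_d (Q : I -> Prop) n G x : rtrunc predT (fun i => Z i n) Q G (cd (coprod Z) n G x) =
  cd (coprod Z) n G (rtrunc predT (fun i => Z i (n + 1)) Q G x).
Proof. by apply: dsum_inj => i /=; case: ifP => // _; rewrite /= linear0. Qed.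
Definition ctrunc Q : cmap (coprod Z) (coprod Z) :=
  @CMap k U (coprod Z) (coprod Z) (fun n => rtrunc predT _ Q) (@ctrunc_d Q).

Lemma ctruncE Q n G x i : ctrunc Q n G x i = if `[< Q i >] then x i else 0.
Proof. exact: rtruncE. Qed.
End Gen.

(** Compactness at the level of chain maps: outside finitely many summands, a map to a coproduct is
    null. *)
Definition hcompact (T : cplx k U) := forall (I : Type) (Z : I -> cplx k U) (g : cmap T (coprod Z)),
  exists2 S : I -> Prop, finite_set S & null (cmap_comp (ctrunc Z (fun i => ~ S i)) g).

Lemma in_trunc0 (I : Type) (Z : I -> cplx k U) i (Q : I -> Prop) : ~ Q i ->
  cmap_comp (ctrunc Z Q) (coprod_in Z i) = cmap_zero (Z i) (coprod Z).
Proof.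
move=> Qi; apply: cmap_ext => n G x; apply: dsum_inj => j.
rewrite [LHS]ctruncE; case: asboolP => // Qj.
by rewrite [LHS]dsum_in_ne // => ij; apply: Qi; rewrite ij.
Qed.

Lemma deq_sum_comp (X Y Y' : cplx k U) n (f : 'I_n -> dhom X Y) (g : dhom Y Y') :
  deq (dcomp g (\big[@dadd _ _ X Y/dzero X Y]_(j < n) f j))
      (\big[@dadd _ _ X Y'/dzero X Y']_(j < n) dcomp g (f j)).
Proof.
elim/big_ind2: _ => [|f1 f2 g1 g2 e1 e2|j _]; last exact: deq_refl.
  exact: deq_comp0r.
exact: deq_trans (deq_compDr _ _ _) (deq_add e1 e2).
Qed.

Lemma deq_comp_sum (X Y Y' : cplx k U) n (f : 'I_n -> dhom X Y) (g : dhom Y' X) :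
  deq (dcomp (\big[@dadd _ _ X Y/dzero X Y]_(j < n) f j) g)
      (\big[@dadd _ _ Y' Y/dzero Y' Y]_(j < n) dcomp (f j) g).
Proof.
elim/big_ind2: _ => [|f1 f2 g1 g2 e1 e2|j _]; last exact: deq_refl.
  exact: deq_comp0l.
exact: deq_trans (deq_compDl _ _ _) (deq_add e1 e2).
Qed.

Lemma deq_sum (X Y : cplx k U) n (f g : 'I_n -> dhom X Y) : (forall j, deq (f j) (g j)) ->
  deq (\big[@dadd _ _ X Y/dzero X Y]_(j < n) f j) (\big[@dadd _ _ X Y/dzero X Y]_(j < n) g j).
Proof.
move=> fg; elim/big_ind2: _ => [|f1 f2 g1 g2 e1 e2|j _]; last exact: fg.
  exact: deq_refl.
exact: deq_add.
Qed.

Lemma deq_sum0 (X Y : cplx k U) n (f : 'I_n -> dhom X Y) : (forall j, deq (f j) (dzero X Y)) ->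
  deq (\big[@dadd _ _ X Y/dzero X Y]_(j < n) f j) (dzero X Y).
Proof.
move=> f0; elim/big_ind: _ => [|f1 f2 e1 e2|j _]; last exact: f0.
  exact: deq_refl.
exact: deq_trans (deq_add e1 e2) (deq_add0 _).
Qed.

Lemma deq_sum_map (X Y : cplx k U) n (f : 'I_n -> cmap X Y) :
  deq (\big[@dadd _ _ X Y/dzero X Y]_(j < n) dmap (f j))
      (dmap (\big[@cmap_add _ _ X Y/cmap_zero X Y]_(j < n) f j)).
Proof.
elim/big_ind2: _ => [|f1 f2 g1 g2 e1 e2|j _]; last exact: deq_refl.
  exact: deq_sym (deq_map_zero _ _).
exact: deq_trans (deq_add e1 e2) (deq_sym (deq_map_add _ _)).
Qed.

Lemma cmap_sumE (X Y : cplx k U) m (f : 'I_m -> cmap X Y) n G x :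
  (\big[@cmap_add _ _ X Y/cmap_zero X Y]_(j < m) f j) n G x = \sum_(j < m) f j n G x.
Proof. by elim/big_ind2: _ => // f1 f2 g1 g2 /= -> ->. Qed.

(* The injectivity half of [compact] is automatic, by projecting to the summands. *)
Lemma compactP (X : cplx k U) : compact X <->
  forall (I : Type) (Y : I -> cplx k U) (g : dhom X (coprod Y)), exists2 S : I -> Prop, finite_set S &
    deq (dcomp (dmap (ctrunc Y (fun i => ~ S i))) g) (dzero X (coprod Y)).
Proof.
split=> [cX I Y g|cX I Y /=].
  have [/(_ g) [n [c [h [ci gE]]]] _] := cX I Y.
  exists (fun i => exists j, c j = i).
    apply: (@sub_finite_set _ _ [set c j | j in [set: 'I_n]]%classic); first by move=> i [j <-]; exists j.
    by apply: finite_image; apply: finite_finset.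
  apply: deq_trans (deq_comp (deq_refl _) gE) _.
  apply: deq_trans (deq_sum_comp _ _) _; apply: deq_sum0 => j.
  apply: deq_trans (deq_compA _ _ _) _.
  apply: deq_trans (deq_comp (deq_sym (deq_map_comp _ _)) (deq_refl _)) _.
  rewrite in_trunc0; last by apply; exists j.
  apply: deq_trans (deq_comp (deq_map_zero _ _) (deq_refl _)) _.
  exact: deq_comp0l.
split=> [g|n c h ci /= h0 j].
  have [S fS gS] := cX I Y g.
  have [s sE] := (@finite_seqP {classic I} S).1 fS.
  pose c (j : 'I_(size (undup s))) : I := tnth (in_tuple (undup s)) j.
  exists (size (undup s)), c, (fun j => dcomp (dmap (cproj Y (c j))) g); split.
    by apply/(tuple_uniqP (in_tuple (undup s))); apply: undup_uniq.
  (* The identity of the coproduct is the truncation away from S plus the finitely many idempotents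
     of the summands in S; the truncation kills g. *)
  have E : cmap_id (coprod Y) = cmap_add (ctrunc Y (fun i => ~ S i))
     (\big[@cmap_add _ _ _ _/cmap_zero (coprod Y) (coprod Y)]_(j < size (undup s))
        cmap_comp (coprod_in Y (c j)) (cproj Y (c j))).
    apply: cmap_ext => n G x; rewrite /= cmap_sumE; apply: dsum_inj => i.
    rewrite dsumDE rtruncE.
    have -> : (\sum_(j < size (undup s)) cmap_comp (coprod_in Y (c j)) (cproj Y (c j)) n G x) i =
      \sum_(j < size (undup s)) dsum_in_fun (V := fun i => Y i n G) (x (c j)) i.
      by elim/big_ind2: _ => // x1 x2 y1 y2; rewrite dsumDE => -> ->.
    have -> : \sum_(j < size (undup s)) dsum_in_fun (V := fun i => Y i n G) (x (c j)) i =
      \sum_(j <- (undup s : seq {classic I})) dsum_in_fun (V := fun i => Y i n G) (x j) i.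
      by rewrite [RHS]big_tnth.
    have iS : S i <-> (i : {classic I}) \in undup s by rewrite mem_undup sE.
    case: asboolP => [nSi|/contrapT/iS si].
      rewrite big1_seq ?addr0 // => j /andP [_ /= js]; apply: dsum_in_ne => ji.
      by apply: nSi; apply/iS; rewrite -ji.
    rewrite add0r (bigD1_seq (i : {classic I})) ?undup_uniq //= dsum_in_id big1 ?addr0 // => j /eqP ji.
    exact: dsum_in_ne.
  apply: deq_trans (deq_sym (deq_idl _)) _; rewrite /did E.
  apply: deq_trans (deq_comp (deq_map_add _ _) (deq_refl _)) _.
  apply: deq_trans (deq_compDl _ _ _) _.
  apply: deq_trans (deq_add gS (deq_refl _)) _.
  apply: deq_trans (deq_add0 _) _.
  apply: deq_trans (deq_comp (deq_sym (deq_sum_map _)) (deq_refl _)) _.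
  apply: deq_trans (deq_comp_sum _ _) _; apply: deq_sum => j.
  apply: deq_trans (deq_comp (deq_map_comp _ _) (deq_refl _)) _.
  exact: deq_sym (deq_compA _ _ _).
have := deq_comp (deq_refl (dmap (cproj Y (c j)))) h0.
move=> /(deq_trans (deq_sym (deq_sum_comp _ _))) e.
have {}e := deq_trans e (deq_comp0r _ _).
apply: deq_trans e; apply: deq_trans (deq_sym _) (deq_refl _).
apply: (@deq_trans _ _ _ _ _ (\big[@dadd _ _ X (Y (c j))/dzero X _]_(i < n)
  (if i == j then dcomp (dmap (cproj Y (c j))) (dcomp (dmap (coprod_in Y (c i))) (h i)) else dzero _ _))).
  apply: deq_sum => i; case: eqP => [_|ij]; first exact: deq_refl.
  apply: deq_trans (deq_compA _ _ _) _.
  apply: deq_trans (deq_comp (deq_sym (deq_map_comp _ _)) (deq_refl _)) _.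
  have -> : cmap_comp (cproj Y (c j)) (coprod_in Y (c i)) = cmap_zero _ _.
    by apply: cmap_ext => m G x; apply: dsum_in_ne => /ci.
  apply: deq_trans (deq_comp (deq_map_zero _ _) (deq_refl _)) _.
  exact: deq_comp0l.
have key m (f : 'I_m -> dhom X (Y (c j))) (i0 : 'I_m) :
   deq (\big[@dadd _ _ X (Y (c j))/dzero X _]_(i < m) (if i == i0 then f i else dzero _ _)) (f i0).
  elim: m f i0 => [f []//|m IHm f i0]; rewrite big_ord_recl.
  case: (unliftP ord0 i0) => [i1 ->|->].
    rewrite (negPf (neq_lift _ _)); apply: deq_trans (deq_add0 _) _.
    apply: deq_trans (IHm (fun i => f (lift ord0 i)) i1); apply: deq_sum => i.
    by rewrite (inj_eq lift_inj); apply: deq_refl.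
  rewrite eqxx; apply: deq_trans (deq_addC _ _) _.
  apply: deq_trans (deq_add _ (deq_refl _)) (deq_add0 _).
  by apply: deq_sum0 => i; apply: deq_refl.
apply: deq_trans (key _ _ j) _.
apply: deq_trans (deq_compA _ _ _) _.
apply: deq_trans (deq_comp (deq_sym (deq_map_comp _ _)) (deq_refl _)) _.
have -> : cmap_comp (cproj Y (c j)) (coprod_in Y (c j)) = cmap_id _.
  by apply: cmap_ext => m G x; apply: dsum_in_id.
exact: deq_idl.
Qed.

(** A morphism out of [X] is one out of [T] through q, hence a chain map by [act_dmap]; [dmap_null]
    turns its vanishing into a null homotopy. *)
Lemma hcompact_compact (T X : cplx k U) (q : cmap T X) : Kproj T -> quasi_iso q ->
  hcompact T <-> compact X.
Proof.
move=> KT qq; rewrite compactP; split=> [hT I Z g|cX I Z g].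
  have [S fS nS] := hT I Z (act KT g q).
  exists S => //; apply: deq_trans (deq_sym (deq_idr _)) _.
  apply: deq_trans (deq_comp (deq_refl _) (deq_sym (deq_invr qq))) _.
  apply: deq_trans (deq_compA _ _ _) _.
  apply: deq_trans (deq_comp (deq_trans (deq_sym (deq_compA _ _ _)) _) (deq_refl _)) (deq_comp0l _ _).
  apply: deq_trans (deq_comp (deq_refl _) (act_dmap KT g q)) _.
  exact: deq_trans (deq_sym (deq_map_comp _ _)) (null_deq0 nS).
have [S fS gS] := cX I Z (dcomp (dmap g) (dinv qq)).
exists S => //; apply/(dmap_null KT); apply: deq_trans (deq_map_comp _ _) _.
apply: deq_trans (deq_comp (deq_refl _) (deq_trans (deq_sym (deq_idr _)) (deq_comp (deq_refl _) (deq_sym (deq_invl qq))))) _.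
apply: deq_trans (deq_comp (deq_refl _) (deq_compA _ _ _)) _.
apply: deq_trans (deq_compA _ _ _) _.
exact: deq_trans (deq_comp gS (deq_refl _)) (deq_comp0l _ _).
Qed.

Lemma compact_retract (X Y : cplx k U) : retract X Y -> compact Y -> compact X.
Proof.
move=> [i [r ri]] /compactP cY; apply/compactP => I Z g.
have [S fS gS] := cY I Z (dcomp g r); exists S => //.
apply: deq_trans (deq_comp (deq_refl _) (deq_trans (deq_sym (deq_idr _)) (deq_comp (deq_refl _) (deq_sym ri)))) _.
apply: deq_trans (deq_comp (deq_refl _) (deq_compA _ _ _)) _.
apply: deq_trans (deq_compA _ _ _) _.
exact: deq_trans (deq_comp gS (deq_refl _)) (deq_comp0l _ _).
Qed.

Lemma compact_zero (X : cplx k U) : deq (did X) (dzero X X) -> compact X.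
Proof.
move=> X0; apply/compactP => I Z g; exists (fun _ => False); first exact: finite_set0.
apply: deq_trans (deq_comp (deq_refl _) (deq_trans (deq_sym (deq_idr _)) (deq_comp (deq_refl _) X0))) _.
exact: deq_trans (deq_comp (deq_refl _) (deq_comp0r _ _)) (deq_comp0r _ _).
Qed.

End CplxSum.

(** * Representable diagrams *)

Lemma dchoice (A : Type) (B : A -> Type) (P : forall x, B x -> Prop) :
  (forall x, exists y, P x y) -> exists f : forall x, B x, forall x, P x (f x).
Proof.
by move=> h; exists (fun x => sval (cid (h x))) => x; case: cid.
Qed.

Lemma dchoiceT (A B : Type) (P : A -> B -> Prop) :
  (forall x, exists y, P x y) -> exists f : A -> B, forall x, P x (f x).
Proof. exact: dchoice. Qed.

Section Epi.

Definition mkepi (G H : finGroupType) (f : G -> H) (fM : {morph f : x y / (x * y)%g})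
    (fS : forall y, exists x, f x = y) : epi G H :=
  @Epi G H (HB.pack f (isMultiplicative.Build G H f fM)) fS.

Lemma epiM (G H : finGroupType) (a : epi G H) : {morph a : x y / (x * y)%g}.
Proof. exact: gmulfM. Qed.

Lemma epi1 (G H : finGroupType) (a : epi G H) : a 1%g = 1%g.
Proof. by apply: (mulgI (a 1%g)); rewrite mulg1 -epiM mulg1. Qed.

Definition isepi (H G : finGroupType) (t : {ffun H -> G}) : bool :=
  [forall x, forall y, t (x * y)%g == (t x * t y)%g] && [forall y, exists x, t x == y].

(** Epimorphisms as a finite type with decidable equality, so that sums and cardinals can be taken
    over them. *)
Definition epiT (H G : finGroupType) := {t : {ffun H -> G} | isepi t}.
HB.instance Definition _ H G := Finite.on (epiT H G).

Lemma isepiP (H G : finGroupType) (t : {ffun H -> G}) :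
  reflect ({morph t : x y / (x * y)%g} /\ forall y, exists x, t x = y) (isepi t).
Proof.
apply: (iffP andP) => [[/forallP tM /forallP tS]|[tM tS]]; split.
- by move=> x y; move/forallP: (tM x) => /(_ y)/eqP.
- by move=> y; have /existsP [x /eqP] := tS y; exists x.
- by apply/forallP => x; apply/forallP => y; rewrite tM.
- by apply/forallP => y; apply/existsP; have [x <-] := tS y; exists x.
Qed.

Fact isepi_epi (H G : finGroupType) (a : epi H G) : isepi [ffun x => a x].
Proof.
apply/isepiP; split=> [x y|y]; first by rewrite !ffunE epiM.
by have [x <-] := epi_surj a y; exists x; rewrite ffunE.
Qed.
Definition epiT_of (H G : finGroupType) (a : epi H G) : epiT H G := 
  exist (fun t : {ffun H -> G} => is_true (isepi t)) [ffun x => a x] (isepi_epi a).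

Definition of_epiT (H G : finGroupType) (t : epiT H G) : epi H G :=
  @mkepi H G (sval t) (proj1 (isepiP (sval t) (valP t))) (proj2 (isepiP (sval t) (valP t))).
Coercion of_epiT : epiT >-> epi.

Lemma epiT_ofE (H G : finGroupType) (a : epi H G) x : epiT_of a x = a x.
Proof. by rewrite /= ffunE. Qed.

Lemma epiT_inj (H G : finGroupType) (s t : epiT H G) : (forall x, s x = t x) -> s = t.
Proof. by move=> st; apply/val_inj/ffunP => x; exact: st. Qed.

Lemma of_epiTK (H G : finGroupType) (t : epiT H G) : epiT_of t = t.
Proof. by apply: epiT_inj => x; rewrite epiT_ofE. Qed.

Definition ecompT (L H G : finGroupType) (b : epi H G) (a : epi L H) : epiT L G :=
  epiT_of (epi_comp b a).
Lemma ecompTE (L H G : finGroupType) (b : epi H G) (a : epi L H) x : ecompT b a x = b (a x).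
Proof. exact: epiT_ofE. Qed.

Lemma ecompT_inj (L H G : finGroupType) (a : epi L H) (b b' : epiT H G) :
  ecompT b a = ecompT b' a -> b = b'.
Proof.
move=> e; apply: epiT_inj => y; have [x <-] := epi_surj a y.
by rewrite -!ecompTE e.
Qed.

Lemma epi_leq (G H : finGroupType) (a : epi G H) : (#|H| <= #|G|)%N.
Proof.
rewrite -!cardsT; apply: (@leq_trans #|[set a x | x in [set: G]]|); last exact: leq_imset_card.
apply: subset_leq_card; apply/fintype.subsetP => y _.
by have [x <-] := epi_surj a y; apply: imset_f.
Qed.

End Epi.

Section Rpr.
Variables (k : fieldType) (p : nat).
Notation U := (abelian_pgroup p).
Notation rep := (rep k U).
Notation cplx := (cplx k U).

Lemma grpC (G : grp U) (x y : G) : (x * y = y * x)%g.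
Proof. by have [/centsP cG _] := grpP G; apply: cG; rewrite inE. Qed.

(** All groups at hand are abelian: conjugacy classes of epimorphisms are single epimorphisms, and
    diagrams act through their values only. *)
Lemma conj_eq (G H : grp U) (a b : epi G H) (h : H) :
  (forall g, b g = (a g ^ h)%g) -> a =1 b.
Proof. by move=> ab g; rewrite ab conjgE (grpC (a g) h) mulKg. Qed.

Lemma ract_ext (X : rep) (G H : grp U) (a b : epi G H) : a =1 b -> ract X a =1 ract X b.
Proof. by move=> ab; apply: (@ract_conj _ _ X _ _ a b 1%g) => g; rewrite conjg1 ab. Qed.

Lemma ract_compT (X : rep) (L H G : grp U) (b : epi H G) (a : epi L H) x :
  ract X (ecompT b a) x = ract X a (ract X b x).
Proof. by rewrite -ract_comp; apply: ract_ext => z; rewrite ecompTE. Qed.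

Section Def.
Variable G : grp U.
Let V (L : grp U) : lmodType k := {ffun epiT L G -> k^o}.
Let act_fun (L H : grp U) (a : epi L H) (f : V H) : V L :=
  [ffun phi : epiT L G => \sum_(psi : epiT H G | ecompT psi a == phi) f psi].
Let act_lin (L H : grp U) (a : epi L H) : linear (act_fun a).
Proof.
move=> c f g; apply/ffunP => phi; rewrite !ffunE scaler_sumr -big_split.
by apply: eq_bigr => psi _; rewrite !ffunE.
Qed.
Let act (L H : grp U) (a : epi L H) := mklin (act_lin a).
Fact rpr_id (L : grp U) f : act (epi_id L) f = f.
Proof.
apply/ffunP => phi; rewrite ffunE (big_pred1 phi) // => psi.
have -> : ecompT (psi : epiT L G) (epi_id L) = psi by apply: epiT_inj => x; rewrite ecompTE.
by [].
Qed.
Fact rpr_comp (L H K : grp U) (b : epi H K) (a : epi L H) f :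
  act (epi_comp b a) f = act a (act b f).
Proof.
apply/ffunP => phi; rewrite !ffunE (eq_bigr (fun psi : epiT H G => \sum_(chi : epiT K G | ecompT chi b == psi) f chi)); last first.
  by move=> psi _; rewrite ffunE.
rewrite [LHS](partition_big (fun chi : epiT K G => ecompT chi b) (fun psi : epiT H G => ecompT psi a == phi)); last first.
  move=> chi /eqP <-; apply/eqP/epiT_inj => x; by rewrite !ecompTE.
apply: eq_bigr => psi /eqP <-; apply: eq_bigl => chi.
apply: andb_idl => /eqP <-; apply/eqP/epiT_inj => x; by rewrite !ecompTE.
Qed.
Fact rpr_conj (L H : grp U) (a b : epi L H) (h : H) :
  (forall g, b g = (a g ^ h)%g) -> act a =1 act b.
Proof.
move=> /conj_eq ab f; apply/ffunP => phi; rewrite !ffunE; apply: eq_bigl => psi.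
by congr (_ == _); apply: epiT_inj => x; rewrite !ecompTE ab.
Qed.
(** The linearized representable k[Epi(-, G)]. Its elements are written as functions, so a
    restriction along a is the pushforward of functions along psi -> psi a. *)
Definition rpr : rep := Rep rpr_id rpr_comp rpr_conj.

Lemma rpr_actE (L H : grp U) (a : epi L H) (f : rpr H) phi :
  (ract rpr a f : {ffun epiT L G -> k^o}) phi = \sum_(psi : epiT H G | ecompT psi a == phi) (f : {ffun epiT H G -> k^o}) psi.
Proof. by rewrite ffunE. Qed.

Definition rdelta : rpr G := [ffun phi : epiT G G => (phi == epiT_of (epi_id G))%:R].

Lemma ract_delta (L : grp U) (a : epi L G) phi :
  (ract rpr a rdelta : {ffun epiT L G -> k^o}) phi = (phi == epiT_of a)%:R.
Proof.
rewrite rpr_actE big_mkcond (bigD1 (epiT_of (epi_id G))) //= big1 ?addr0.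
  rewrite ffunE eqxx; have -> : ecompT (epiT_of (epi_id G)) a = epiT_of a.
    by apply: epiT_inj => x; rewrite ecompTE !epiT_ofE.
  by rewrite eq_sym; case: ifP.
by move=> psi /negPf psi1; rewrite ffunE psi1 if_same.
Qed.

Lemma rprE (L : grp U) (f : rpr L) :
  f = \sum_(phi : epiT L G) (f : {ffun epiT L G -> k^o}) phi *: ract rpr (phi : epiT L G) rdelta.
Proof.
apply/ffunP => phi; rewrite sum_ffunE (bigD1 phi) //= big1 ?addr0.
  by rewrite [in RHS]ffunE ract_delta of_epiTK eqxx [RHS]mulr1.
move=> psi ne; rewrite [LHS]ffunE ract_delta of_epiTK eq_sym (negPf ne).
by rewrite [LHS]mulr0.
Qed.

Section Yoneda.
Variables (A : rep) (a : A G).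
Let yo_fun (L : grp U) (f : rpr L) : A L := \sum_(phi : epiT L G) (f : {ffun epiT L G -> k^o}) phi *: ract A phi a.
Fact yo_lin L : linear (@yo_fun L).
Proof.
move=> c f g; rewrite /yo_fun scaler_sumr -big_split; apply: eq_bigr => phi _.
by rewrite !ffunE scalerDl scalerA.
Qed.
Fact yo_nat (L H : grp U) (b : epi L H) f : yo_fun (ract rpr b f) = ract A b (yo_fun f).
Proof.
rewrite /yo_fun linear_sum.
rewrite (eq_bigr (fun phi : epiT L G => \sum_(psi : epiT H G | ecompT psi b == phi) (f : {ffun epiT H G -> k^o}) psi *: ract A phi a)); last first.
  by move=> phi _; rewrite rpr_actE scaler_suml.
rewrite [RHS](partition_big (fun psi : epiT H G => ecompT psi b) predT) //.
apply: eq_bigr => phi _; apply: eq_bigr => psi /eqP <-.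
by rewrite linearZ /= ract_compT.
Qed.
Definition yo : rhom rpr A := mkrhom yo_lin yo_nat.

Lemma yo_delta : yo G rdelta = a.
Proof.
rewrite /= /yo_fun (bigD1 (epiT_of (epi_id G))) //= big1 ?addr0.
  rewrite ffunE eqxx scale1r -[RHS]ract_id; apply: ract_ext => x.
  by rewrite epiT_ofE.
by move=> phi /negPf ne; rewrite ffunE ne scale0r.
Qed.
End Yoneda.

Lemma yo_eq (A : rep) (u v : rhom rpr A) : u G rdelta = v G rdelta -> forall L f, u L f = v L f.
Proof.
move=> uv L f; rewrite [f]rprE !linear_sum; apply: eq_bigr => phi _.
by rewrite !linearZ /= !rnat uv.
Qed.

End Def.

(** Projectivity as lifting along an exact sequence A' -> A -> A'', which avoids images and
    quotients of diagrams. *)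
Definition Pj (R : rep) := forall (A' A A'' : rep) (al : rhom A' A) (be : rhom A A''),
  (forall G x, be G x = 0 -> exists y, al G y = x) ->
  forall g : rhom R A, (forall G x, be G (g G x) = 0) ->
  exists h : rhom R A', forall G x, al G (h G x) = g G x.

Lemma Pj_rpr G : Pj (rpr G).
Proof.
move=> A' A A'' al be ex g bg; have [y yE] := ex G _ (bg G (rdelta G)).
exists (yo y) => L x; apply: (@yo_eq G A (rcomp al (yo y)) g).
by rewrite /= -yE; congr (al G _); exact: yo_delta.
Qed.

Lemma rhom_sumE (I : finType) (X Y : rep) (f : I -> rhom X Y) G x :
  (\big[@radd _ _ X Y/rzero X Y]_i f i) G x = \sum_i f i G x.
Proof. by elim/big_ind2: _ => // f1 f2 g1 g2 /= -> ->. Qed.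

(** A retract of a finite sum of representables, that is, a finitely generated projective; the
    identity is decomposed without forming the sum. *)
Definition fproj (R : rep) := exists (I : finType) (G : I -> grp U)
  (inn : forall i, rhom (rpr (G i)) R) (pr : forall i, rhom R (rpr (G i))),
  forall L x, x = \sum_i inn i L (pr i L x).

Lemma Pj_fproj R : fproj R -> Pj R.
Proof.
move=> [I [G [inn [pr E]]]] A' A A'' al be ex g bg.
have /dchoice [h hE] : forall i, exists h : rhom (rpr (G i)) A', forall L x, al L (h L x) = g L (inn i L x).
  move=> i; have := @Pj_rpr (G i) A' A A'' al be ex (rcomp g (inn i)).
  by apply=> L x; apply: bg.
exists (\big[@radd _ _ R A'/rzero R A']_i rcomp (h i) (pr i)) => L x.
rewrite rhom_sumE linear_sum [x in RHS]E linear_sum; apply: eq_bigr => i _.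
by rewrite /= hE.
Qed.

Definition perfect (F : cplx) := (exists N : nat, forall n, (N < `|n|)%N -> forall G (x : F n G), x = 0) /\
  forall n, fproj (F n).

(** The contraction is built upwards in the degree m of the source, starting below the support of
    [F]; projectivity of F (m + 1) solves the equation in degree m. *)
Lemma perfect_Kproj F : perfect F -> Kproj F.
Proof.
move=> [[N F0] Ffp] A acA e e1 c cd_.
pose eqn (h : forall m n, rhom (F m) (A n)) m := forall n G x,
  c (m + 1) n G x = cd A n G (h (m + 1) (n + 1) G x) + e *: h m n G (cd F m G x).
have step h b : (forall m, (m < b)%R -> eqn h m) -> exists h', forall m, (m < b + 1)%R -> eqn h' m.
  move=> hb.
  (* What the equation in degree m - 1 says on boundaries. It makes the right-hand side in degree m
     a cycle, hence a boundary in [A]. *)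
  pose P m := forall n G x, c m n G (cd F m G x) = cd A n G (h m (n + 1) G (cd F m G x)).
  have Pm : forall m, (m < b + 1)%R -> P m.
    apply: intS_ind => m; rewrite ltrD2r => mb n G x.
    by rewrite (hb m mb) cdd linear0 scaler0 addr0.
  have /dchoice [y yE] : forall m, exists y : forall n, rhom (F (m + 1)) (A n), P m ->
      forall n G x, c (m + 1) n G x = cd A n G (y (n + 1) G x) + e *: h m n G (cd F m G x).
    move=> m; case: (pselect (P m)) => [Pm'|]; last by exists (fun n => rzero _ _).
    have /dchoice [y yE] : forall n, exists y : rhom (F (m + 1)) (A (n + 1)),
       forall G x, cd A n G (y G x) = c (m + 1) n G x - e *: h m n G (cd F m G x).
      apply: intS_ind => n.
      pose g : rhom (F (m + 1)) (A (n + 1)) := radd (c (m + 1) (n + 1)) (rscale (- e) (rcomp (h m (n + 1)) (cd F m))).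
      have [|G x|y yE] := @Pj_fproj _ (Ffp (m + 1)) _ _ _ (cd A (n + 1)) (cd A n) _ g.
      - by move=> G x /acA [y ->]; exists y.
      - by rewrite /= linearD linearZ /= -Pm' cd_ scalerA mulNr e1 scaleN1r subrr.
      - by exists y => G x; rewrite yE /= scaleNr.
    have [z zE] := @desc (fun n => rhom (F (m + 1)) (A n)) y; exists z => _ n G x; rewrite zE yE subrK //.
  have [Y YE] := @desc (fun m => forall n, rhom (F m) (A n)) y.
  exists (fun m => if (m <= b)%R then h m else Y m) => m mb n G x.
  have mb' : (m <= b)%R by rewrite -ltzD1.
  rewrite mb'; case: ifP => [m1b|/negbT m1b].
    by apply: hb; rewrite -lezD1.
  by rewrite YE; apply: yE (Pm m mb) n G x.
have [h hE] : exists h, forall m, (m < N%:Z)%R -> eqn h m.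
  (* F (m + 1) is zero for m below -(N + 2) and for m from N on, so 2N + 2 extensions cross the
     whole support. *)
  have S i : exists h, forall m, (m < - (N.+2)%:Z + i%:Z)%R -> eqn h m.
    elim: i => [|i [h hE]].
      exists (fun m n => rzero _ _) => m mN n G x.
      rewrite [x](F0 (m + 1)); first by rewrite !linear0 ?scaler0 addr0.
      by move: mN; lia.
    have [h' h'E] := step h _ hE; exists h' => m mi; apply: h'E; move: mi; lia.
  have [h hE] := S (2 * N + 2)%N; exists h => m mN; apply: hE; move: mN; lia.
exists h => m n G x; case: (ltP m N%:Z) => [/hE //|mN].
rewrite [x](F0 (m + 1)); first by rewrite !linear0 ?scaler0 addr0.
by move: mN; lia.
Qed.

(** By Yoneda a map out of [F] is determined by the images of finitely many generators in finitely
    many degrees, and each image meets finitely many summands. *)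
Lemma perfect_hcompact F : perfect F -> hcompact F.
Proof.
move=> [[N F0] Ffp] J Z g.
have /dchoice [S SE] : forall n, exists S : J -> Prop, finite_set S /\
   forall G x, ctrunc Z (fun i => ~ S i) n G (g n G x) = 0.
  move=> n; have [I [G [inn [pr E]]]] := Ffp n.
  pose z i : coprod Z n (G i) := g n (G i) (inn i (G i) (rdelta (G i))).
  exists (\bigcup_(i in [set: I]) [set j | z i j != 0])%classic; split.
    by apply: bigcup_finite => [|i _]; [apply: finite_finset|case: (dvalP (z i))].
  move=> L x; rewrite [x]E !linear_sum big1 // => i _.
  apply: (@yo_eq (G i) _ (rcomp (ctrunc Z _ n) (rcomp (g n) (inn i))) (rzero _ _)).
  apply: dsum_inj => j; rewrite [LHS]ctruncE; case: asboolP => //= nS.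
  by apply/eqP; apply: contrapT => /negP zj; apply: nS; exists i.
have fin : finite_set [set n : int | (`|n| <= N)%N]%classic.
  apply: (@sub_finite_set _ _ [set` [seq m%:Z - N%:Z | m <- iota 0 (2 * N + 1)]]%classic); last exact: finite_seq.
  move=> n /= nN; apply/mapP; exists (absz (n + N%:Z)%R); last by move: nN; lia.
  by rewrite mem_iota; move: nN; lia.
exists (\bigcup_(n in [set n : int | (`|n| <= N)%N]) S n)%classic.
  by apply: bigcup_finite => // n _; case: (SE n).
apply: null_eq0 => n G x; case: (leqP `|n| N) => nN; last by rewrite [x]F0 // linear0.
apply: dsum_inj => j; rewrite [LHS]ctruncE; case: asboolP => //= nS.
have [_ /(_ G x) /(congr1 (fun z : coprod Z n G => z j))] := SE n.
by rewrite ctruncE; case: asboolP => //= /contrapT Sj; case: nS; exists n.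
Qed.

Lemma quasi_iso_id (X : cplx) : quasi_iso (cmap_id X).
Proof.
move=> n G; split=> [x _ [y xE]|y dy]; first by exists y.
by exists y => //; exists 0; rewrite linear0 addr0.
Qed.

Lemma perfect_compact F : perfect F -> compact F.
Proof.
by move=> pF; apply/(hcompact_compact (perfect_Kproj pF) (quasi_iso_id F))/perfect_hcompact.
Qed.

End Rpr.

(** * Linear algebra in arbitrary dimension *)

Section LinAlg.
Variable k : fieldType.

Definition subsp (V : lmodType k) (C : V -> Prop) :=
  C 0 /\ forall a x y, C x -> C y -> C (a *: x + y).

Lemma subspD (V : lmodType k) (C : V -> Prop) x y : subsp C -> C x -> C y -> C (x + y).
Proof. by move=> [_ CD] Cx Cy; rewrite -[x]scale1r; apply: CD. Qed.
Lemma subspZ (V : lmodType k) (C : V -> Prop) a x : subsp C -> C x -> C (a *: x).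
Proof. by move=> [C0 CD] Cx; rewrite -[_ *: _]addr0; apply: CD. Qed.
Lemma subspB (V : lmodType k) (C : V -> Prop) x y : subsp C -> C x -> C y -> C (x - y).
Proof. by move=> Cs Cx Cy; rewrite -scaleN1r addrC; case: Cs => _; apply. Qed.

(** Zorn's lemma for the subspaces containing D that meet L trivially. If x lay outside the sum of L
    and a maximal one, x could be adjoined to the latter. *)
Lemma complement (V : lmodType k) (L D : V -> Prop) : subsp L -> subsp D ->
  (forall x, L x -> D x -> x = 0) ->
  exists C : V -> Prop, [/\ subsp C, forall x, D x -> C x, forall x, L x -> C x -> x = 0
    & forall x, exists2 c, C c & L (x - c)].
Proof.
move=> Ls Ds LD.
(* Adding D inside the condition keeps the union of the empty chain admissible: it stands for D
   itself. *)
pose W (X : set V) := fun x => X x \/ D x.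
pose P (X : set V) := subsp (W X) /\ forall x, L x -> W X x -> x = 0.
have [F FP tF|A [[As LA] Amax]] := @Zorn_bigcup V P.
  split.
    split; first by right; case: Ds.
    move=> a x y [[X FX Xx]|Dx] [[Y FY Yy]|Dy].
    - have [XY|YX] := tF _ _ FX FY.
        have [[_ cl] _] := FP _ FY.
        by case: (cl a x y (or_introl (XY _ Xx)) (or_introl Yy)) => [h|]; [left; exists Y|right].
      have [[_ cl] _] := FP _ FX.
      by case: (cl a x y (or_introl Xx) (or_introl (YX _ Yy))) => [h|]; [left; exists X|right].
    - have [[_ cl] _] := FP _ FX.
      by case: (cl a x y (or_introl Xx) (or_intror Dy)) => [h|]; [left; exists X|right].
    - have [[_ cl] _] := FP _ FY.
      by case: (cl a x y (or_intror Dx) (or_introl Yy)) => [h|]; [left; exists Y|right].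
    - by right; case: Ds => _; apply.
  move=> x Lx [[X FX Xx]|]; last exact: LD.
  by have [_] := FP _ FX; apply=> //; left.
exists (W A); split=> // [x Dx|x]; first by right.
apply: contrapT => nx.
have nWx : ~ W A x.
  by move=> Wx; apply: nx; exists x; rewrite // subrr; case: Ls.
pose B : set V := fun y => exists a, W A (y - a *: x).
have WB y : W B y -> B y.
  by case=> // Dy; exists 0; rewrite scale0r subr0; right.
apply: (Amax B).
  split=> [y Ay|BA]; first by exists 0; rewrite scale0r subr0; left.
  apply: nWx; left; apply: BA; exists 1; rewrite scale1r subrr.
  by case: As.
split.
  split; first by right; case: Ds.
  move=> a y z /WB [b Wb] /WB [c Wc]; left; exists (a * b + c).
  rewrite scalerDl opprD addrACA -scalerA -scalerBr.
  by case: As => _; apply.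
move=> y Ly /WB [a Wa]; case: (eqVneq a 0) Wa => [->|a0 Wa].
  by rewrite scale0r subr0; apply: LA.
exfalso; apply: nx; exists (- a^-1 *: (y - a *: x)); first exact: subspZ.
rewrite scaleNr opprK scalerBr scalerA mulVf // scale1r addrC subrK.
exact: subspZ.
Qed.

Lemma lin_of_rel (V W : lmodType k) (R : V -> W -> Prop) :
  (forall v, exists w, R v w) -> (forall w, R 0 w -> w = 0) ->
  (forall a v v' w w', R v w -> R v' w' -> R (a *: v + v') (a *: w + w')) ->
  exists f : {linear V -> W}, forall v, R v (f v).
Proof.
move=> tot u0 RL; have /dchoice [f fR] := tot.
have fL : linear f.
  move=> a x y; have := RL (-1) _ _ _ _ (fR (a *: x + y)) (RL a _ _ _ _ (fR x) (fR y)).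
  rewrite !scaleN1r addNr => /u0 /eqP.
  by rewrite [X in X == _]addrC subr_eq0 => /eqP ->.
by exists (mklin fL).
Qed.

(** The coordinate along v with respect to a complement of the line through v that contains L. *)
Lemma functional (V : lmodType k) (L : V -> Prop) v : subsp L -> ~ L v ->
  exists f : {linear V -> k^o}, (forall x, L x -> f x = 0) /\ f v = 1.
Proof.
move=> Ls nv.
have v0 : v != 0 by apply: contra_notN nv => /eqP ->; case: Ls.
have [||x [a ->] Lav|C [Cs LC C0 Cex]] := @complement V (fun x => exists a, x = a *: v) L.
- split; first by exists 0; rewrite scale0r.
  by move=> a x y [b ->] [c ->]; exists (a * b + c); rewrite scalerDl scalerA.
- by [].
- case: (eqVneq a 0) => [->|a0]; first by rewrite scale0r.
  by case: nv; rewrite -[v]scale1r -(mulVf a0) -scalerA; apply: subspZ.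
have uniq (a : k) : C (a *: v) -> a = 0.
  move=> Cav; have /eqP := C0 _ (ex_intro _ a erefl) Cav.
  by rewrite scaler_eq0 (negPf v0) orbF => /eqP.
have [x|w|a x y b c Cb Cc|f fE] := @lin_of_rel V k^o (fun x a => C (x - (a : k) *: v)).
- have [c Cc [a xE]] := Cex x; exists a; rewrite -xE.
  by rewrite opprB addrC subrK.
- by rewrite sub0r -scaleNr => /uniq /eqP; rewrite oppr_eq0 => /eqP.
- rewrite scalerDl opprD addrACA -[(a *: b : k^o)]/(a * b : k) -scalerA -scalerBr.
  by case: Cs => _; apply.
exists f; split=> [x Lx|].
  apply: uniq; have := subspB Cs (LC _ Lx) (fE x).
  by rewrite opprB addrC subrK.
apply/eqP; rewrite -subr_eq0 -[1]opprK opprK; apply/eqP.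
have := fE v; rewrite -{1}[v]scale1r -scalerBl => /uniq /eqP.
by rewrite subr_eq0 => /eqP <-; rewrite subrr.
Qed.

(** Split off complements of the image and of the kernel: s projects w to the image of d and takes
    the preimage lying in the complement of the kernel. *)
Lemma ginv (V W : lmodType k) (d : {linear V -> W}) :
  exists s : {linear W -> V}, forall v, d (s (d v)) = d v.
Proof.
have s0 (T : lmodType k) : subsp (fun x : T => x = 0).
  by split=> // a x y -> ->; rewrite scaler0 addr0.
have [||x _ -> //|C [Cs _ C0 Cex]] := @complement W (fun w => exists v, w = d v) (fun x => x = 0).
- split; first by exists 0; rewrite linear0.
  by move=> a x y [v ->] [v' ->]; exists (a *: v + v'); rewrite linearP.
- exact: s0.
have [||x _ -> //|C' [Cs' _ C0' Cex']] := @complement V (fun v => d v = 0) (fun x => x = 0).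
- split; first by rewrite linear0.
  by move=> a x y x0 y0; rewrite linearP x0 y0 scaler0 addr0.
- exact: s0.
have [w|v|a x y b c [Cb Cb'] [Cc Cc']|s sE] := @lin_of_rel W V (fun w v => C' v /\ C (w - d v)).
- have [c Cc [v wE]] := Cex w; have [c' Cc' /eqP] := Cex' v.
  rewrite linearB subr_eq0 => /eqP dv; exists c'; split=> //.
  by rewrite -dv -wE opprB addrC subrK.
- move=> [C'v]; rewrite sub0r -linearN => Cv.
  have /eqP := C0 _ (ex_intro _ _ erefl) Cv; rewrite linearN oppr_eq0 => /eqP dv.
  exact: C0'.
- split; first by case: Cs' => _; apply.
  by rewrite linearP opprD addrACA -scalerBr; case: Cs => _; apply.
exists s => v; have [_] := sE (d v); rewrite -linearB => /(C0 _ (ex_intro _ _ erefl)) /eqP.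
by rewrite linearB subr_eq0 => /eqP.
Qed.

Fixpoint span (V : lmodType k) (l : seq V) (x : V) : Prop :=
  if l is v :: l' then exists a, span l' (x - a *: v) else x = 0.

Lemma span_sub (V : lmodType k) (l : seq V) : subsp (span l).
Proof.
elim: l => [|v l [IH0 IHD]] /=.
  by split=> // a x y -> ->; rewrite scaler0 addr0.
split; first by exists 0; rewrite scale0r subrr.
move=> a x y [b xb] [c yc]; exists (a * b + c).
by rewrite scalerDl opprD addrACA -scalerA -scalerBr; apply: IHD.
Qed.

Lemma span_in (V : lmodType k) (l : seq V) x : x \in l -> span l x.
Proof.
elim: l => [//|v l IH]; rewrite inE => /orP [/eqP ->|/IH xl] /=.
  by exists 1; rewrite scale1r subrr; case: (span_sub l).
by exists 0; rewrite scale0r subr0.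
Qed.

Lemma span_min (V : lmodType k) (l : seq V) (C : V -> Prop) x : subsp C ->
  (forall y, y \in l -> C y) -> span l x -> C x.
Proof.
move=> Cs; elim: l x => [x _ -> |v l IH x lC [a xa]]; first by case: Cs.
rewrite -(subrK (a *: v) x); apply: subspD => //; last first.
  by apply: subspZ => //; apply: lC; rewrite inE eqxx.
by apply: IH xa => y yl; apply: lC; rewrite inE yl orbT.
Qed.

Lemma noeth (V : lmodType k) (l : seq V) (L : V -> Prop) : subsp L ->
  (forall x, L x -> span l x) ->
  exists l', (forall x, x \in l' -> L x) /\ forall x, L x -> span l' x.
Proof.
elim: l L => [|v l IH] L Ls Ll; first by exists [::].
have [||l' [l'L Ll']] := IH (fun x => L x /\ span l x).
- split; first by split; [case: Ls|case: (span_sub l)].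
  by move=> a x y [Lx lx] [Ly ly]; split; [case: Ls => _; apply|case: (span_sub l) => _; apply].
- by move=> x [].
case: (pselect (exists2 u, L u & span l (u - v))) => [[u Lu lu]|nu].
  exists (u :: l'); split=> [x|x Lx].
    by rewrite inE => /orP [/eqP ->|/l'L []].
  have [a xa] := Ll x Lx; exists a; apply: Ll'; split; first exact: subspB (subspZ _ _ _).
  have := subspB (span_sub l) xa (subspZ a (span_sub l) lu).
  by rewrite scalerBr opprB addrA subrK.
exists l'; split=> [x /l'L []//|x Lx]; apply: Ll'; split=> //.
have [a xa] := Ll x Lx; case: (eqVneq a 0) xa => [->|a0 xa]; first by rewrite scale0r subr0.
case: nu; exists (a^-1 *: x); first exact: subspZ.
by have := subspZ a^-1 (span_sub l) xa; rewrite scalerBr scalerA mulVf // scale1r.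
Qed.

Definition fd (V : lmodType k) := exists l : seq V, forall x, span l x.

End LinAlg.

Definition single (T : int -> Type) (z : forall n, T n) m (t : T m) n : T n :=
  match pselect (m = n) with left e => eq_rect m T t n e | right _ => z n end.

Lemma singleE (T : int -> Type) (z : forall n, T n) m (t : T m) : single z t m = t.
Proof. by rewrite /single; case: pselect => // e; rewrite (Prop_irrelevance e erefl). Qed.

Lemma single_ind (T : int -> Type) (z : forall n, T n) m (t : T m) (P : forall n, T n -> Prop) :
  P m t -> (forall n, P n (z n)) -> forall n, P n (single z t n).
Proof. by move=> Pt Pz n; rewrite /single; case: pselect => // e; case: n / e. Qed.

Lemma single_ne (A : int -> Type) (z : forall n, A n) a (t : A a) c : a <> c -> single z t c = z c.
Proof. by move=> ac; rewrite /single; case: pselect. Qed.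

Lemma finite_nat_ne (S : nat -> Prop) : finite_set S -> exists i, ~ S i.
Proof.
move=> fS; apply: contrapT => nS; apply: infinite_nat.
by apply: sub_finite_set fS => i _; apply: contrapT => Si; apply: nS; exists i.
Qed.

(** * Finiteness of the homology of compact complexes *)

Section Homology.
Variables (k : fieldType) (p : nat).
Notation U := (abelian_pgroup p).
Notation rep := (rep k U).
Notation cplx := (cplx k U).

Definition acycG (X : cplx) (G : grp U) := forall n (x : X (n + 1) G), cd X n G x = 0 ->
  exists y, x = cd X (n + 1) G y.

Lemma boundary_functional (X : cplx) n G (x : X (n + 1) G) : ~ (exists y, x = cd X (n + 1) G y) ->
  exists l : {linear X (n + 1) G -> k^o}, (forall y, l (cd X (n + 1) G y) = 0) /\ l x = 1.
Proof.
move=> nx; have [|l [l0 l1]] := @functional k _ (fun z => exists y, z = cd X (n + 1) G y) x _ nx.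
  split; first by exists 0; rewrite linear0.
  by move=> c _ _ [u ->] [v ->]; exists (c *: u + v); rewrite linearP.
by exists l; split=> // y; apply: l0; exists y.
Qed.

Definition cst (R : rep) : cplx := @Cplx k U (fun=> R) (fun=> rzero R R) (fun n G x => erefl).

Lemma Kproj_cst R : Pj R -> Kproj (cst R).
Proof.
move=> PR A acA e e1 c cd_.
have /dchoice [h hE] : forall m, exists h : forall n, rhom R (A n), forall n G x, c m n G x = cd A n G (h (n + 1) G x).
  apply: intS_ind => m.
  have /dchoice [y yE] : forall n, exists y : rhom R (A (n + 1)), forall G x, c (m + 1) n G x = cd A n G (y G x).
    apply: intS_ind => n.
    have [|G x|y yE] := PR _ _ _ (cd A (n + 1)) (cd A n) _ (c (m + 1) (n + 1)).
    - by move=> G x /acA [y ->]; exists y.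
    - have := cd_ m n G x; rewrite /= linear0 => /(congr1 (fun z => e *: z)).
      by rewrite scalerA e1 scale1r scaler0.
    by exists y => G x; rewrite yE.
  have [z zE] := @desc (fun n => rhom R (A n)) y.
  by exists z => n G x; rewrite zE.
by exists h => m n G x; rewrite hE /= linear0 scaler0 addr0.
Qed.

Definition Tst (G : grp U) := cst (rpr k G).
Lemma Kproj_Tst G : Kproj (Tst G).
Proof. exact/Kproj_cst/Pj_rpr. Qed.

Lemma tstmap_ex (X : cplx) G n (x : X (n + 1) G) : cd X n G x = 0 ->
  exists u : cmap (Tst G) X, u (n + 1) G (rdelta k G) = x.
Proof.
move=> dx; pose y := single (T := fun n => X n G) (fun n => 0) x.
have yd m : cd X m G (y (m + 1)) = 0.
  rewrite /y /single; case: pselect => [e|_]; last by rewrite linear0.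
  have e' : n = m by apply: addIr e.
  by subst m; rewrite (Prop_irrelevance e erefl).
have ud m L f : yo (y m) L (cd (Tst G) m L f) = cd X m L (yo (y (m + 1)) L f).
  rewrite [LHS](linear0 (yo (y m) L)).
  symmetry; apply: (@yo_eq k p G (X m) (rcomp (cd X m) (yo (y (m + 1)))) (rzero _ _)).
  change (cd X m G (yo (y (m + 1)) G (rdelta k G)) = 0).
  by rewrite yo_delta.
exists (@CMap k U (Tst G) X (fun n => yo (y n)) ud).
change (yo (y (n + 1)) G (rdelta k G) = x).
by rewrite yo_delta; apply: singleE.
Qed.

(** Expresses acyclicity at G by maps from a K-projective complex, so that it is inherited along
    retracts in the derived category. *)
Lemma acycG_null X G : acycG X G <-> forall u : cmap (Tst G) X, null u.
Proof.
split=> [ac u|nu n x dx]; last first.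
  have [u <-] := tstmap_ex dx; have [h hE] := nu u.
  exists (h (n + 1) G (rdelta k G)); rewrite hE /=.
  by rewrite [h n G 0]linear0 addr0.
have /dchoice [y yE] : forall n, exists y : rhom (rpr k G) (X (n + 1 + 1)), forall L x, u (n + 1) L x = cd X (n + 1) L (y L x).
  move=> n; have [|y yE] := ac n (u (n + 1) G (rdelta k G)).
    by rewrite -cfd linear0.
  exists (yo y) => L x.
  apply: (@yo_eq k p G _ (u (n + 1)) (rcomp (cd X (n + 1)) (yo y))).
  by rewrite yE; congr (cd X _ _ _); symmetry; exact: yo_delta.
have [h hE] := @desc (fun n => rhom (rpr k G) (X (n + 1))) y.
exists h => n L x; rewrite yE hE /=.
by rewrite [h n L 0]linear0 addr0.
Qed.

Lemma acycG_retract X Y G : retract X Y -> acycG Y G -> acycG X G.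
Proof.
move=> [i [r ri]] /acycG_null acY; apply/acycG_null => u.
have KT := @Kproj_Tst G.
apply: (htpy_null (g := act KT (did X) u)).
  by apply: null_eq0 => n L x; rewrite csubE subrr.
apply: htpy_null (htpy_sym (act_deq KT ri u)) _.
apply: htpy_null (act_htpy KT r (proj1 (null_htpy0 _) (acY (act KT i u)))) _.
by apply/null_htpy0; apply: act_zero.
Qed.

Lemma diso_retract (X Y : cplx) : diso X Y -> retract X Y /\ retract Y X.
Proof. by move=> [f [g [gf fg]]]; split; [exists f, g|exists g, f]. Qed.

Lemma acycG_zero (X : cplx) G : deq (did X) (dzero X X) -> acycG X G.
Proof.
move=> X0; apply/acycG_null => u; have KT := @Kproj_Tst G.
have e : null (act KT (did X) u) by apply/null_htpy0; exact: act_deq X0 u.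
by apply: null_ext e.
Qed.

Lemma qis_acycG (X Y : cplx) (q : cmap X Y) G : quasi_iso q -> acycG X G <-> acycG Y G.
Proof.
move=> qq.
have e : diso X Y.
  exists (dmap q), (dinv qq); split; [exact: deq_invl|exact: deq_invr].
by have [h1 h2] := diso_retract e; split; apply: acycG_retract.
Qed.

Lemma fib_acyc1 (X Y : cplx) (f : cmap X Y) G : acycG X G -> acycG Y G -> acycG (fib f) G.
Proof.
move=> aX aY n [x y] /= [dx /eqP]; rewrite subr_eq0 => /eqP fx.
have [x' xE] := aX n x dx.
have [|y' yE] := aY (n + 1) (f (n + 1 + 1) G x' - y).
  by rewrite linearB -cfd -xE fx subrr.
exists (x', y'); congr pair => //=.
by rewrite -yE subKr.
Qed.

Lemma fib_acyc2 (X Y : cplx) (f : cmap X Y) G : acycG (fib f) G -> acycG Y G -> acycG X G.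
Proof.
move=> aF aY n x dx.
have [|y yE] := aY n (f (n + 1) G x); first by rewrite -cfd dx linear0.
have [|[x' y'] [-> _]] := aF n (x, y); first by rewrite /= dx yE subrr.
by exists x'.
Qed.

Lemma fib_acyc3 (X Y : cplx) (f : cmap X Y) G : acycG (fib f) G -> acycG X G -> acycG Y G.
Proof.
move=> aF aX; apply: intS_ind => n y dy.
have [|[x y'] [dx yE]] := aF n (0, y); first by rewrite /= dy subr0 !linear0.
have [x' xE] := aX (n + 1) x (esym dx).
exists (f (n + 1 + 1 + 1) G x' - y').
by rewrite linearB -cfd -xE yE.
Qed.

(** Finite-dimensional homology, stated by cycles that span modulo boundaries so that no quotient is
    formed. *)
Definition FDat (X : cplx) n G := exists l : seq (X (n + 1) G),
  (forall x, x \in l -> cd X n G x = 0) /\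
  forall x, cd X n G x = 0 -> exists y, span l (x - cd X (n + 1) G y).
Definition FD (X : cplx) := forall n G, FDat X n G.

Section IRep.
Variables (V : grp U) (E : lmodType k).
Let W (L : grp U) : lmodType k := {ffun epiT V L -> E}.
Let act_fun (L H : grp U) (a : epi L H) (f : W H) : W L := [ffun v : epiT V L => f (ecompT a v)].
Let act_lin (L H : grp U) (a : epi L H) : linear (act_fun a).
Proof. by move=> c f g; apply/ffunP => v; rewrite !ffunE. Qed.
Let act (L H : grp U) (a : epi L H) := mklin (act_lin a).
Fact irep_id (L : grp U) f : act (epi_id L) f = f.
Proof.
apply/ffunP => v; rewrite ffunE; congr (f _); apply: epiT_inj => x.
by rewrite ecompTE.
Qed.
Fact irep_comp (L H K : grp U) (b : epi H K) (a : epi L H) f :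
  act (epi_comp b a) f = act a (act b f).
Proof.
apply/ffunP => v; rewrite !ffunE; congr (f _); apply: epiT_inj => x.
by rewrite !ecompTE.
Qed.
Fact irep_conj (L H : grp U) (a b : epi L H) (h : H) :
  (forall g, b g = (a g ^ h)%g) -> act a =1 act b.
Proof.
move=> /conj_eq ab f; apply/ffunP => v; rewrite !ffunE; congr (f _); apply: epiT_inj => x.
by rewrite !ecompTE ab.
Qed.
(** The right adjoint of evaluation at V, applied to the vector space E; [coyo] is the transpose of
    a linear map. *)
Definition irep : rep := Rep irep_id irep_comp irep_conj.
Lemma irep_actE (L H : grp U) (a : epi L H) (f : irep H) (v : epiT V L) :
  (ract irep a f : {ffun epiT V L -> E}) v = (f : {ffun epiT V H -> E}) (ecompT a v).
Proof. by rewrite ffunE. Qed.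

Section CoYo.
Variables (A : rep) (l : {linear A V -> E}).
Let coyo_fun (L : grp U) (x : A L) : irep L := [ffun v : epiT V L => l (ract A (v : epiT V L) x)].
Fact coyo_lin L : linear (@coyo_fun L).
Proof. by move=> c x y; apply/ffunP => v; rewrite !ffunE !linearP. Qed.
Fact coyo_nat (L H : grp U) (a : epi L H) x : coyo_fun (ract A a x) = ract irep a (coyo_fun x).
Proof. by apply/ffunP => v; rewrite !ffunE ract_compT. Qed.
Definition coyo : rhom A irep := mkrhom coyo_lin coyo_nat.
Lemma coyoE (L : grp U) x (v : epiT V L) : (coyo L x : {ffun epiT V L -> E}) v = l (ract A (v : epiT V L) x).
Proof. by rewrite ffunE. Qed.
End CoYo.

Lemma coyo_id (A : rep) (l : {linear A V -> E}) x :
  (coyo l V x : {ffun epiT V V -> E}) (epiT_of (epi_id V)) = l x.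
Proof.
rewrite coyoE -[x in RHS]ract_id; congr (l _); apply: ract_ext => y.
by rewrite epiT_ofE.
Qed.
End IRep.

(* If H_{n+1}(X(G)) is infinite-dimensional, a sequence of functionals on it,
   each vector being killed by almost all of them, gives a map from X to a
   countable coproduct with no vanishing component. *)
Lemma compact_FD X : compact X -> FD X.
Proof.
move=> /compactP cX n G; apply: contrapT => nFD.
pose V := X (n + 1) G; pose Z (x : V) := cd X n G x = 0.
pose SB (l : seq V) x := exists y, span l (x - cd X (n + 1) G y).
have SBs l : subsp (SB l).
  split; first by exists 0; rewrite linear0 subrr; case: (span_sub l).
  move=> a x y [x' xl] [y' yl]; exists (a *: x' + y').
  by rewrite linearP opprD addrACA -scalerBr; case: (span_sub l) => _; apply.
(* Without a finite spanning list, every list of cycles can be extended by a cycle independent of it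
   modulo boundaries. *)
have /dchoiceT [pk pkP] : forall l : seq V, exists v, (forall x, x \in l -> Z x) -> Z v /\ ~ SB l v.
  move=> l; case: (pselect (forall x, x \in l -> Z x)) => [lZ|]; last by exists 0.
  apply: contrapT => nv; apply: nFD; exists l; split=> // x Zx.
  by apply: contrapT => nx; apply: nv; exists x.
pose l i := iter i (fun l => pk l :: l) [::].
have lZ i x : x \in l i -> Z x.
  elim: i x => [//|i IH] x; rewrite inE => /orP [/eqP ->|/IH //].
  by have [] := pkP (l i) IH.
have SBm i j : (i <= j)%N -> forall x, SB (l i) x -> SB (l j) x.
  move=> ij x; elim: j ij => [|j IH]; first by rewrite leqn0 => /eqP ->.
  rewrite leq_eqVlt => /orP [/eqP -> //|/IH h /h [y xy]].
  by exists y => /=; exists 0; rewrite scale0r subr0.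
pose L x := exists i, SB (l i) x.
have Ls : subsp L.
  split; first by exists 0%N; case: (SBs (l 0%N)).
  move=> a x y [i xi] [j yj]; exists (maxn i j).
  by case: (SBs (l (maxn i j))) => _; apply; [apply: SBm xi; rewrite leq_maxl|apply: SBm yj; rewrite leq_maxr].
have [||C [Cs _ C0 Cex]] := @complement k V L (fun x => x = 0) Ls.
- by split=> // a x y -> ->; rewrite scaler0 addr0.
- by [].
(* The functional [lam i] is 1 on the i-th chosen cycle and 0 on the earlier ones, on boundaries and
   on the complement C. As C and the chosen cycles span modulo boundaries, almost all [lam i] vanish
   on any given vector. *)
pose Li i x := exists2 c, C c & SB (l i) (x - c).
have Lis i : subsp (Li i).
  split; first by exists 0; [case: Cs|rewrite subrr; case: (SBs (l i))].
  move=> a x y [c Cc xc] [c' Cc' yc]; exists (a *: c + c'); first by case: Cs => _; apply.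
  by rewrite opprD addrACA -scalerBr; case: (SBs (l i)) => _; apply.
have nLi i : ~ Li i (pk (l i)).
  move=> [c Cc h]; have [_ nv] := pkP (l i) (@lZ i); apply: nv.
  suff c0 : c = 0 by rewrite c0 subr0 in h.
  apply: C0 => //; rewrite -(subKr (pk (l i)) c); apply: subspB => //; last by exists i.
  by exists i.+1, 0; rewrite linear0 subr0; apply: span_in; rewrite inE eqxx.
have /dchoiceT [lam lamP] := fun i => functional (Lis i) (@nLi i).
have lamZ x : exists i0, forall i, (i0 <= i)%N -> lam i x = 0.
  have [c Cc [i0 h]] := Cex x; exists i0 => i i0i; apply: (lamP i).1.
  by exists c => //; apply: SBm h.
pose T m := nat -> {linear X m G -> k^o}.
pose Lam := single (T := T) (fun m _ => \0) lam.
have LamZ m x : exists i0, forall i, (i0 <= i)%N -> Lam m i x = 0.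
  move: m x; apply: (@single_ind T _ _ lam (fun m (t : T m) => forall x, exists i0, forall i, (i0 <= i)%N -> t i x = 0)) => //.
  by move=> m x; exists 0%N.
have LamB m i x : Lam m i (cd X m G x) = 0.
  move: m i x; apply: (@single_ind T _ _ lam (fun m (t : T m) => forall i x, t i (cd X m G x) = 0)) => //.
  move=> i x; apply: (lamP i).1; exists 0; first by case: Cs.
  by exists x; rewrite subr0 subrr; case: (span_sub (l i)).
pose J := irep G k^o.
have gP m H x : dsum_pred (V := fun _ : nat => J H) predT (fun i => coyo (Lam m i) H x).
  split=> //.
  (* Epi(G, H) is finite, so a common bound exists for all translates of x. *)
  have /dchoiceT [b bP] := fun v : epiT G H => LamZ m (ract (X m) v x).
  apply: (@sub_finite_set _ _ [set` iota 0 (\max_(v : epiT G H) b v)]%classic); last exact: finite_seq.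
  move=> i /=; rewrite mem_iota add0n /=; apply: contraR; rewrite -leqNgt => ib.
  apply/eqP/ffunP => v; rewrite coyoE ffunE; apply: bP.
  by apply: leq_trans ib; apply: leq_bigmax.
pose Y := coprod (fun _ : nat => cst J).
pose g0 m : rhom (X m) (Y m) := @rinto k U nat predT (fun=> J) (X m) (fun i => coyo (Lam m i)) (@gP m).
have gd m H x : g0 m H (cd X m H x) = cd Y m H (g0 (m + 1) H x).
  apply: dsum_inj => i /=; apply/ffunP => v; rewrite coyoE -rnat LamB.
  by rewrite ffunE.
pose g : cmap X Y := CMap gd.
have [S fS gS] := cX _ _ (dmap g).
have [i nSi] := finite_nat_ne fS.
have [pkZ _] := pkP (l i) (@lZ i).
have [u uE] := tstmap_ex pkZ.
have KT := @Kproj_Tst G.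
have [h hE] : null (cmap_comp (cmap_comp (ctrunc (fun=> cst J) (fun i => ~ S i)) g) u).
  by have e := act_deq KT (deq_trans (deq_map_comp _ _) gS) u; apply/null_htpy0.
have e : cmap_comp (cmap_comp (ctrunc (fun=> cst J) (fun i => ~ S i)) g) u (n + 1) G (rdelta k G) = 0.
  rewrite hE; have -> : h n G (cd (Tst G) n G (rdelta k G)) = 0 := linear0 _.
  by rewrite addr0; apply: dsum_inj => j.
have {}e : rtrunc predT (fun=> J) (fun i => ~ S i) G (g0 (n + 1) G (u (n + 1) G (rdelta k G))) i = 0.
  exact: (congr1 (fun z : Y (n + 1) G => z i) e).
move: e; rewrite rtruncE; case: asboolP => // _ /(congr1 (fun f : {ffun epiT G G -> k^o} => f (epiT_of (epi_id G)))).
rewrite coyo_id ffunE uE /Lam singleE (lamP i).2 => /eqP.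
by rewrite oner_eq0.
Qed.

End Homology.

(** * Small groups up to isomorphism and closure properties of projectives *)

Section Tools.
Variables (k : fieldType) (p : nat).
Notation U := (abelian_pgroup p).
Notation rep := (rep k U).
Notation cplx := (cplx k U).

(** A group of order at most B is, up to isomorphism, a subset of a set with B elements together
    with a multiplication table, and there are finitely many of these. One group is chosen for every
    table that occurs. *)
Lemma exhaust B : exists (I : finType) (Gs : I -> grp U), forall H : grp U, (#|H| <= B)%N ->
  exists (i : I) (a : epi H (Gs i)) (b : epi (Gs i) H), forall x, b (a x) = x.
Proof.
case: (pselect (exists H0 : grp U, True)) => [[H0 _]|nH]; last first.
  exists void, (fun i : void => match i with end) => H; case: nH; by exists H.
pose I : finType := ({set 'I_B} * {ffun 'I_B * 'I_B -> 'I_B})%type.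
pose R (i : I) (H : grp U) := exists e : H -> 'I_B, [/\ injective e,
  forall j, j \in i.1 <-> exists x, e x = j & forall x y, e (x * y)%g = i.2 (e x, e y)].
have /dchoiceT [Gs GsP] : forall i, exists G, (exists H, R i H) -> R i G.
  move=> i; case: (pselect (exists H, R i H)) => [[H RH]|]; first by exists H.
  by exists H0.
exists I, Gs => H HB.
pose e (x : H) : 'I_B := widen_ord HB (enum_rank x).
have ei : injective e by move=> x y /(congr1 val) /= xy; apply/enum_rank_inj/val_inj.
pose inv (j : 'I_B) : H := odflt 1%g [pick x | e x == j].
have eK x : inv (e x) = x.
  by rewrite /inv; case: pickP => [y /eqP /ei //|/(_ x)]; rewrite eqxx.
pose i : I := ([set e x | x : H], [ffun z => e (inv z.1 * inv z.2)%g]).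
have Ri : R i H.
  exists e; split=> // [j|x y]; last by rewrite ffunE !eK.
  by split=> [/imsetP [x _ ->]|[x <-]]; [exists x|apply: imset_f].
have [e' [e'i e'S e'M]] := GsP i (ex_intro _ H Ri).
have /dchoiceT [a aE] : forall x, exists y, e' y = e x.
  by move=> x; apply/e'S; apply: imset_f.
have /dchoiceT [b bE] : forall y, exists x, e x = e' y.
  by move=> y; have /e'S /imsetP [x _ ->] : exists z, e' z = e' y; [exists y|exists x].
have ab y : a (b y) = y by apply: e'i; rewrite aE bE.
have ba x : b (a x) = x by apply: ei; rewrite bE aE.
have aM : {morph a : x y / (x * y)%g}.
  by move=> x y; apply: e'i; rewrite e'M !aE ffunE !eK.
have bM : {morph b : x y / (x * y)%g}.
  by move=> x y; rewrite -[LHS]ba -[RHS]ba aM !ab.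
exists i, (mkepi aM (fun y => ex_intro _ _ (ab y))), (mkepi bM (fun y => ex_intro _ _ (ba y))).
exact: ba.
Qed.

Section Rsum.
Variables (I : choiceType) (P : pred I) (X : I -> rep).

Section RinP.
Variable i : I.
Fact rinP_sub G (x : X i G) : dsum_pred P (fun j => if P j then dsum_in_fun (V := fun j => X j G) x j else 0).
Proof.
split=> [|j /negPf -> //]; apply: sub_finite_set _ (finite_set1 i) => j /=.
by case: ifP => _; rewrite ?eqxx // /dsum_in_fun; case: pselect => // _; rewrite eqxx.
Qed.
Fact rinP_lin G : linear (fun x : X i G => DSum (rinP_sub x) : rsum P X G).
Proof.
move=> a x y; apply: dsum_inj => j; rewrite dsumDE dsumZE /=.
case: ifP => _; last by rewrite scaler0 addr0.
exact: (congr1 (fun z => dval z j) (linearP (dsum_in (fun j => X j G) i) a x y)).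
Qed.
Fact rinP_nat (G H : grp U) (a : epi G H) x :
  (DSum (rinP_sub (ract (X i) a x)) : rsum P X G) = ract (rsum P X) a (DSum (rinP_sub x) : rsum P X H).
Proof.
apply: dsum_inj => j /=; case: ifP => _; last by rewrite linear0.
exact: (congr1 (fun z => dval z j) (@rin_nat _ _ _ X i _ _ a x)).
Qed.
Definition rinP : rhom (X i) (rsum P X) := mkrhom rinP_lin rinP_nat.
Lemma rinPE G (x : X i G) j : rinP G x j = if P j then dsum_in_fun (V := fun j => X j G) x j else 0.
Proof. by []. Qed.
End RinP.

Lemma dsum_bigE (J : Type) (r : seq J) (V : I -> lmodType k) (f : J -> dsum P V) i :
  (\sum_(j <- r) f j) i = \sum_(j <- r) f j i.
Proof. by elim/big_ind2: _ => // x x' y y' /= <- <-. Qed.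

Lemma rinP_sum G (x : rsum P X G) (s : seq I) : uniq s -> (forall i, i \notin s -> x i = 0) ->
  x = \sum_(i <- s) rinP i G (x i).
Proof.
move=> us xs; apply: dsum_inj => i; rewrite dsum_bigE.
case: (boolP (i \in s)) => si; last first.
  rewrite xs // big1_seq // => j /andP [_ js]; rewrite rinPE; case: ifP => // _.
  by apply: dsum_in_ne => ji; move: js; rewrite ji (negPf si).
rewrite (bigD1_seq i) //= dsum_in_id big1 ?addr0 => [|j /eqP ji].
  by case: ifP => // /negbT Pi; case: (dvalP x) => _; apply.
by case: ifP => // _; apply: dsum_in_ne.
Qed.

Lemma rsum_ext A (u v : rhom (rsum P X) A) : (forall i, P i -> forall G x, u G (rinP i G x) = v G (rinP i G x)) ->
  forall G x, u G x = v G x.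
Proof.
move=> uv G x; have [s [us xs]] := dsum_seq x; rewrite (rinP_sum us xs) !linear_sum.
apply: eq_bigr => i _; case: (boolP (P i)) => [Pi|nP]; first exact: uv.
have -> : x i = 0 by case: (dvalP x) => _; apply.
by rewrite !linear0.
Qed.

Lemma rinP_rout A (f : forall i, rhom (X i) A) i G (x : X i G) : P i -> rout P f G (rinP i G x) = f i G x.
Proof.
move=> Pi; rewrite (rout1 f (i := i)) ?rinPE ?Pi ?dsum_in_id //.
by move=> j /eqP ji; rewrite rinPE; case: ifP => // _; rewrite dsum_in_ne // => /esym.
Qed.

Lemma Pj_rsum : (forall i, Pj (X i)) -> Pj (rsum P X).
Proof.
move=> PX A' A A'' al be ex g bg.
have /dchoice [h hE] : forall i, exists h : rhom (X i) A', forall G x, al G (h G x) = g G (rinP i G x).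
  by move=> i; apply: (PX i _ _ _ al be ex (rcomp g (rinP i))) => G x; apply: bg.
exists (rout P h) => G x.
apply: (@rsum_ext _ (rcomp al (rout P h)) g) => i Pi L y.
change (al L (rout P h L (rinP i L y)) = g L (rinP i L y)).
by rewrite rinP_rout.
Qed.

Lemma fproj_rsum (s : seq I) : uniq s -> (forall i, i \notin s -> P i -> forall G (x : X i G), x = 0) ->
  (forall i, fproj (X i)) -> fproj (rsum P X).
Proof.
move=> us s0 fX.
have /dchoice [J /dchoice [G /dchoice [inn /dchoice [pr E]]]] := fX.
pose c := tnth (in_tuple s).
exists {i : 'I_(size s) & J (c i)}, (fun t => G (c (tag t)) (tagged t)).
exists (fun t => rcomp (rinP (c (tag t))) (inn _ (tagged t))).
exists (fun t => rcomp (pr _ (tagged t)) (rproj P X (c (tag t)))) => L x.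
have xs i : i \notin s -> x i = 0.
  by move=> si; case: (boolP (P i)) => [Pi|]; [apply: s0|case: (dvalP x) => _; apply].
rewrite [LHS](rinP_sum us xs) big_tnth.
rewrite (eq_bigr (fun i => \sum_(t : J (c i)) rinP (c i) L (inn _ t L (pr _ t L (x (c i)))))); last first.
  by move=> i _; rewrite -linear_sum -E.
by rewrite sig_big_dep.
Qed.

End Rsum.

Lemma fproj_rprod (R R' : rep) : fproj R -> fproj R' -> fproj (rprod R R').
Proof.
move=> [J [G [inn [pr E]]]] [J' [G' [inn' [pr' E']]]].
pose GG (t : J + J') : grp U := match t with inl j => G j | inr j => G' j end.
pose ii (t : J + J') : rhom (rpr k (GG t)) (rprod R R') :=
  match t as t0 return rhom (rpr k (GG t0)) (rprod R R') with
  | inl j => rpair (inn j) (rzero _ R') | inr j => rpair (rzero _ R) (inn' j) end.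
pose pp (t : J + J') : rhom (rprod R R') (rpr k (GG t)) :=
  match t as t0 return rhom (rprod R R') (rpr k (GG t0)) with
  | inl j => rcomp (pr j) (rfst R R') | inr j => rcomp (pr' j) (rsnd R R') end.
exists (J + J')%type, GG, ii, pp.
move=> L [x x']; rewrite big_sumType /=.
have sumE (T : finType) (f : T -> R L) (f' : T -> R' L) :
    \sum_t (f t, f' t) = (\sum_t f t, \sum_t f' t).
  by elim/big_ind3: _ => // x1 x2 x3 y1 y2 y3 -> ->.
transitivity ((x, 0) + (0, x') : rprod R R' L); first by congr pair; rewrite /= ?addr0 ?add0r.
by congr (_ + _); rewrite sumE -?E -?E' big1.
Qed.

Lemma fd_fproj (R : rep) G : fproj R -> fd (R G).
Proof.
move=> [J [Gj [inn [pr E]]]].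
pose f (t : {j : J & epiT G (Gj j)}) := inn (tag t) G (ract (rpr k (Gj (tag t))) (tagged t) (rdelta k (Gj (tag t)))).
exists (codom f) => x; rewrite [x]E.
have Ss := span_sub (codom f).
elim/big_ind: _ => [|y z Sy Sz|j _]; [by case: Ss|exact: subspD|].
rewrite [pr j G x]rprE linear_sum.
elim/big_ind: _ => [|y z Sy Sz|v _]; [by case: Ss|exact: subspD|].
rewrite linearZ; apply: subspZ => //; apply: span_in.
exact: (codom_f f (Tagged (fun j => epiT G (Gj j)) v)).
Qed.

End Tools.

(** * Cellular resolutions *)

Section Resolution.
Variables (k : fieldType) (p : nat).
Notation U := (abelian_pgroup p).
Notation rep := (rep k U).
Notation cplx := (cplx k U).

(** A cycle of the fibre is determined by its first component up to a cycle of [X]. The first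
    components form a subspace of a finite-dimensional space, and cycles of [X] are spanned modulo
    boundaries by a finite list. *)
Lemma FD_fib (P X : cplx) (q : cmap P X) : (forall n G, fd (P n G)) -> FD X -> FD (fib q).
Proof.
move=> Pfd XFD n G.
have [l0 l0P] := Pfd (n + 1) G.
pose L (x : P (n + 1) G) := exists y, cd (fib q) n G (x, y) = 0.
have Ls : subsp L.
  split; first by exists 0; rewrite linear0.
  move=> a x y [x' hx] [y' hy]; exists (a *: x' + y').
  have -> : (a *: x + y, a *: x' + y') = a *: ((x, x') : fib q (n + 1) G) + (y, y') by [].
  by rewrite linearP hx hy scaler0 addr0.
have [l1 [l1L l1P]] := noeth Ls (fun x _ => l0P x).
have [l2 [l2L l2P]] := XFD (n + 1) G.
have /dchoiceT [t tP] : forall x, exists y, L x -> cd (fib q) n G (x, y) = 0.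
  by move=> x; case: (pselect (L x)) => [[y]|]; [exists y|exists 0].
pose l : seq (fib q (n + 1) G) := [seq (x, t x) | x <- l1] ++ [seq (0, y) | y <- l2].
exists l; split=> [z|[x w] dz].
  rewrite mem_cat => /orP [/mapP [x /l1L /tP h ->] //|/mapP [y /l2L dy ->]].
  by rewrite /= dy subr0 !linear0.
have Ss := span_sub l.
have Lx : L x by exists w.
have [y Sxy] : exists y, span l ((x, y) : fib q (n + 1) G).
  apply: (@span_min k _ l1 (fun x => exists y, span l ((x, y) : fib q (n + 1) G)) x) (l1P x Lx).
    split; first by exists 0; case: Ss.
    move=> a x1 x2 [y1 h1] [y2 h2]; exists (a *: y1 + y2).
    by have := (proj2 Ss) a _ _ h1 h2.
  move=> x1 x1l; exists (t x1); apply: span_in; rewrite mem_cat.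
  by apply/orP; left; apply: map_f.
have dxy : cd (fib q) n G (x, y) = 0.
  apply: (@span_min k _ l (fun z => cd (fib q) n G z = 0)) Sxy.
    split; first by rewrite linear0.
    by move=> a z1 z2 z10 z20; rewrite linearP z10 z20 scaler0 addr0.
  move=> z; rewrite mem_cat => /orP [/mapP [x1 /l1L /tP h ->] //|/mapP [y1 /l2L dy ->]].
  by rewrite /= dy subr0 !linear0.
have dwy : cd X (n + 1) G (w - y) = 0.
  move/(congr1 snd): dz => /= /eqP; rewrite subr_eq0 => /eqP qx.
  move/(congr1 snd): dxy => /= /eqP; rewrite subr_eq0 => /eqP qx'.
  by rewrite linearB -qx -qx' subrr.
have [v Sv] := l2P _ dwy; exists (0, - v).
have -> : (x, w) - cd (fib q) (n + 1) G (0, - v) =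
   (x, y) + (0, w - y - cd X (n + 1 + 1) G v) :> fib q (n + 1) G.
  have e1 : x - 0 = x + 0 by rewrite subr0 addr0.
  have e2 : w - (0 - cd X (n + 1 + 1) G (- v)) = y + (w - y - cd X (n + 1 + 1) G v).
    by rewrite linearN opprK add0r [RHS]addrA [X in _ = X - _]addrC subrK.
  by congr pair; rewrite /= !linear0.
apply: subspD => //.
apply: (@span_min k _ l2 (fun x => span l ((0, x) : fib q (n + 1) G))) Sv.
  split; first by case: Ss.
  by move=> a x1 x2 h1 h2; have := (proj2 Ss) a _ _ h1 h2; rewrite /= -[a *: (0, x1) + _]/(a *: 0 + 0, a *: x1 + x2) scaler0 addr0.
move=> y1 y1l; apply: span_in; rewrite mem_cat.
by apply/orP; right; apply: map_f.
Qed.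

(* The data needed to attach cells aC n in degree n to P, over q : P -> X. *)
Record att (P X : cplx) (q : cmap P X) := Att {
  aC : int -> rep;
  ad : forall n, rhom (aC (n + 1)) (P n);
  add : forall n G y, cd P n G (ad (n + 1) G y) = 0;
  aw : forall n, rhom (aC n) (X n);
  aqw : forall n G y, q n G (ad n G y) = cd X n G (aw (n + 1) G y) }.

Section Attach.
Variables (P X : cplx) (q : cmap P X) (a : att q).
Definition att_d n : rhom (rprod (P (n + 1)) (aC a (n + 1))) (rprod (P n) (aC a n)) :=
  rpair (radd (rcomp (cd P n) (rfst _ _)) (rcomp (ad a n) (rsnd _ _))) (rzero _ _).
Fact att_dd n G x : att_d n G (att_d (n + 1) G x) = 0.
Proof. by congr pair; rewrite /= linear0 addr0 linearD cdd add addr0. Qed.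
Definition att_c : cplx := @Cplx k U (fun n => rprod (P n) (aC a n)) att_d att_dd.
Definition att_q0 n : rhom (att_c n) (X n) := radd (rcomp (q n) (rfst _ _)) (rcomp (aw a n) (rsnd _ _)).
Fact att_qd n G x : att_q0 n G (cd att_c n G x) = cd X n G (att_q0 (n + 1) G x).
Proof. by rewrite /= linear0 addr0 linearD cfd aqw linearD. Qed.
Definition att_q : cmap att_c X := CMap att_qd.
End Attach.

(** One number N bounds both the degree and the order of the group, so that finitely many cells are
    attached at each stage while every cycle is eventually reached. *)
Definition kills N (P X : cplx) (q : cmap P X) (a : att q) := forall (n : int) (G : grp U),
  (`|(n + 1 + 1)%R| <= N)%N -> (#|G| <= N)%N -> forall c : fib q (n + 1) G, cd (fib q) n G c = 0 ->
  exists (y : aC a (n + 1 + 1) G) c',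
    c = (ad a (n + 1) G y, aw a (n + 1 + 1) G y) + cd (fib q) (n + 1) G c'.

Definition att_bound N (P X : cplx) (q : cmap P X) (a : att q) :=
  (forall n, (N < `|n|)%N -> forall G (y : aC a n G), y = 0) /\ forall n, fproj (aC a n).

(** One cell for each member of a spanning list of the homology of the fibre at each representative
    group. Where that homology is infinite-dimensional the list is empty, so that the attaching data
    exist unconditionally. *)
Lemma att_ex N (P X : cplx) (q : cmap P X) : exists a : att q, att_bound N a /\ (FD (fib q) -> kills N a).
Proof.
have [I [Gs GsP]] := @exhaust p N.
have /dchoice [l lP] : forall n, exists l : forall i : I, seq (fib q (n + 1) (Gs i)), forall i,
   (forall x, x \in l i -> cd (fib q) n (Gs i) x = 0) /\ (FD (fib q) ->
   forall x, cd (fib q) n (Gs i) x = 0 -> exists y, span (l i) (x - cd (fib q) (n + 1) (Gs i) y)).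
  move=> n; suff /dchoice [l lP] : forall i, exists l : seq (fib q (n + 1) (Gs i)),
     (forall x, x \in l -> cd (fib q) n (Gs i) x = 0) /\ (FD (fib q) ->
     forall x, cd (fib q) n (Gs i) x = 0 -> exists y, span l (x - cd (fib q) (n + 1) (Gs i) y)).
    by exists l.
  move=> i; case: (pselect (FDat (fib q) n (Gs i))) => [[l [lc ls]]|nF].
    by exists l.
  by exists [::]; split=> // /(_ n (Gs i)).
(* Cells in degree m are known only for m = n + 1 + 1, where they come from cycles of degree n + 1.
   Bundling the index set, the groups and the attaching elements lets [desc] transport them
   together; the boundary of a cell is recorded in all degrees, being zero except in the right
   one. *)
pose D (m : int) := {J : finType & {Gc : J -> grp U &
  ((forall j, X m (Gc j)) * (forall j n, P n (Gc j)))%type}}.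
pose J n : finType := {i : I & 'I_(size (l n i))}.
pose e n (j : J n) : fib q (n + 1) (Gs (tag j)) := tnth (in_tuple (l n (tag j))) (tagged j).
pose D2 n : D (n + 1 + 1) := existT _ (J n) (existT _ (fun j : J n => Gs (tag j))
  ((fun j => (e n j).2), (fun j => single (T := fun n => P n (Gs (tag j))) (fun n => 0) (e n j).1))).
have [D1 D1E] := @desc (fun m => D (m + 1)) D2.
have [D0 D0E] := @desc D D1.
have DE n : D0 (n + 1 + 1) = D2 n by rewrite D0E D1E.
pose C m : rep := rsum (fun _ : projT1 (D0 m) => (`|m| <= N)%N) (fun j => rpr k (projT1 (projT2 (D0 m)) j)).
pose dl n : rhom (C (n + 1)) (P n) := rout _ (fun j => yo ((projT2 (projT2 (D0 (n + 1)))).2 j n)).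
pose w n : rhom (C n) (X n) := rout _ (fun j => yo ((projT2 (projT2 (D0 n))).1 j)).
have ecyc n (j : J n) : cd (fib q) n (Gs (tag j)) (e n j) = 0.
  by apply: (lP n (tag j)).1; apply: mem_tnth.
have dl0 n G y : cd P n G (dl (n + 1) G y) = 0.
  apply: (@rsum_ext k p _ _ _ _ (rcomp (cd P n) (dl (n + 1))) (rzero _ _)) => j Nj L x.
  change (cd P n L (dl (n + 1) L (rinP _ _ j L x)) = 0); rewrite rinP_rout //.
  apply: (@yo_eq k p _ _ (rcomp (cd P n) (yo _)) (rzero _ _)).
  change (cd P n _ (yo ((projT2 (projT2 (D0 (n + 1 + 1)))).2 j (n + 1)) _ (rdelta k _)) = 0).
  rewrite yo_delta; move: j {Nj x}; rewrite DE => j /=; rewrite singleE.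
  by have /(congr1 fst) := ecyc n j.
have qw n G y : q n G (dl n G y) = cd X n G (w (n + 1) G y).
  apply: (@rsum_ext k p _ _ _ _ (rcomp (q n) (dl n)) (rcomp (cd X n) (w (n + 1)))) => j Nj L x.
  change (q n L (dl n L (rinP _ _ j L x)) = cd X n L (w (n + 1) L (rinP _ _ j L x))); rewrite !rinP_rout //.
  apply: (@yo_eq k p _ _ (rcomp (q n) (yo _)) (rcomp (cd X n) (yo _))).
  change (q n _ (yo ((projT2 (projT2 (D0 (n + 1)))).2 j n) _ (rdelta k _)) =
    cd X n _ (yo ((projT2 (projT2 (D0 (n + 1)))).1 j) _ (rdelta k _))).
  rewrite !yo_delta; move: n j {y Nj x}; apply: intS_ind => n; rewrite DE => j /=; rewrite singleE.
  by have /(congr1 snd) /= /eqP := ecyc n j; rewrite subr_eq0 => /eqP.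
exists (@Att P X q C dl dl0 w qw); split.
  split=> [n Nn G y|n].
    by apply: dsum_inj => j; case: (dvalP y) => _; apply; rewrite -ltnNge.
  apply: (@fproj_rsum k p _ _ _ (enum (projT1 (D0 n)))); first exact: enum_uniq.
    by move=> j; rewrite mem_enum.
  move=> j; exists unit, (fun=> projT1 (projT2 (D0 n)) j), (fun=> rid _), (fun=> rid _) => L x.
  by rewrite big_const cardT enumT unlock /= addr0.
move=> F n G nN GN c dc.
have [i [a [b ba]]] := GsP G GN.
have keyi : forall c : fib q (n + 1) (Gs i), cd (fib q) n (Gs i) c = 0 -> exists (y : C (n + 1 + 1) (Gs i)) c',
    c = (dl (n + 1) _ y, w (n + 1 + 1) _ y) + cd (fib q) (n + 1) _ c'.
  move=> c1 /((lP n i).2 F) [c' Sc].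
  have [y yE] : exists y : C (n + 1 + 1) (Gs i), c1 - cd (fib q) (n + 1) (Gs i) c' = (dl (n + 1) _ y, w (n + 1 + 1) _ y).
    apply: (@span_min k _ (l n i) (fun z => exists y : C (n + 1 + 1) (Gs i), z = (dl (n + 1) _ y, w (n + 1 + 1) _ y))) Sc.
      split; first by exists 0; rewrite !linear0.
      move=> s z1 z2 [y1 ->] [y2 ->]; exists (s *: y1 + y2).
      by rewrite (linearP (dl (n + 1) (Gs i))) (linearP (w (n + 1 + 1) (Gs i))).
    move=> z zl; rewrite -index_mem in zl.
    pose j : J n := Tagged (fun i => 'I_(size (l n i))) (Ordinal zl).
    have ez : e n j = z by rewrite /e (tnth_nth 0) /= nth_index // -index_mem.
    suff [y [y1 y2]] : exists y : C (n + 1 + 1) (Gs i), dl (n + 1) _ y = (e n j).1 /\ w (n + 1 + 1) _ y = (e n j).2.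
      by exists y; rewrite y1 y2 ez; case: (z).
    rewrite /dl /w /C; move: (D0 (n + 1 + 1)) (DE n) => d ->.
    exists (rinP (fun _ : J n => (`|(n + 1 + 1)%R| <= N)%N) (fun j => rpr k (Gs (tag j))) j _ (rdelta k (Gs i))).
    by rewrite !rinP_rout //; split; rewrite yo_delta //= singleE.
  by exists y, c'; rewrite -yE subrK.
have [|y [c' E]] := keyi (ract (fib q (n + 1)) b c); first by rewrite rnat dc linear0.
exists (ract (C (n + 1 + 1)) a y), (ract (fib q (n + 1 + 1)) a c').
rewrite !rnat -[c](ract_id (r := fib q (n + 1))).
have -> : ract (fib q (n + 1)) (epi_id G) c = ract (fib q (n + 1)) a (ract (fib q (n + 1)) b c).
  by rewrite -ract_comp; apply: ract_ext => x /=; rewrite ba.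
by rewrite E linearD.
Qed.

End Resolution.

(** * The union of the stages of a cellular resolution *)

Section Pinf.
Variables (k : fieldType) (p : nat).
Notation U := (abelian_pgroup p).
Notation rep := (rep k U).
Notation cplx := (cplx k U).

Definition rep0 : rep := rsum (fun _ : void => true) (fun v : void => match v with end).
Lemma rep0_eq G (x y : rep0 G) : x = y.
Proof. by apply: dsum_inj; case. Qed.
Lemma fproj_rep0 : fproj rep0.
Proof.
exists void, (fun v : void => match v with end), (fun v : void => match v with end), (fun v : void => match v with end).
by move=> L x; apply: rep0_eq.
Qed.

Variables (X : cplx) (XFD : FD X).

Record stage := Stage { sP : cplx; sq : cmap sP X }.
Variable A : forall (N : nat) (s : stage), att (sq s).
Hypothesis AP : forall (N : nat) (s : stage), att_bound N (A N s) /\ (FD (fib (sq s)) -> kills N (A N s)).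

Fixpoint stages N : stage :=
  if N is N'.+1 then Stage (att_q (A N' (stages N'))) else Stage (cmap_zero (cst rep0) X).
Notation P N := (sP (stages N)).
Notation q N := (sq (stages N)).
Notation C N n := (aC (A N (stages N)) n).
Notation dl N n := (ad (A N (stages N)) n).
Notation w N n := (aw (A N (stages N)) n).

Lemma stage_fproj N n : fproj (P N n).
Proof.
elim: N => [|N IH]; first exact: fproj_rep0.
by apply: fproj_rprod => //; apply: (AP N (stages N)).1.2.
Qed.

Lemma stage_bound N n : (N <= `|n|)%N -> forall G (x : P N n G), x = 0.
Proof.
elim: N => [_ G x|N IH nN G [x y]]; first exact: rep0_eq.
congr pair; first by apply: IH; apply: ltnW.
by apply: (AP N (stages N)).1.1.
Qed.

Lemma stage_perfect N : perfect (P N).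
Proof. by split; [exists N => n /ltnW; apply: stage_bound|apply: stage_fproj]. Qed.

Lemma stage_FD N : FD (fib (q N)).
Proof. by apply: FD_fib XFD => n G; apply/fd_fproj/stage_fproj. Qed.

(** The union of the stages, realized as the sum of all cells ever attached. Each stage is then a
    direct summand of the terms, by [stage_in] and [stage_pr], although only [stage_in] respects
    differentials. *)
Definition Pinf_term n : rep := rsum predT (fun N => C N n).

Fixpoint stage_in N n : rhom (P N n) (Pinf_term n) :=
  match N return rhom (P N n) (Pinf_term n) with
  | 0%N => rzero _ _
  | N'.+1 => radd (rcomp (stage_in N' n) (rfst _ _)) (rcomp (rin (fun N => C N n) N') (rsnd _ _))
  end.

Fixpoint stage_pr N n : rhom (Pinf_term n) (P N n) :=
  match N return rhom (Pinf_term n) (P N n) with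
  | 0%N => rzero _ _
  | N'.+1 => rpair (stage_pr N' n) (rproj predT (fun N => C N n) N')
  end.

Lemma stage_in_prE N n G (x : Pinf_term n G) i : stage_in N n G (stage_pr N n G x) i = if (i < N)%N then x i else 0.
Proof.
elim: N => [//|N IH] /=; rewrite IH /dsum_in_fun.
case: pselect => [e|ne]; first by subst i; rewrite ltnn ltnSn add0r.
rewrite addr0 ltnS [(i <= N)%N]leq_eqVlt; case: eqP => [e|_] //=; by case: ne; rewrite e.
Qed.

Lemma stage_pr_ge N n G i (x : C i n G) : (N <= i)%N -> stage_pr N n G (rin (fun N => C N n) i G x) = 0.
Proof.
elim: N => [//|N IH] Ni /=; congr pair; first by apply: IH; apply: ltnW.
by apply: dsum_in_ne => e; move: Ni; rewrite e ltnn.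
Qed.

Lemma stage_in_ge N n G (x : P N n G) i : (N <= i)%N -> stage_in N n G x i = 0.
Proof.
elim: N x => [//|N IH] [x y] Ni /=; rewrite IH ?add0r; last exact: ltnW.
by apply: dsum_in_ne => e; move: Ni; rewrite e ltnn.
Qed.

Lemma stage_inK N n G (x : P N n G) : stage_pr N n G (stage_in N n G x) = x.
Proof.
elim: N x => [|N IH] x; first exact: rep0_eq.
case: x => x y /=; congr pair.
  by rewrite linearD IH stage_pr_ge // addr0.
by rewrite [LHS]/= stage_in_ge // add0r; apply: dsum_in_id.
Qed.

(** An element involves finitely many cells and so lies in all late stages; identities on the union
    are checked there. *)
Lemma stage_in_surj n G (x : Pinf_term n G) : exists N0, forall N, (N0 <= N)%N -> stage_in N n G (stage_pr N n G x) = x.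
Proof.
have [s [us xs]] := dsum_seq x.
exists (\max_(i <- s) i.+1)%N => N sN; apply: dsum_inj => i; rewrite stage_in_prE.
case: ltnP => // Ni; rewrite xs //; apply/negP => si.
have : (i.+1 <= N)%N by apply: leq_trans sN; apply: (leq_bigmax_seq (F := succn)).
by rewrite ltnNge Ni.
Qed.

Definition Pinf_d n : rhom (Pinf_term (n + 1)) (Pinf_term n) := rout predT (fun N => rcomp (stage_in N n) (dl N n)).

Lemma Pinf_d_in n N G (y : C N (n + 1) G) :
  Pinf_d n G (rin (fun N => C N (n + 1)) N G y) = stage_in N n G (dl N n G y).
Proof. exact: rin_out. Qed.

Lemma Pinf_d_stage N n G (x : P N (n + 1) G) : Pinf_d n G (stage_in N (n + 1) G x) = stage_in N n G (cd (P N) n G x).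
Proof.
elim: N x => [x|N IH [x y]]; first exact: (linear0 (Pinf_d n G)).
rewrite [stage_in N.+1 (n + 1) G _]/= linearD IH Pinf_d_in.
change (stage_in N n G (cd (P N) n G x) + stage_in N n G (dl N n G y) =
  stage_in N n G (cd (P N) n G x + dl N n G y) + rin (fun N => C N n) N G 0).
by rewrite (linear0 (rin _ N G)) addr0 linearD.
Qed.

Fact Pinf_dd n G x : Pinf_d n G (Pinf_d (n + 1) G x) = 0.
Proof.
have [N0 xN] := stage_in_surj x; rewrite -(xN N0) // !Pinf_d_stage cdd.
exact: linear0.
Qed.
Definition Pinf : cplx := Cplx Pinf_dd.

Definition Pinf_q0 n : rhom (Pinf_term n) (X n) := rout predT (fun N => w N n).

Lemma Pinf_q_stage N n G (x : P N n G) : Pinf_q0 n G (stage_in N n G x) = q N n G x.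
Proof.
elim: N x => [x|N IH [x y]]; first exact: (linear0 (Pinf_q0 n G)).
rewrite [stage_in N.+1 n G _]/= linearD IH; congr (_ + _); exact: rin_out.
Qed.

Fact Pinf_qd n G x : Pinf_q0 n G (cd Pinf n G x) = cd X n G (Pinf_q0 (n + 1) G x).
Proof.
have [N0 xN] := stage_in_surj x; rewrite -(xN N0) //.
rewrite [cd Pinf n G _]Pinf_d_stage !Pinf_q_stage; exact: cfd.
Qed.
Definition Pinf_q : cmap Pinf X := CMap Pinf_qd.

(** A cycle of the fibre lies in some stage N, which can be taken beyond its degree and the order of
    G; the cells attached to that stage make it a boundary. *)
Lemma Pinf_qis : quasi_iso Pinf_q.
Proof.
apply: fib_qis => n G [x v] dxv.
have [N0 xN] := stage_in_surj x.
pose N := (maxn N0 (maxn `|(n + 1 + 1)%R| #|G|))%N.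
have NN0 : (N0 <= N)%N by rewrite leq_maxl.
have Nn : (`|(n + 1 + 1)%R| <= N)%N by rewrite /N !leq_max leqnn orbT.
have NG : (#|G| <= N)%N by rewrite /N !leq_max leqnn !orbT.
have xE := xN N NN0.
have cyc : cd (fib (q N)) n G (stage_pr N (n + 1) G x, v) = 0.
  have dx : Pinf_d n G x = 0 := congr1 fst dxv.
  have qx : Pinf_q0 (n + 1) G x - cd X (n + 1) G v = 0 := congr1 snd dxv.
  congr pair => /=; last by rewrite -{1}xE Pinf_q_stage in qx.
  have := Pinf_d_stage (stage_pr N (n + 1) G x); rewrite xE dx => /(congr1 (stage_pr N n G)).
  by rewrite stage_inK linear0.
have kil : kills N (A N (stages N)) by case: (AP N (stages N)) => _; apply; apply: stage_FD.
have [y [[c1 c2]]] := kil n G Nn NG _ cyc.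
move=> /[dup] /(congr1 fst) /= E1 /(congr1 snd) /= E2.
pose z := rin (fun N => C N (n + 1 + 1)) N G y + stage_in N (n + 1 + 1) G c1.
have F1 : x = Pinf_d (n + 1) G z.
  by rewrite (linearD (Pinf_d (n + 1) G)) Pinf_d_in Pinf_d_stage -linearD -E1 xE.
have F2 : v = Pinf_q0 (n + 1 + 1) G z - cd X (n + 1 + 1) G c2.
  rewrite (linearD (Pinf_q0 (n + 1 + 1) G)) Pinf_q_stage.
  have -> : Pinf_q0 (n + 1 + 1) G (rin (fun N => C N (n + 1 + 1)) N G y) = w N (n + 1 + 1) G y by exact: rin_out.
  by rewrite [LHS]E2 [LHS]addrA.
by exists (z, c2); rewrite {1}F1 F2.
Qed.

Lemma Pinf_Pj n : Pj (Pinf n).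
Proof. by apply: Pj_rsum => N; apply/Pj_fproj/(AP N (stages N)).1.2. Qed.

Lemma Pinf_Kproj : Kproj Pinf.
Proof.
move=> B acB e e1 c cd_.
pose eqn N (h : forall m n, rhom (P N m) (B n)) := forall m n G x,
  c (m + 1) n G (stage_in N (m + 1) G x) = cd B n G (h (m + 1) (n + 1) G x) + e *: h m n G (cd (P N) m G x).
(* The extension to the cells of stage N is chosen for every candidate h, correct or not, so that
   [H] can be defined by recursion before its correctness is proved. *)
have /dchoice [g0 gE] : forall N, exists g : (forall m n, rhom (P N m) (B n)) -> forall m n, rhom (C N m) (B n),
   forall h, eqn N h -> forall m n G y,
   c (m + 1) n G (rin (fun N => C N (m + 1)) N G y) =
   cd B n G (g h (m + 1) (n + 1) G y) + e *: h m n G (dl N m G y).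
  move=> N; suff /dchoiceT [g gP] : forall h, exists g : forall m n, rhom (C N m) (B n),
     eqn N h -> forall m n G y,
     c (m + 1) n G (rin (fun N => C N (m + 1)) N G y) =
     cd B n G (g (m + 1) (n + 1) G y) + e *: h m n G (dl N m G y) by exists g.
  move=> h; case: (pselect (eqn N h)) => [hE|nh]; last first.
    by exists (fun m n => rzero _ _).
  have /dchoice [z zE] : forall m, exists z : forall n, rhom (C N (m + 1)) (B n), forall n G y,
     c (m + 1) n G (rin (fun N => C N (m + 1)) N G y) = cd B n G (z (n + 1) G y) + e *: h m n G (dl N m G y).
    apply: intS_ind => m.
    have /dchoice [z zE] : forall n, exists z : rhom (C N (m + 1 + 1)) (B (n + 1)), forall G y,
       cd B n G (z G y) = c (m + 1 + 1) n G (rin (fun N => C N (m + 1 + 1)) N G y) - e *: h (m + 1) n G (dl N (m + 1) G y).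
      apply: intS_ind => n.
      pose g : rhom (C N (m + 1 + 1)) (B (n + 1)) :=
        radd (rcomp (c (m + 1 + 1) (n + 1)) (rin (fun N => C N (m + 1 + 1)) N))
             (rscale (- e) (rcomp (h (m + 1) (n + 1)) (dl N (m + 1)))).
      have PC : Pj (C N (m + 1 + 1)) by apply/Pj_fproj/(AP N (stages N)).1.2.
      have [|G y|z zE] := PC _ _ _ (cd B (n + 1)) (cd B n) _ g.
      - by move=> G x /acB [y ->]; exists y.
      - have := cd_ (m + 1) n G (rin (fun N => C N (m + 1 + 1)) N G y).
        rewrite [cd Pinf _ _ _]Pinf_d_in hE add linear0 scaler0 addr0 => E.
        change (cd B n G (c (m + 1 + 1) (n + 1) G (rin (fun N => C N (m + 1 + 1)) N G y) +
          (- e) *: h (m + 1) (n + 1) G (dl N (m + 1) G y)) = 0).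
        by rewrite linearD linearZ /= [X in - e *: X]E scalerA mulNr e1 scaleN1r subrr.
      - by exists z => G y; rewrite zE /= scaleNr.
    have [Z ZE] := @desc (fun n => rhom (C N (m + 1 + 1)) (B n)) z.
    by exists Z => n G y; rewrite ZE zE subrK.
  have [Z ZE] := @desc (fun m => forall n, rhom (C N m) (B n)) z.
  by exists Z => _ m n G y; rewrite ZE zE.
pose ext N (h : forall m n, rhom (P N m) (B n)) : forall m n, rhom (P N.+1 m) (B n) :=
  fun m n => radd (rcomp (h m n) (rfst _ _)) (rcomp (g0 N h m n) (rsnd _ _)).
pose H := fix H N : forall m n, rhom (P N m) (B n) :=
  match N with 0%N => fun m n => rzero _ _ | N'.+1 => ext N' (H N') end.
have HE N : eqn N (H N).
  elim: N => [|N IH] m n G x; first by rewrite /= !linear0 ?scaler0 addr0.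
  case: x => x y; rewrite [stage_in N.+1 (m + 1) G _]/= linearD IH (gE N _ IH) /=.
  by rewrite !linear0 addr0 !linearD [LHS]addrACA.
pose h m n := rout predT (fun N => g0 N (H N) m n).
have hj N m n G x : h m n G (stage_in N m G x) = H N m n G x.
  elim: N x => [|N IH] x; first exact: (linear0 (h m n G)).
  case: x => x y; rewrite [stage_in N.+1 m G _]/= linearD IH; congr (_ + _); exact: rin_out.
exists h => m n G x; have [N0 xN] := stage_in_surj x; rewrite -(xN N0) //.
by rewrite [cd Pinf m G _]Pinf_d_stage !hj HE.
Qed.

(** The truncations to the cells attached from stage M on are chain maps to the quotients by the
    stages. Each element dies in almost all of them, so together they map to the coproduct; by
    compactness one of them is null, and its homotopy deforms the identity into a stage. *)
Lemma hcompact_Pinf : hcompact Pinf -> exists (F : cplx) (a : cmap Pinf F) (b : cmap F Pinf),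
  perfect F /\ htpy (cmap_comp b a) (cmap_id Pinf).
Proof.
move=> hc.
pose t M n : rhom (Pinf_term n) (Pinf_term n) := rtrunc predT (fun N => C N n) (fun N => (M <= N)%N).
have tE M n G x i : t M n G x i = if (M <= i)%N then x i else 0.
  by rewrite rtruncE asboolb.
have tk M n G x : x = stage_in M n G (stage_pr M n G x) + t M n G x.
  by apply: dsum_inj => i; rewrite dsumDE stage_in_prE tE; case: leqP; rewrite ?add0r ?addr0.
have tj M n G x : t M n G (stage_in M n G x) = 0.
  by apply: dsum_inj => i; rewrite tE; case: leqP => // /stage_in_ge ->.
have tdt M n G x : t M n G (Pinf_d n G x) = t M n G (Pinf_d n G (t M (n + 1) G x)).
  by rewrite [x in LHS](tk M) linearD Pinf_d_stage linearD tj add0r.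
have tt M n G x : t M n G (t M n G x) = t M n G x.
  by apply: dsum_inj => i; rewrite !tE; case: (M <= i)%N.
have Rdd M n G x : rcomp (t M n) (Pinf_d n) G (rcomp (t M (n + 1)) (Pinf_d (n + 1)) G x) = 0.
  change (t M n G (Pinf_d n G (t M (n + 1) G (Pinf_d (n + 1) G x))) = 0).
  by rewrite -tdt Pinf_dd; exact: linear0.
(* The quotient by stage M, realized on all of [Pinf_term] with the truncated differential; the
   cells of stage M remain as an idle summand with zero differential. *)
pose R M : cplx := @Cplx k U Pinf_term (fun n => rcomp (t M n) (Pinf_d n)) (@Rdd M).
have gP n G x : dsum_pred (V := fun M => R M n G) predT (fun M => t M n G x).
  split=> //; have [N0 xN] := stage_in_surj x.
  apply: (@sub_finite_set _ _ [set` iota 0 N0]%classic); last exact: finite_seq.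
  move=> M /=; rewrite mem_iota add0n /=; apply: contraR; rewrite -leqNgt => N0M.
  apply/eqP; have := tk M n G x; rewrite (xN M N0M) -{1}[x]addr0 => /addrI e.
  exact: esym e.
pose g0 n : rhom (Pinf_term n) (coprod R n) := @rinto k U nat predT (fun M => R M n) (Pinf_term n) (t^~ n) (@gP n).
have gd n G x : g0 n G (cd Pinf n G x) = cd (coprod R) n G (g0 (n + 1) G x).
  by apply: dsum_inj => M; exact: tdt.
have [S fS [h0 hE0]] := hc nat R (@CMap k U Pinf (coprod R) g0 gd).
have [M nSM] : exists M, ~ S M.
  apply: contrapT => h; have : finite_set [set: nat].
    by apply: (@sub_finite_set _ _ S) => // i _; apply: contrapT => nS; apply: h; exists i.
  exact: infinite_nat.
pose h n : rhom (Pinf_term n) (Pinf_term (n + 1)) := rcomp (t M (n + 1)) (rcomp (rproj predT (fun M => R M (n + 1)) M) (h0 n)).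
have hE n G x : t M (n + 1) G x = t M (n + 1) G (Pinf_d (n + 1) G (h (n + 1) G x)) + h n G (Pinf_d n G x).
  have := congr1 (fun z : coprod R (n + 1) G => z M) (hE0 n G x).
  rewrite dsumDE [LHS]rtruncE; case: asboolP => // _.
  change (t M (n + 1) G x = t M (n + 1) G (Pinf_d (n + 1) G (h0 (n + 1) G x M)) + h0 n G (Pinf_d n G x) M -> 
   t M (n + 1) G x = t M (n + 1) G (Pinf_d (n + 1) G (t M (n + 1 + 1) G (h0 (n + 1) G x M))) + t M (n + 1) G (h0 n G (Pinf_d n G x) M)).
  by rewrite -tdt => E; rewrite -{1}(tt M (n + 1) G x) E linearD tt.
(* The deformed identity 1 - (d h + h d): truncating it gives zero by [hE], so it takes values in
   stage M. *)
have [phi phiE] := @desc (fun n => rhom (Pinf_term n) (Pinf_term n)) (fun n => radd (rid (Pinf_term (n + 1)))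
  (rscale (-1) (radd (rcomp (Pinf_d (n + 1)) (h (n + 1))) (rcomp (h n) (Pinf_d n))))).
have phiS n G x : phi (n + 1) G x = x - (Pinf_d (n + 1) G (h (n + 1) G x) + h n G (Pinf_d n G x)).
  by rewrite phiE -scaleN1r.
have phid : forall n G x, phi n G (Pinf_d n G x) = Pinf_d n G (phi (n + 1) G x).
  apply: intS_ind => n G x; rewrite !phiS Pinf_dd linear0 addr0.
  by rewrite (linearB (Pinf_d (n + 1) G)) (linearD (Pinf_d (n + 1) G)) Pinf_dd add0r.
have phit : forall n G x, phi n G x = stage_in M n G (stage_pr M n G (phi n G x)).
  apply: intS_ind => n G x; rewrite [LHS](tk M).
  suff -> : t M (n + 1) G (phi (n + 1) G x) = 0 by rewrite addr0.
  rewrite phiS linearB linearD.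
  have -> : t M (n + 1) G (h n G (Pinf_d n G x)) = h n G (Pinf_d n G x) by exact: tt.
  by rewrite -hE subrr.
have ad_ n G x : rcomp (stage_pr M n) (phi n) G (cd Pinf n G x) = cd (P M) n G (rcomp (stage_pr M (n + 1)) (phi (n + 1)) G x).
  change (stage_pr M n G (phi n G (Pinf_d n G x)) = cd (P M) n G (stage_pr M (n + 1) G (phi (n + 1) G x))).
  by rewrite phid phit Pinf_d_stage !stage_inK.
exists (P M), (@CMap k U Pinf (P M) (fun n => rcomp (stage_pr M n) (phi n)) ad_).
exists (@CMap k U (P M) Pinf (stage_in M) (fun n G x => esym (@Pinf_d_stage M n G x))); split; first exact: stage_perfect.
exists (fun n => rscale (-1) (h n)) => n G x; rewrite csubE.
change (stage_in M (n + 1) G (stage_pr M (n + 1) G (phi (n + 1) G x)) - x =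
  Pinf_d (n + 1) G (-1 *: h (n + 1) G x) + -1 *: h n G (Pinf_d n G x)).
rewrite -phit phiS linearZ_LR -scalerDr scaleN1r.
by rewrite [LHS]addrAC subrr sub0r.
Qed.

End Pinf.

Section ResThm.
Variables (k : fieldType) (p : nat).
Notation U := (abelian_pgroup p).
Notation cplx := (cplx k U).

Lemma resolution (X : cplx) : FD X -> exists (T : cplx) (q : cmap T X),
  [/\ Kproj T, quasi_iso q, forall n, Pj (T n) & hcompact T ->
    exists (F : cplx) (a : cmap T F) (b : cmap F T), perfect F /\ htpy (cmap_comp b a) (cmap_id T)].
Proof.
move=> XFD.
have /dchoice [A AP] : forall N, exists A : forall s : stage X, att (sq s),
   forall s, att_bound N (A s) /\ (FD (fib (sq s)) -> kills N (A s)).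
  by move=> N; have /dchoice [a aP] := fun s : stage X => att_ex N (sq s); exists a.
exists (Pinf A), (Pinf_q A); split.
- exact: Pinf_Kproj.
- exact: Pinf_qis.
- exact: Pinf_Pj.
- exact: hcompact_Pinf.
Qed.

End ResThm.

(** * Compact objects and triangles *)

Section Shift.
Variables (k : fieldType) (p : nat).
Notation U := (abelian_pgroup p).
Notation rep := (rep k U).
Notation cplx := (cplx k U).

Fact Om_dd (X : cplx) n G x : rscale (-1) (cd X (n + 1)) G (rscale (-1) (cd X (n + 1 + 1)) G x) = 0.
Proof. by rewrite /= linearZ /= cdd !scaler0. Qed.
(* The desuspension. *)
Definition Om (X : cplx) : cplx := Cplx (@Om_dd X).

Fact Om_map_d (X Y : cplx) (f : cmap X Y) n G x :
  f (n + 1) G (cd (Om X) n G x) = cd (Om Y) n G (f (n + 1 + 1) G x).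
Proof. by rewrite /= linearZ /= cfd. Qed.
Definition Om_map (X Y : cplx) (f : cmap X Y) : cmap (Om X) (Om Y) :=
  @CMap k U (Om X) (Om Y) (fun n => f (n + 1)) (@Om_map_d X Y f).

Lemma Om_null (X Y : cplx) (f : cmap X Y) : null f -> null (Om_map f).
Proof.
move=> [h hE]; exists (fun n => rscale (-1) (h (n + 1))) => n G x.
by rewrite /= hE !linearZ /= !scalerA mulrNN mulr1 !scale1r.
Qed.

(** Desuspension changes the sign of the differential, which the free sign e in [Kproj] absorbs. *)
Lemma Kproj_Om T : Kproj T -> Kproj (Om T).
Proof.
move=> KT A acA e e1 c cd_.
have [c' c'E] := @desc (fun m => forall n, rhom (T m) (A n)) c.
have e1' : - e * - e = 1 by rewrite mulrNN.
have [|h hE] := KT A acA (- e) e1' c'.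
  apply: intS_ind => m n G x; rewrite !c'E.
  have := cd_ m n G x; rewrite /= scaleN1r linearN => /eqP.
  by rewrite eqr_oppLR -scaleNr => /eqP.
exists (fun m => h (m + 1)) => m n G x.
by rewrite -c'E hE /= scaleN1r linearN scalerN scaleNr.
Qed.

(** The fibre contains the desuspension of P' with quotient P: contract on the subcomplex, then
    correct the family on P by the contraction composed with f. *)
Lemma Kproj_fib (P P' : cplx) (f : cmap P P') : Kproj P -> Kproj P' -> Kproj (fib f).
Proof.
move=> KP /Kproj_Om KP' A acA e e1 c cd_.
pose i2 m : rhom (P' (m + 1)) (fib f m) := rpair (rzero _ _) (rid _).
pose i1 m : rhom (P m) (fib f m) := rpair (rid _) (rzero _ _).
have i12 m G x y : ((x, y) : fib f m G) = i1 m G x + i2 m G y.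
  by congr pair; rewrite /= ?addr0 ?add0r.
have di2 m G y : cd (fib f) m G (i2 (m + 1) G y) = i2 m G (cd (Om P') m G y).
  by congr pair; [exact: linear0|rewrite /= scaleN1r linear0 sub0r].
have di1 m G x : cd (fib f) m G (i1 (m + 1) G x) = i1 m G (cd P m G x) + i2 m G (f (m + 1) G x).
  by rewrite -i12; congr pair; rewrite /= linear0 subr0.
have [|l lE] := KP' A acA e e1 (fun m n => rcomp (c m n) (i2 m)).
  move=> m n G y.
  change (c m n G (i2 m G (cd (Om P') m G y)) = e *: cd A n G (c (m + 1) (n + 1) G (i2 (m + 1) G y))).
  by rewrite -di2 cd_.
have lE' m n G y : c (m + 1) n G (i2 (m + 1) G y) = cd A n G (l (m + 1) (n + 1) G y) - e *: l m n G (cd P' (m + 1) G y).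
  apply: etrans (lE m n G y) _; rewrite [cd (Om P') m G y]scaleN1r.
  by rewrite linearN scalerN.
have [l' l'E] := @desc (fun m => forall n, rhom (P' m) (A n)) l.
have [|h hE] := KP A acA e e1 (fun m n => radd (rcomp (c m n) (i1 m)) (rscale (- e) (rcomp (l' m n) (f m)))).
  apply: intS_ind => m n G x; rewrite /= !l'E.
  change (c (m + 1) n G (i1 (m + 1) G (cd P (m + 1) G x)) + - e *: l m n G (f (m + 1) G (cd P (m + 1) G x)) =
    e *: cd A n G (c (m + 1 + 1) (n + 1) G (i1 (m + 1 + 1) G x) + - e *: l (m + 1) (n + 1) G (f (m + 1 + 1) G x))).
  have -> : i1 (m + 1) G (cd P (m + 1) G x) = cd (fib f) (m + 1) G (i1 (m + 1 + 1) G x) - i2 (m + 1) G (f (m + 1 + 1) G x).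
    by rewrite di1 addrK.
  rewrite linearB cd_ lE' cfd (linearD (cd A n G)) scalerDr.
  have -> : forall z, e *: cd A n G (- e *: z) = - cd A n G z.
    by move=> z; rewrite linearZ_LR scalerA mulrN e1 scaleN1r.
  by rewrite -[LHS]addrA; congr (_ + _); rewrite scaleNr opprB [LHS]addrAC subrr sub0r.
exists (fun m n => radd (rcomp (h m n) (rfst _ _)) (rcomp (l m n) (rsnd _ _))) => m n G [x y].
have := hE m n G x.
change (c (m + 1) n G (i1 (m + 1) G x) + (- e) *: l' (m + 1) n G (f (m + 1) G x) =
  cd A n G (h (m + 1) (n + 1) G x) + e *: h m n G (cd P m G x) ->
  c (m + 1) n G (x, y) = cd A n G (h (m + 1) (n + 1) G x + l (m + 1) (n + 1) G y) +
  e *: (h m n G (cd P m G x) + l m n G (f (m + 1) G x - cd P' (m + 1) G y))).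
rewrite i12 linearD lE' l'E linearD linearB scalerDr scalerBr scaleNr.
move=> /eqP; rewrite subr_eq => /eqP ->.
set A1 := cd A n G (h _ _ _ _); set B1 := cd A n G _; set C1 := e *: _; set D1 := e *: l m n G (f _ _ _).
set E1 := e *: l m n G _.
by rewrite [RHS]addrACA [B1 + (D1 - E1)]addrCA [RHS]addrA.
Qed.

Definition hret (T : cplx) := exists (F : cplx) (a : cmap T F) (b : cmap F T),
  perfect F /\ htpy (cmap_comp b a) (cmap_id T).

(** Up to homotopy g is (g b) a, and g b starts at a perfect complex. *)
Lemma hret_hcompact T : hret T -> hcompact T.
Proof.
move=> [F [a [b [/perfect_hcompact pF ba]]]] I Z g.
have [S fS nS] := pF I Z (cmap_comp g b).
exists S => //; have := htpy_compl (cmap_comp (ctrunc Z (fun i => ~ S i)) g) (htpy_sym ba).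
have := null_compr a nS => n1 /(htpy_null (f := cmap_comp _ (cmap_id T))) h.
have e : null (cmap_comp (cmap_comp (ctrunc Z (fun i => ~ S i)) g) (cmap_comp b a)).
  by apply: null_ext n1.
by apply: null_ext (h e).
Qed.

Lemma perfect_Om F : perfect F -> perfect (Om F).
Proof.
move=> [[N F0] Ff]; split; last by move=> n; apply: Ff.
by exists N.+1 => n Nn G x; apply: F0; move: Nn; lia.
Qed.

Lemma hret_Om T : hret T -> hret (Om T).
Proof.
move=> [F [a [b [pF ba]]]]; exists (Om F), (Om_map a), (Om_map b); split; first exact: perfect_Om.
by have := Om_null ba; apply: null_ext.
Qed.

Lemma qis_Om (X Y : cplx) (q : cmap X Y) : quasi_iso q -> quasi_iso (Om_map q).
Proof.
move=> qq n G; have [q1 q2] := qq (n + 1) G; split=> [x|y].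
  rewrite /= scaleN1r => /eqP; rewrite oppr_eq0 => /eqP dx [y E].
  have [|x' ->] := q1 x dx; first by exists (- y); rewrite linearN E scaleN1r.
  by exists (- x'); rewrite linearN scaleN1r opprK.
rewrite /= scaleN1r => /eqP; rewrite oppr_eq0 => /eqP dy.
have [x dx [y' yE]] := q2 y dy; exists x; first by rewrite dx scaler0.
by exists (- y'); rewrite linearN scaleN1r opprK.
Qed.

Lemma compact_qis (X Y : cplx) (q : cmap X Y) : quasi_iso q -> compact X <-> compact Y.
Proof.
move=> qq; have e : diso X Y.
  exists (dmap q), (dinv qq); split; [exact: deq_invl|exact: deq_invr].
by have [h1 h2] := diso_retract e; split; apply: compact_retract.
Qed.

Lemma compact_diso (X Y : cplx) : diso X Y -> compact X <-> compact Y.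
Proof. by move=> /diso_retract [h1 h2]; split; apply: compact_retract. Qed.

Lemma compact_res (X : cplx) : compact X -> exists (T : cplx) (q : cmap T X),
  [/\ Kproj T, quasi_iso q, forall n, Pj (T n) & hret T].
Proof.
move=> cX; have [T [q [KT qq PT hT]]] := resolution (compact_FD cX).
exists T, q; split=> //; apply: hT; exact/(hcompact_compact KT qq).
Qed.

Lemma compact_Om (X : cplx) : compact X -> compact (Om X).
Proof.
move=> /compact_res [T [q [KT qq _ hT]]].
by apply/(hcompact_compact (Kproj_Om KT) (qis_Om qq)); apply/hret_hcompact/hret_Om.
Qed.

Lemma FD_Om_inv (X : cplx) : FD (Om X) -> FD X.
Proof.
move=> F; apply: intS_ind => n G; have [l [lc ls]] := F n G.
have cE x : cd X (n + 1) G x = 0 <-> cd (Om X) n G x = 0.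
  rewrite /= scaleN1r; split=> [->|/eqP]; first by rewrite oppr0.
  by rewrite oppr_eq0 => /eqP.
exists l; split=> [x /lc /cE //|x /cE /ls [y Sy]].
exists (- y); have -> : cd X (n + 1 + 1) G (- y) = cd (Om X) (n + 1) G y by rewrite linearN /= scaleN1r.
exact: Sy.
Qed.

(** Rather than suspending, a map from [T] to a coproduct is desuspended, made null outside a finite
    set there, and the homotopy is re-indexed by [desc]. *)
Lemma compact_Om_inv (X : cplx) : compact (Om X) -> compact X.
Proof.
move=> cX; have [T [q [KT qq _ _]]] := resolution (FD_Om_inv (compact_FD cX)).
apply/(hcompact_compact KT qq) => I Z g.
have hT : hcompact (Om T) by apply/(hcompact_compact (Kproj_Om KT) (qis_Om qq)).
have gd n G x : g (n + 1) G (cd (Om T) n G x) = cd (coprod (fun i => Om (Z i))) n G (g (n + 1 + 1) G x).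
  change (g (n + 1) G (-1 *: cd T (n + 1) G x) = cd (coprod (fun i => Om (Z i))) n G (g (n + 1 + 1) G x)).
  by rewrite linearZ_LR cfd; apply: dsum_inj.
have [S fS [h hE]] := hT I (fun i => Om (Z i)) (@CMap k U (Om T) (coprod (fun i => Om (Z i))) (fun n => g (n + 1)) gd).
exists S => //.
have [l lE] := @desc (fun n => rhom (T n) (coprod Z (n + 1))) (fun n => rscale (-1) (h n)).
exists l; apply: intS_ind => n G x; rewrite !lE.
have := hE n G x.
change (ctrunc Z (fun i => ~ S i) (n + 1 + 1) G (g (n + 1 + 1) G x) =
  cd (coprod (fun i => Om (Z i))) (n + 1) G (h (n + 1) G x) + h n G (-1 *: cd T (n + 1) G x) ->
  ctrunc Z (fun i => ~ S i) (n + 1 + 1) G (g (n + 1 + 1) G x) =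
  cd (coprod Z) (n + 1 + 1) G (-1 *: h (n + 1) G x) + -1 *: h n G (cd T (n + 1) G x)).
move=> ->; rewrite !linearZ_LR; congr (_ + _).
by apply: dsum_inj.
Qed.

Section FibMap.
Variables (Y Z TY TZ : cplx) (f : cmap Y Z) (qY : cmap TY Y) (qZ : cmap TZ Z) (f' : cmap TY TZ).
Variable s : forall n, rhom (TY n) (Z (n + 1)).
Hypothesis sE : forall n G x, qZ (n + 1) G (f' (n + 1) G x) =
  f (n + 1) G (qY (n + 1) G x) - (cd Z (n + 1) G (s (n + 1) G x) + s n G (cd TY n G x)).
(** A square that commutes up to the homotopy s induces a map of fibres, s entering its second
    component. *)
Definition fibmap0 n : rhom (fib f' n) (fib f n) :=
  rpair (rcomp (qY n) (rfst _ _)) (radd (rcomp (qZ (n + 1)) (rsnd _ _)) (rcomp (s n) (rfst _ _))).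
Fact fibmap_d n G x : fibmap0 n G (cd (fib f') n G x) = cd (fib f) n G (fibmap0 (n + 1) G x).
Proof.
case: x => x y; congr pair => /=; first exact: cfd.
rewrite linearB sE (linearD (cd Z (n + 1) G)) cfd; zmod.
Qed.
Definition fibmap : cmap (fib f') (fib f) := CMap fibmap_d.
Hypotheses (qqY : quasi_iso qY) (qqZ : quasi_iso qZ).
(** The five lemma for the two fibre sequences, by a chase on elements. *)
Lemma fibmap_qis : quasi_iso fibmap.
Proof.
move=> n G; split.
  move=> [x y] dxy [[u v] Exy].
  have dx : cd TY n G x = 0 := congr1 fst dxy.
  have /eqP fx : f' (n + 1) G x - cd TZ (n + 1) G y = 0 := congr1 snd dxy.
  have qx : qY (n + 1) G x = cd Y (n + 1) G u := congr1 fst Exy.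
  have qy : qZ (n + 1 + 1) G y + s (n + 1) G x = f (n + 1 + 1) G u - cd Z (n + 1 + 1) G v := congr1 snd Exy.
  rewrite subr_eq0 in fx; move/eqP: fx => fx.
  have [x1 xE1] := (qqY n G).1 x dx (ex_intro _ u qx).
  have [|x2 dx2 [u' uE]] := (qqY (n + 1) G).2 (qY (n + 1 + 1) G x1 - u).
    by rewrite linearB -cfd -xE1 qx subrr.
  pose x0 := x1 - x2.
  have dx0 : cd TY (n + 1) G x0 = x by rewrite linearB -xE1 dx2 subr0.
  have uE' : u = qY (n + 1 + 1) G x0 - cd Y (n + 1 + 1) G u'.
    apply/eqP; rewrite linearB eq_sym [X in X == _]addrAC subr_eq -subr_eq0 opprD.
    apply/eqP; move/eqP: uE; rewrite -subr_eq0 opprD => /eqP <-.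
    by rewrite [LHS]addrC !addrA; congr (_ - _); rewrite addrC addrA.
  have [||z zE] := (qqZ (n + 1) G).1 (y - f' (n + 1 + 1) G x0).
  - by rewrite linearB -cfd dx0 fx subrr.
  - exists (s (n + 1 + 1) G x0 - f (n + 1 + 1 + 1) G u' - v).
    have -> : qZ (n + 1 + 1) G (y - f' (n + 1 + 1) G x0) =
       (f (n + 1 + 1) G u - cd Z (n + 1 + 1) G v - s (n + 1) G x) -
       (f (n + 1 + 1) G (qY (n + 1 + 1) G x0) - (cd Z (n + 1 + 1) G (s (n + 1 + 1) G x0) + s (n + 1) G x)).
      by rewrite linearB sE dx0 -qy addrK.
    rewrite (linearB (cd Z (n + 1 + 1) G)) (linearB (cd Z (n + 1 + 1) G)) -(cfd f) uE' (linearB (f (n + 1 + 1) G)).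
    zmod.
  exists (x0, - z); congr pair; rewrite /= ?dx0 //.
  by rewrite linearN opprK -zE [RHS]addrC subrK.
move=> [u v] duv.
have du : cd Y n G u = 0 := congr1 fst duv.
have /eqP fu : f (n + 1) G u - cd Z (n + 1) G v = 0 := congr1 snd duv.
rewrite subr_eq0 in fu; move/eqP: fu => fu.
have [x dx [u' uE]] := (qqY n G).2 u du.
have qf : qZ (n + 1) G (f' (n + 1) G x) = cd Z (n + 1) G (v - f (n + 1 + 1) G u' - s (n + 1) G x).
  rewrite sE dx (linear0 (s n G)) addr0 (linearB (cd Z (n + 1) G)) (linearB (cd Z (n + 1) G)) -(cfd f) -fu uE.
  by rewrite (linearD (f (n + 1) G)) addrK.
have [||y1 yE1] := (qqZ n G).1 (f' (n + 1) G x).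
- by rewrite -cfd dx linear0.
- by eexists; exact: qf.
have [|y2 dy2 [v' vE]] := (qqZ (n + 1) G).2 (v - f (n + 1 + 1) G u' - s (n + 1) G x - qZ (n + 1 + 1) G y1).
  by rewrite (linearB (cd Z (n + 1) G)) -qf -cfd -yE1 subrr.
exists (x, y1 + y2).
  by congr pair; rewrite //= linearD dy2 addr0 yE1 subrr.
exists (u', - v').
transitivity ((qY (n + 1) G x + cd Y (n + 1) G u',
  (qZ (n + 1 + 1) G (y1 + y2) + s (n + 1) G x) + (f (n + 1 + 1) G u' - cd Z (n + 1 + 1) G (- v'))) : fib f (n + 1) G) => //.
congr pair => //.
rewrite (linearN (cd Z (n + 1 + 1) G)) opprK (linearD (qZ (n + 1 + 1) G)).
apply: (zmod_from vE); zmod.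
Qed.
End FibMap.

(** On resolutions, a map g from the fibre to a coproduct is first made null on the desuspension of
    [TZ] outside S1; what remains comes, up to homotopy, from a map [gam] out of [TY], which is null
    outside S2. *)
Lemma compact_fib (Y Z : cplx) (f : cmap Y Z) : compact Y -> compact Z -> compact (fib f).
Proof.
move=> /compact_res [TY [qY [KY qqY _ hY]]] /compact_res [TZ [qZ [KZ qqZ _ hZ]]].
have [f' [s0 sE0]] := Kproj_lift (cmap_comp f qY) KY qqZ.
have sE n G x : qZ (n + 1) G (f' (n + 1) G x) =
  f (n + 1) G (qY (n + 1) G x) - (cd Z (n + 1) G (rscale (-1) (s0 (n + 1)) G x) + rscale (-1) (s0 n) G (cd TY n G x)).
  have := sE0 n G x; rewrite csubE /= => /eqP; rewrite subr_eq => /eqP ->.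
  by rewrite linearZ_LR -scalerDr scaleN1r opprK [RHS]addrC.
apply/(hcompact_compact (Kproj_fib (f := f') KY KZ) (fibmap_qis sE qqY qqZ)) => I W g.
pose i2 n : rhom (TZ (n + 1)) (fib f' n) := rpair (rzero _ _) (rid _).
pose i1 n : rhom (TY n) (fib f' n) := rpair (rid _) (rzero _ _).
have i12 m G x y : ((x, y) : fib f' m G) = i1 m G x + i2 m G y.
  by congr pair; rewrite /= ?addr0 ?add0r.
have di2 n G y : i2 n G (cd (Om TZ) n G y) = cd (fib f') n G (i2 (n + 1) G y).
  by congr pair; [exact/esym/linear0|rewrite /= scaleN1r linear0 sub0r].
have di1 n G x : i1 n G (cd TY n G x) = cd (fib f') n G (i1 (n + 1) G x) - i2 n G (f' (n + 1) G x).
  rewrite -[RHS](addrK (i2 n G (f' (n + 1) G x))) [X in _ = X - _]subrK.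
  have -> : cd (fib f') n G (i1 (n + 1) G x) = i1 n G (cd TY n G x) + i2 n G (f' (n + 1) G x).
    by rewrite -i12; congr pair; rewrite /= linear0 subr0.
  by rewrite addrK.
have hOZ := hret_hcompact (hret_Om hZ).
have [S1 fS1 [l lE]] := hOZ I W (cmap_comp g (CMap di2)).
pose t1 := ctrunc W (fun i => ~ S1 i).
pose g1 := cmap_comp t1 g.
have lE' n G y : g1 (n + 1) G (i2 (n + 1) G y) = cd (coprod W) (n + 1) G (l (n + 1) G y) - l n G (cd TZ (n + 1) G y).
  apply: etrans (lE n G y) _; rewrite [cd (Om TZ) n G y]scaleN1r.
  by rewrite linearN.
have [gam gamE] := @desc (fun n => rhom (TY n) (coprod W n)) (fun n =>
  radd (rcomp (g1 (n + 1)) (i1 (n + 1))) (rscale (-1) (rcomp (l n) (f' (n + 1))))).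
have gamS n G x : gam (n + 1) G x = g1 (n + 1) G (i1 (n + 1) G x) - l n G (f' (n + 1) G x).
  by rewrite gamE -scaleN1r.
have gamd : forall n G x, gam n G (cd TY n G x) = cd (coprod W) n G (gam (n + 1) G x).
  apply: intS_ind => n G x; rewrite !gamS di1 (linearB (g1 (n + 1) G)) (linearB (cd (coprod W) (n + 1) G)) cfd lE' cfd.
  by rewrite opprB addrA [LHS]addrAC addrK.
have [S2 fS2 nS2] := hret_hcompact hY (@CMap k U TY (coprod W) gam gamd).
exists (fun i => S1 i \/ S2 i); first by apply: (@sub_finite_set _ _ (S1 `|` S2)%classic); rewrite ?finite_setU.
have tE n G (z : coprod W n G) : ctrunc W (fun i => ~ (S1 i \/ S2 i)) n G z =
   ctrunc W (fun i => ~ S2 i) n G (t1 n G z).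
  apply: dsum_inj => i; rewrite !ctruncE.
  case: asboolP => [nS|/contrapT S]; case: asboolP => [n2|/contrapT s2]; rewrite ?ctruncE //.
  - by case: asboolP => // n1; case: n1 => s1; apply: nS; left.
  - by case: nS; right.
  - by case: asboolP => // n1; case: S => // s2; case: n2.
pose n2 := cmap_comp (ctrunc W (fun i => ~ S2 i)) (cmap_comp (CMap gamd) (fib_fst f')).
have nn2 : null n2 by have := null_compr (fib_fst f') nS2; apply: null_ext.
have hg : null (csub g1 (cmap_comp (CMap gamd) (fib_fst f'))).
  exists (fun n => rcomp (l n) (rsnd _ _)) => n G [x y]; rewrite csubE.
  change (g1 (n + 1) G (x, y) - gam (n + 1) G x =
    cd (coprod W) (n + 1) G (l (n + 1) G y) + l n G (f' (n + 1) G x - cd TZ (n + 1) G y)).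
  rewrite gamS i12 (linearD (g1 (n + 1) G)) lE' (linearB (l n G)).
  zmod.
apply: null_ext (null_add (null_compl (ctrunc W (fun i => ~ S2 i)) hg) nn2) => n G x.
change (ctrunc W (fun i => ~ S2 i) n G (csub g1 (cmap_comp (CMap gamd) (fib_fst f')) n G x) +
  ctrunc W (fun i => ~ S2 i) n G (cmap_comp (CMap gamd) (fib_fst f') n G x) =
  ctrunc W (fun i => ~ (S1 i \/ S2 i)) n G (g n G x)).
by rewrite tE -linearD csubE subrK.
Qed.

Section Rotate.
Variables (Y Z : cplx) (f : cmap Y Z).

Fact fib_in_d n G w : rpair (rzero (Om Z n) (Y n)) (rid _) G (cd (Om Z) n G w) =
  cd (fib f) n G (rpair (rzero (Om Z (n + 1)) (Y (n + 1))) (rid _) G w).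
Proof. by congr pair; [exact/esym/linear0|rewrite /= scaleN1r linear0 sub0r]. Qed.
Definition fib_in : cmap (Om Z) (fib f) :=
  @CMap k U (Om Z) (fib f) (fun n => rpair (rzero (Om Z n) (Y n)) (rid _)) fib_in_d.

Fact fib_in_cofib_d n G w :
  rcomp (rfst (Y (n + 1)) (Z (n + 1 + 1))) (rsnd (Om Z n) _) G (cd (fib fib_in) n G w) =
  cd (Om Y) n G (rcomp (rfst (Y (n + 1 + 1)) (Z (n + 1 + 1 + 1))) (rsnd (Om Z (n + 1)) _) G w).
Proof. by rewrite /= scaleN1r; apply: sub0r. Qed.
(** Rotation of the triangle: the fibre of Om Z -> fib f is Om Y up to quasi-isomorphism, so
    compactness of [Y] reduces to that of a fibre. *)
Definition fib_in_cofib : cmap (fib fib_in) (Om Y) :=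
  @CMap k U (fib fib_in) (Om Y) (fun n => rcomp (rfst _ _) (rsnd _ _)) fib_in_cofib_d.

Lemma fib_in_cofib_qis : quasi_iso fib_in_cofib.
Proof.
move=> n G; split.
  move=> [w [y z]] dx [y' E].
  have /= dw : cd (Om Z) n G w = 0 := congr1 fst dx.
  have /= Ew : w - (f (n + 1 + 1) G y - cd Z (n + 1 + 1) G z) = 0 := congr1 (fun t => t.2.2) dx.
  have Ey : y = - cd Y (n + 1 + 1) G y' by rewrite -scaleN1r; exact: E.
  exists (z + f (n + 1 + 1 + 1) G y', (y', 0)).
  change ((w, (y, z)) = (-1 *: cd Z (n + 1 + 1) G (z + f (n + 1 + 1 + 1) G y'),
    (0 - cd Y (n + 1 + 1) G y', (z + f (n + 1 + 1 + 1) G y') - (f (n + 1 + 1 + 1) G y' - cd Z (n + 1 + 1 + 1) G 0)))).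
  congr (_, (_, _)).
  - rewrite scaleN1r (linearD (cd Z (n + 1 + 1) G)) -cfd.
    have -> : cd Y (n + 1 + 1) G y' = - y by rewrite Ey opprK.
    by rewrite linearN; apply: (zmod_from Ew); zmod.
  - by rewrite sub0r.
  by rewrite linear0 subr0 addrK.
move=> y; rewrite /= scaleN1r => /eqP; rewrite oppr_eq0 => /eqP dy.
exists (f (n + 1 + 1) G y, (y, 0)); last first.
  exists 0; change (y = y + -1 *: cd Y (n + 1 + 1) G 0).
  by rewrite linear0 scaler0 addr0.
change ((-1 *: cd Z (n + 1) G (f (n + 1 + 1) G y), (0 - cd Y (n + 1) G y,
   f (n + 1 + 1) G y - (f (n + 1 + 1) G y - cd Z (n + 1 + 1) G 0))) = 0 :> fib fib_in n G).
by rewrite -cfd dy !linear0 !addr0 subrr ?scaler0.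
Qed.

Fact fib_fst_cofib_d n G w :
  radd (rcomp (rsnd (Y n) (Z (n + 1))) (rfst _ (Y (n + 1)))) (rscale (-1) (rcomp (f (n + 1)) (rsnd _ _))) G
    (cd (fib (fib_fst f)) n G w) =
  cd (Om Z) n G (radd (rcomp (rsnd _ _) (rfst _ _)) (rscale (-1) (rcomp (f (n + 1 + 1)) (rsnd _ _))) G w).
Proof.
case: w => [[y z] y'].
change (f (n + 1) G y - cd Z (n + 1) G z + -1 *: f (n + 1) G (y - cd Y (n + 1) G y') =
  -1 *: cd Z (n + 1) G (z + -1 *: f (n + 1 + 1) G y')).
rewrite (linearB (f (n + 1) G)) (linearD (cd Z (n + 1) G)) linearZ_LR cfd !scaleN1r; zmod.
Qed.
(** The other rotation: the fibre of fib f -> Y is Om Z up to quasi-isomorphism. *)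
Definition fib_fst_cofib : cmap (fib (fib_fst f)) (Om Z) :=
  @CMap k U (fib (fib_fst f)) (Om Z) (fun n =>
    radd (rcomp (rsnd _ _) (rfst _ _)) (rscale (-1) (rcomp (f (n + 1)) (rsnd _ _)))) fib_fst_cofib_d.

Lemma fib_fst_cofib_qis : quasi_iso fib_fst_cofib.
Proof.
move=> n G; split.
  move=> [[y z] y'] dx [z' E].
  have /= dy : y - cd Y (n + 1) G y' = 0 := congr1 snd dx.
  have E' : z + -1 *: f (n + 1 + 1) G y' = -1 *: cd Z (n + 1 + 1) G z' by exact: E.
  exists ((y', z'), 0).
  change ((y, z, y') = ((cd Y (n + 1) G y', f (n + 1 + 1) G y' - cd Z (n + 1 + 1) G z'),
     y' - cd Y (n + 1 + 1) G 0)).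
  congr (_, _, _); last by rewrite linear0 subr0.
    by apply: (zmod_from dy); zmod.
  by move: E'; rewrite !scaleN1r => E'; apply: (zmod_from E'); zmod.
move=> z; rewrite /= scaleN1r => /eqP; rewrite oppr_eq0 => /eqP dz.
exists ((0, z), 0).
  change ((cd Y n G 0, f (n + 1) G 0 - cd Z (n + 1) G z, 0 - cd Y (n + 1) G 0) = 0 :> fib (fib_fst f) n G).
  by rewrite dz !linear0 ?addr0 ?subr0 ?addr0.
exists 0; change (z = z + -1 *: f (n + 1 + 1) G 0 + -1 *: cd Z (n + 1 + 1) G 0).
by rewrite !linear0 ?scaler0 !addr0.
Qed.

Lemma compact_fibl : compact (fib f) -> compact Z -> compact Y.
Proof.
move=> cf /compact_Om cZ; apply: compact_Om_inv.
by apply/(compact_qis fib_in_cofib_qis)/compact_fib.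
Qed.

Lemma compact_fibr : compact (fib f) -> compact Y -> compact Z.
Proof.
move=> cf cY; apply: compact_Om_inv.
by apply/(compact_qis fib_fst_cofib_qis)/compact_fib.
Qed.
End Rotate.

End Shift.

(** * Tensor products of complexes *)

Section TensLemmas.
Variable k : fieldType.

Definition tpure (V W : lmodType k) (v : V) (w : W) : tens V W := tpi [:: (v, w)].

Lemma tpi_cat (V W : lmodType k) (s t : seq (V * W)) : tpi (s ++ t) = tpi s + tpi t.
Proof. by rewrite -tensDE. Qed.

Lemma tpi_sum (V W : lmodType k) (s : seq (V * W)) : tpi s = \sum_(q <- s) tpure q.1 q.2.
Proof.
elim: s => [|[v w] s IH]; first by rewrite big_nil.
by rewrite big_cons -IH -tpi_cat.
Qed.

Lemma tpureDl (V W : lmodType k) (v v' : V) (w : W) : tpure (v + v') w = tpure v w + tpure v' w.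
Proof. by rewrite -tpi_cat; apply: tpi_eq; apply: tens_Dl. Qed.
Lemma tpureDr (V W : lmodType k) (v : V) (w w' : W) : tpure v (w + w') = tpure v w + tpure v w'.
Proof. by rewrite -tpi_cat; apply: tpi_eq; apply: tens_Dr. Qed.
Lemma tpureZl (V W : lmodType k) a (v : V) (w : W) : tpure (a *: v) w = a *: tpure v w.
Proof. by rewrite -[RHS]/(tensZ a _) tensZE. Qed.
Lemma tpureZr (V W : lmodType k) a (v : V) (w : W) : tpure v (a *: w) = a *: tpure v w.
Proof. by rewrite -tpureZl; apply/esym/tpi_eq/tens_Z. Qed.

Lemma tens_map_pure (V W V' W' : lmodType k) (f : {linear V -> V'}) (g : {linear W -> W'}) v w :
  tens_map f g (tpure v w) = tpure (f v) (g w).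
Proof. by rewrite /tpure tens_mapE. Qed.

Lemma tens_lin_ext (V W Z : lmodType k) (f g : {linear tens V W -> Z}) :
  (forall v w, f (tpure v w) = g (tpure v w)) -> f =1 g.
Proof.
move=> fg; elim/tens_ind => s; rewrite tpi_sum !linear_sum.
by apply: eq_bigr => q _; apply: fg.
Qed.

Section Out.
Variables (V W Z : lmodType k) (B : V -> W -> Z).
Hypothesis Bl : forall w, linear (B^~ w).
Hypothesis Br : forall v, linear (B v).
Let bsum (s : seq (V * W)) : Z := \sum_(q <- s) B q.1 q.2.
Let Bl0 w : B 0 w = 0.
Proof. exact: (linear0 (mklin (Bl w))). Qed.
Let Br0 v : B v 0 = 0.
Proof. exact: (linear0 (mklin (Br v))). Qed.
Fact bsum_rel s t : tens_rel s t -> bsum s = bsum t.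
Proof.
elim=> [u|u v _|u v w _ uv _ vw|u u' v v' _ IHu _ IHv|u v|v v' w|v w w'|b v w|w] //.
- by rewrite uv.
- by rewrite /bsum !big_cat -/(bsum u) -/(bsum v) IHu IHv.
- by rewrite /bsum !big_cat /= addrC.
- by rewrite /bsum !big_cons !big_nil !addr0 /= -[v]scale1r Bl !scale1r.
- by rewrite /bsum !big_cons !big_nil !addr0 /= -[w]scale1r Br !scale1r.
- by rewrite /bsum !big_cons !big_nil !addr0 /= -[b *: v]addr0 -[b *: w]addr0 Bl Br Bl0 Br0.
- by rewrite /bsum !big_cons !big_nil !addr0 Bl0.
Qed.
Fact tens_out_lin : linear (fun x : tens V W => bsum (repr x)).
Proof.
have bE s : bsum (repr (tpi s)) = bsum s by apply: bsum_rel; apply: repr_tpi.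
move=> a; elim/tens_ind => s; elim/tens_ind => t.
rewrite -[a *: _]/(tensZ a _) tensZE -tpi_cat !bE /bsum big_cat; congr (_ + _).
rewrite big_map scaler_sumr; apply: eq_bigr => q _ /=.
by rewrite -[a *: q.1]addr0 Bl Bl0 addr0.
Qed.
Definition tens_out : {linear tens V W -> Z} := mklin tens_out_lin.
Lemma tens_out_pure v w : tens_out (tpure v w) = B v w.
Proof.
have -> : tens_out (tpure v w) = bsum [:: (v, w)] by apply: bsum_rel; apply: repr_tpi.
by rewrite /bsum big_seq1.
Qed.
End Out.
End TensLemmas.

Section CtensMap.
Variables (k : fieldType) (p : nat).
Notation U := (abelian_pgroup p).
Notation rep := (rep k U).
Notation cplx := (cplx k U).

Fact rtens_map_nat (X X' Y Y' : rep) (f : rhom X X') (g : rhom Y Y') (G H : grp U) (a : epi G H)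
    (x : rtens X Y H) :
  tens_map (f G) (g G) (ract (rtens X Y) a x) = ract (rtens X' Y') a (tens_map (f H) (g H) x).
Proof. by apply: tens_map_sq => v; apply: rnat. Qed.
Definition rtens_map (X X' Y Y' : rep) (f : rhom X X') (g : rhom Y Y') : rhom (rtens X Y) (rtens X' Y') :=
  @RHom k U (rtens X Y) (rtens X' Y') (fun G => tens_map (f G) (g G)) (rtens_map_nat f g).

Lemma ctens_dE (X Y : cplx) n G (x : ctens X Y (n + 1) G) i j : cd (ctens X Y) n G x (i, j) =
  tens_map (cd X i G) idfun (x (i + 1, j)) + (-1) ^ i *: tens_map idfun (cd Y j G) (x (i, j + 1)).
Proof. by []. Qed.

Lemma ctens_mem (X Y : cplx) n G (x : ctens X Y n G) i j : i + j <> n -> x (i, j) = 0.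
Proof. by move=> /eqP ij; case: (dvalP x) => _; apply. Qed.

Section Map.
Variables (X X' Y Y' : cplx) (f : cmap X X') (g : cmap Y Y').
Let cm0 n G : {linear ctens X Y n G -> ctens X' Y' n G} :=
  dsum_map _ (fun ij => rtens_map (f ij.1) (g ij.2) G).
Fact ctens_map_nat n (G H : grp U) (a : epi G H) x :
  cm0 n G (ract (ctens X Y n) a x) = ract (ctens X' Y' n) a (cm0 n H x).
Proof. by apply: dsum_inj => ij; exact: rnat. Qed.
Definition ctens_map0 n : rhom (ctens X Y n) (ctens X' Y' n) := RHom (@ctens_map_nat n).
Fact ctens_map_d n G x : ctens_map0 n G (cd (ctens X Y) n G x) = cd (ctens X' Y') n G (ctens_map0 (n + 1) G x).
Proof.
apply: dsum_inj => -[i j].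
change (tens_map (f i G) (g j G) (cd (ctens X Y) n G x (i, j)) =
   tens_map (cd X' i G) idfun (tens_map (f (i + 1) G) (g j G) (x (i + 1, j))) +
  (-1) ^ i *: tens_map idfun (cd Y' j G) (tens_map (f i G) (g (j + 1) G) (x (i, j + 1)))).
rewrite ctens_dE linearD linearZ; congr (_ + _ *: _).
  by apply: tens_map_sq => // v; rewrite cfd.
by apply: tens_map_sq => // v; rewrite cfd.
Qed.
Definition ctens_map : cmap (ctens X Y) (ctens X' Y') := CMap ctens_map_d.
Lemma ctens_mapE n G x i j : ctens_map n G x (i, j) = tens_map (f i G) (g j G) (x (i, j)).
Proof. by []. Qed.
End Map.

Lemma ctens_map_comp (X X' X'' Y Y' Y'' : cplx) (f' : cmap X' X'') (f : cmap X X')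
   (g' : cmap Y' Y'') (g : cmap Y Y') n G x :
  ctens_map (cmap_comp f' f) (cmap_comp g' g) n G x = ctens_map f' g' n G (ctens_map f g n G x).
Proof. by apply: dsum_inj => -[i j]; rewrite !ctens_mapE; apply: tens_map_comp. Qed.

Lemma ctens_map_id (X Y : cplx) n G x : ctens_map (cmap_id X) (cmap_id Y) n G x = x.
Proof. by apply: dsum_inj => -[i j]; rewrite !ctens_mapE; apply: tens_map_id. Qed.

Lemma tens_map_comp' (V V' V'' W W' W'' : lmodType k)
    (f : {linear V -> V'}) (f' : {linear V' -> V''}) (g : {linear W -> W'}) (g' : {linear W' -> W''}) x :
  tens_map (f' \o f) (g' \o g) x = tens_map f' g' (tens_map f g x).
Proof. exact: tens_map_comp. Qed.

Lemma tens_mapDl (V W V' W' : lmodType k) (f f' f'' : {linear V -> V'}) (g : {linear W -> W'}) x :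
  (forall v, f'' v = f v + f' v) -> tens_map f'' g x = tens_map f g x + tens_map f' g x.
Proof.
move=> fE; elim/tens_ind: x => s; rewrite !tens_mapE !tpi_sum !big_map -big_split.
by apply: eq_bigr => q _ /=; rewrite fE tpureDl.
Qed.
Lemma tens_mapDr (V W V' W' : lmodType k) (f : {linear V -> V'}) (g g' g'' : {linear W -> W'}) x :
  (forall v, g'' v = g v + g' v) -> tens_map f g'' x = tens_map f g x + tens_map f g' x.
Proof.
move=> fE; elim/tens_ind: x => s; rewrite !tens_mapE !tpi_sum !big_map -big_split.
by apply: eq_bigr => q _ /=; rewrite fE tpureDr.
Qed.

Lemma sgzS (i : int) : (-1) ^ (i + 1) = - (-1) ^ i :> k.
Proof. by rewrite expfzDr ?oppr_eq0 ?oner_eq0 // expr1z mulrN1. Qed.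
Lemma sgzz (i : int) : (-1) ^ i * (-1) ^ i = 1 :> k.
Proof. by rewrite -expfzMl mulrNN mulr1 exp1rz. Qed.

(** The homotopy is h (x) g. It raises the first degree, so its components are given at i + 1 and
    assembled by [desc]; the terms with the differential of the right factor cancel because the sign
    changes from i to i + 1. *)
Lemma ctens_null_l (X X' Y Y' : cplx) (f : cmap X X') (g : cmap Y Y') : null f -> null (ctens_map f g).
Proof.
move=> [h hE].
have /dchoice [H HP] : forall n, exists H : forall i j, rhom (ctens X Y n) (rtens (X' i) (Y' j)),
    forall i j G (x : ctens X Y n G), H (i + 1) j G x = tens_map (h i G) (g j G) (x (i, j)).
  move=> n; have [H HE] := @desc (fun i => forall j, rhom (ctens X Y n) (rtens (X' i) (Y' j)))
    (fun i j => rcomp (rtens_map (h i) (g j)) (rproj _ _ (i, j))).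
  by exists H => i j G x; rewrite HE.
have HS n G (x : ctens X Y n G) : dsum_pred (fun ij : int * int => ij.1 + ij.2 == n + 1) (fun ij : int * int => H n ij.1 ij.2 G x).
  case: (dvalP x) => xf x0; split=> [|[i j]]; last first.
    elim/intS_ind: i => i /= ij; rewrite HP x0 ?linear0 //; apply: contraNN ij => /eqP <- /=.
    by rewrite addrAC.
  apply: sub_finite_set (finite_image (fun ij : int * int => (ij.1 + 1, ij.2)) xf) => -[i j].
  elim/intS_ind: i => i /= Hij; exists (i, j) => //=; apply: contraNneq Hij => x00.
  by rewrite HP [x (i, j)]x00 linear0.
pose HH n : rhom (ctens X Y n) (ctens X' Y' (n + 1)) :=
  @rinto k U _ (fun ij : int * int => ij.1 + ij.2 == n + 1) (fun ij => rtens (X' ij.1) (Y' ij.2))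
     (ctens X Y n) (fun ij => H n ij.1 ij.2) (HS n).
have HHE n G x i j : HH n G x (i + 1, j) = tens_map (h i G) (g j G) (x (i, j)) by apply: HP.
exists HH => n G x; apply: dsum_inj => -[i j]; elim/intS_ind: i => i.
rewrite dsumDE ctens_mapE ctens_dE !HHE ctens_dE linearD linearZ_LR.
have -> : tens_map (idfun : {linear X' (i + 1) G -> X' (i + 1) G}) (cd Y' j G) (tens_map (h i G) (g (j + 1) G) (x (i, j + 1))) =
  tens_map (h i G) (g j G) (tens_map idfun (cd Y j G) (x (i, j + 1))).
  by apply: tens_map_sq => // v; rewrite cfd.
rewrite sgzS scaleNr [RHS]addrACA [- _ + _]addNr addr0.
rewrite -!tens_map_comp'.
by apply: tens_mapDl => v; rewrite /= hE.
Qed.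

(** Here the homotopy is (-1)^i f (x) h, the sign coming from moving h past an element of degree
    i. *)
Lemma ctens_null_r (X X' Y Y' : cplx) (f : cmap X X') (g : cmap Y Y') : null g -> null (ctens_map f g).
Proof.
move=> [h hE].
have /dchoice [H HP] : forall n, exists H : forall i j, rhom (ctens X Y n) (rtens (X' i) (Y' j)),
    forall i j G (x : ctens X Y n G), H i (j + 1) G x = (-1) ^ i *: tens_map (f i G) (h j G) (x (i, j)).
  move=> n; have [H HE] := @desc (fun j => forall i, rhom (ctens X Y n) (rtens (X' i) (Y' j)))
    (fun j i => rscale ((-1) ^ i) (rcomp (rtens_map (f i) (h j)) (rproj _ _ (i, j)))).
  by exists (fun i j => H j i) => i j G x; rewrite HE.
have HS n G (x : ctens X Y n G) : dsum_pred (fun ij : int * int => ij.1 + ij.2 == n + 1) (fun ij : int * int => H n ij.1 ij.2 G x).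
  case: (dvalP x) => xf x0; split=> [|[i j]]; last first.
    elim/intS_ind: j => j /= ij; rewrite HP x0 ?linear0 ?scaler0 //; apply: contraNN ij => /eqP <- /=.
    by rewrite addrA.
  apply: sub_finite_set (finite_image (fun ij : int * int => (ij.1, ij.2 + 1)) xf) => -[i j].
  elim/intS_ind: j => j /= Hij; exists (i, j) => //=; apply: contraNneq Hij => x00.
  by rewrite HP [x (i, j)]x00 linear0 ?scaler0.
pose HH n : rhom (ctens X Y n) (ctens X' Y' (n + 1)) :=
  @rinto k U _ (fun ij : int * int => ij.1 + ij.2 == n + 1) (fun ij => rtens (X' ij.1) (Y' ij.2))
     (ctens X Y n) (fun ij => H n ij.1 ij.2) (HS n).
have HHE n G x i j : HH n G x (i, j + 1) = (-1) ^ i *: tens_map (f i G) (h j G) (x (i, j)) by apply: HP.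
exists HH => n G x; apply: dsum_inj => -[i j]; elim/intS_ind: j => j.
rewrite dsumDE ctens_mapE ctens_dE !HHE ctens_dE linearD !(linearZ_LR (tens_map _ _)).
have -> : tens_map (cd X' i G) (idfun : {linear Y' (j + 1) G -> Y' (j + 1) G}) (tens_map (f (i + 1) G) (h j G) (x (i + 1, j))) =
  tens_map (f i G) (h j G) (tens_map (cd X i G) idfun (x (i + 1, j))).
  by apply: tens_map_sq => // v; rewrite cfd.
rewrite sgzS scaleNr scalerDr !scalerA sgzz !scale1r [RHS]addrACA addNr add0r.
rewrite -!tens_map_comp'.
by apply: tens_mapDr => v; rewrite /= hE.
Qed.

Lemma ctens_htpy (X X' Y Y' : cplx) (f f' : cmap X X') (g g' : cmap Y Y') :
  htpy f f' -> htpy g g' -> htpy (ctens_map f g) (ctens_map f' g').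
Proof.
move=> /(ctens_null_l g) nf /(ctens_null_r f') ng.
apply: null_ext (null_add nf ng) => n G x; apply: dsum_inj => -[i j].
change (tens_map (csub f f' i G) (g j G) (x (i, j)) + tens_map (f' i G) (csub g g' j G) (x (i, j)) =
  tens_map (f i G) (g j G) (x (i, j)) + -1 *: tens_map (f' i G) (g' j G) (x (i, j))).
have e1 : tens_map (f i G) (g j G) (x (i, j)) = tens_map (csub f f' i G) (g j G) (x (i, j)) + tens_map (f' i G) (g j G) (x (i, j)).
  by apply: tens_mapDl => v; rewrite csubE subrK.
have e2 : tens_map (f' i G) (g j G) (x (i, j)) = tens_map (f' i G) (csub g g' j G) (x (i, j)) + tens_map (f' i G) (g' j G) (x (i, j)).
  by apply: tens_mapDr => v; rewrite csubE subrK.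
by rewrite e1 e2 scaleN1r; zmod.
Qed.

Section Const.
Variable G : grp U.
(* The constant diagram at X(G): a homotopy of constant complexes is an arbitrary
   homotopy of complexes of vector spaces, so facts about natural homotopies also
   apply to unnatural ones. *)
Definition kcr (V : lmodType k) : rep :=
  @Rep k U (fun=> V) (fun _ _ _ => idfun) (fun _ _ => erefl) (fun _ _ _ _ _ _ => erefl) (fun _ _ _ _ _ _ _ => erefl).
Definition kchom (V W : lmodType k) (f : {linear V -> W}) : rhom (kcr V) (kcr W) :=
  @RHom k U (kcr V) (kcr W) (fun=> f) (fun _ _ _ _ => erefl).
Definition kc (X : cplx) : cplx :=
  @Cplx k U (fun n => kcr (X n G)) (fun n => kchom (cd X n G)) (fun n _ x => @cdd k U X n G x).
Definition kcm (X Y : cplx) (f : cmap X Y) : cmap (kc X) (kc Y) :=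
  @CMap k U (kc X) (kc Y) (fun n => kchom (f n G)) (fun n _ x => @cfd k U X Y f n G x).

(** With s a generalized inverse of d, the contraction is s (1 - s d). *)
Lemma kc_split (X : cplx) : acycG X G -> null (cmap_id (kc X)).
Proof.
move=> aX; have /dchoice [s sE] : forall n, exists s : {linear X n G -> X (n + 1) G},
   forall v, cd X n G (s (cd X n G v)) = cd X n G v by move=> n; apply: ginv.
have [h hE] := @desc (fun n => rhom (kc X n) (kc X (n + 1))) (fun n =>
  rcomp (kchom (s (n + 1))) (radd (rid (kc X (n + 1))) (rscale (-1) (rcomp (kchom (s n)) (cd (kc X) n))))).
exists h; apply: intS_ind => n H x; rewrite !hE.
change (x = cd X (n + 1 + 1) G (s (n + 1 + 1) (x + -1 *: s (n + 1) (cd X (n + 1) G x))) +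
  s (n + 1) (cd X (n + 1) G x + -1 *: s n (cd X n G (cd X (n + 1) G x)))).
have [|y yE] := aX (n + 1) (x + -1 *: s (n + 1) (cd X (n + 1) G x)).
  by rewrite linearD linearZ_LR sE scaleN1r subrr.
by rewrite yE sE -yE cdd linear0 scaler0 addr0 scaleN1r subrK.
Qed.

Lemma kc_d (X Y : cplx) n (x : ctens X Y (n + 1) G) :
  cd (ctens X Y) n G x = cd (ctens (kc X) (kc Y)) n G x.
Proof. by apply: dsum_inj => -[i j]. Qed.
Lemma kc_map (X X' Y Y' : cplx) (f : cmap X X') (g : cmap Y Y') n (x : ctens X Y n G) :
  ctens_map f g n G x = ctens_map (kcm f) (kcm g) n G x.
Proof. by apply: dsum_inj => -[i j]. Qed.

Lemma qis_kc_ctens (X X' Y Y' : cplx) (f : cmap X X') (g : cmap Y Y') :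
  quasi_iso (ctens_map (kcm f) (kcm g)) -> forall n,
    (forall x : ctens X Y (n + 1) G, cd (ctens X Y) n G x = 0 ->
       (exists y, ctens_map f g (n + 1) G x = cd (ctens X' Y') (n + 1) G y) ->
       exists x', x = cd (ctens X Y) (n + 1) G x') /\
    (forall y : ctens X' Y' (n + 1) G, cd (ctens X' Y') n G y = 0 ->
       exists2 x, cd (ctens X Y) n G x = 0 &
       exists y', y = ctens_map f g (n + 1) G x + cd (ctens X' Y') (n + 1) G y').
Proof.
move=> q n; have [q1 q2] := q n G; split=> [x dx [y E]|y dy].
  have [||x' ->] := q1 x; last by exists x'; exact/esym/kc_d.
    by rewrite -kc_d.
  by exists y; rewrite -kc_d -kc_map.
have [|x dx [y' ->]] := q2 y; first by rewrite -kc_d.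
by exists x; [exact: (etrans (@kc_d X Y n x) dx)|exists y'; rewrite (kc_map f g) (kc_d (X := X') (Y := Y'))].
Qed.

Lemma acyc_kc_ctens (X Y : cplx) : acyclic (ctens (kc X) (kc Y)) -> acycG (ctens X Y) G.
Proof.
move=> a n x dx; have [|y ->] := a n G x; first by rewrite -kc_d.
by exists y; exact/esym/kc_d.
Qed.

(** The fibre of f is contractible at G. Read as a matrix, a contraction of it contains the inverse
    of f in one entry and the two homotopies, up to sign, in the diagonal entries. *)
Lemma kc_hequiv (X Y : cplx) (f : cmap X Y) : quasi_iso f -> exists g : cmap (kc Y) (kc X),
  htpy (cmap_comp g (kcm f)) (cmap_id _) /\ htpy (cmap_comp (kcm f) g) (cmap_id _).
Proof.
move=> /qis_fib aF; have [|h hE] := @kc_split (fib f); first by move=> n; apply: aF.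
pose i1 n : {linear X n G -> fib f n G} := rpair (rid (X n)) (rzero (X n) (Y (n + 1))) G.
pose i2 n : {linear Y (n + 1) G -> fib f n G} := rpair (rzero (Y (n + 1)) (X n)) (rid (Y (n + 1))) G.
pose p1 n : {linear fib f n G -> X n G} := rfst (X n) (Y (n + 1)) G.
pose p2 n : {linear fib f n G -> Y (n + 1) G} := rsnd (X n) (Y (n + 1)) G.
pose hG n : {linear fib f n G -> fib f (n + 1) G} := h n G.
have hD n (x : X (n + 1) G) (y : Y (n + 1 + 1) G) : (x, y) = cd (fib f) (n + 1) G (hG (n + 1) (x, y)) + 
   hG n (cd X n G x, f (n + 1) G x - cd Y (n + 1) G y) by exact: (hE n G (x, y)).
have [g gE] := @desc (fun n => rhom (kc Y n) (kc X n)) (fun n => kchom (p1 (n + 1) \o (hG n \o i2 n))).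
have gE' n H y : g (n + 1) H y = (hG n (0, y)).1 by rewrite gE.
have [g1 g1E] : exists g' : cmap (kc Y) (kc X), forall n H y, g' (n + 1) H y = (hG n (0, y)).1.
  suff gd : forall n H y, g n H (cd (kc Y) n H y) = cd (kc X) n H (g (n + 1) H y) by exists (CMap gd).
  apply: intS_ind => n H y; rewrite !gE'.
  have := congr1 fst (hD n 0 y); rewrite !linear0 sub0r.
  have -> : (0, - cd Y (n + 1) G y) = - (0, cd Y (n + 1) G y) :> fib f n G by congr pair; rewrite /= ?oppr0.
  rewrite linearN => E.
  have E' : 0 = cd X (n + 1) G (hG (n + 1) (0, y)).1 - (hG n (0, cd Y (n + 1) G y)).1 by exact: E.
  by apply: (zmod_from E'); zmod.
exists g1; split.
  exists (fun n => rscale (-1) (kchom (p1 (n + 1) \o (hG n \o i1 n)))) => n H x; rewrite csubE.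
  change (g1 (n + 1) H (f (n + 1) G x) - x = cd X (n + 1) G (-1 *: (hG (n + 1) (x, 0)).1) + -1 *: (hG n (cd X n G x, 0)).1).
  rewrite g1E linearZ_LR !scaleN1r.
  have E : x = cd X (n + 1) G (hG (n + 1) (x, 0)).1 + (hG n (cd X n G x, f (n + 1) G x - cd Y (n + 1) G 0)).1
    := congr1 fst (hD n x 0).
  have E2 : (hG n (cd X n G x, f (n + 1) G x - cd Y (n + 1) G 0)).1 =
     (hG n (cd X n G x, 0)).1 + (hG n (0, f (n + 1) G x)).1.
    have -> : (cd X n G x, f (n + 1) G x - cd Y (n + 1) G 0) =
      (cd X n G x, 0) + (0, f (n + 1) G x) :> fib f n G.
      by congr pair; rewrite /= ?addr0 // linear0 subr0 add0r.
    by rewrite linearD.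
  by rewrite E2 in E; apply: (zmod_from (esym E)); zmod.
have [S SE] := @desc (fun n => rhom (kc Y n) (kc Y (n + 1))) (fun n => kchom (p2 (n + 1) \o (hG n \o i2 n))).
exists S; apply: intS_ind => n H y; rewrite csubE !SE.
change (f (n + 1 + 1) G (g1 (n + 1 + 1) H y) - y =
  cd Y (n + 1 + 1) G (hG (n + 1) (0, y)).2 + (hG n (0, cd Y (n + 1) G y)).2).
rewrite g1E.
have E : y = f (n + 1 + 1) G (hG (n + 1) (0, y)).1 - cd Y (n + 1 + 1) G (hG (n + 1) (0, y)).2 +
  (hG n (cd X n G 0, f (n + 1) G 0 - cd Y (n + 1) G y)).2 := congr1 snd (hD n 0 y).
have E2 : (hG n (cd X n G 0, f (n + 1) G 0 - cd Y (n + 1) G y)).2 = - (hG n (0, cd Y (n + 1) G y)).2.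
  have -> : (cd X n G 0, f (n + 1) G 0 - cd Y (n + 1) G y) = - (0, cd Y (n + 1) G y) :> fib f n G.
    by congr pair; rewrite /= !linear0 ?oppr0 // sub0r.
  by rewrite linearN.
by rewrite E2 in E; apply: (zmod_from (esym E)); zmod.
Qed.

Lemma hequiv_qis (X Y : cplx) (f : cmap X Y) (g : cmap Y X) :
  htpy (cmap_comp g f) (cmap_id X) -> htpy (cmap_comp f g) (cmap_id Y) -> quasi_iso f.
Proof.
move=> [h hE] [l lE] n H; split=> [x dx [y E]|y dy].
  exists (g (n + 1 + 1) H y - h (n + 1) H x).
  have := hE n H x; rewrite csubE dx linear0 addr0 linearB -cfd -E => <-.
  by rewrite /=; zmod.
exists (g (n + 1) H y); first by rewrite -cfd dy linear0.
exists (- l (n + 1) H y); rewrite linearN.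
have := lE n H y; rewrite csubE dy linear0 addr0 => <-.
by rewrite /=; zmod.
Qed.
End Const.

Lemma ctens_acyc (X Y : cplx) G : acycG X G -> acycG (ctens X Y) G.
Proof.
move=> /kc_split nX; apply: acyc_kc_ctens => n H x dx.
have [h hE] := ctens_null_l (cmap_id (kc G Y)) nX.
by have := hE n H x; rewrite ctens_map_id dx linear0 addr0 => ->; eexists.
Qed.

(** At each G a quasi-isomorphism is a homotopy equivalence of complexes of vector spaces, and those
    are stable under tensor products. *)
Lemma ctens_qis (X X' Y Y' : cplx) (f : cmap X X') (g : cmap Y Y') :
  quasi_iso f -> quasi_iso g -> quasi_iso (ctens_map f g).
Proof.
move=> qf qg n G; apply: qis_kc_ctens.
have [f' [f1 f2]] := kc_hequiv G qf; have [g' [g1 g2]] := kc_hequiv G qg.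
apply: (@hequiv_qis _ _ _ (ctens_map f' g')).
  apply: null_ext (ctens_htpy f1 g1) => m H x.
  by rewrite !csubE ctens_map_comp ctens_map_id.
apply: null_ext (ctens_htpy f2 g2) => m H x.
by rewrite !csubE ctens_map_comp ctens_map_id.
Qed.
End CtensMap.

(** * Tensor products of compact objects *)

Section TensProj.
Variables (k : fieldType) (p : nat).
Notation U := (abelian_pgroup p).
Notation rep := (rep k U).
Notation cplx := (cplx k U).

Lemma fproj_sum (R : rep) (T : finType) (S : T -> rep) (a : forall t, rhom (S t) R) (b : forall t, rhom R (S t)) :
  (forall t, fproj (S t)) -> (forall G x, x = \sum_t a t G (b t G x)) -> fproj R.
Proof.
move=> /dchoice [I /dchoice [G /dchoice [inn /dchoice [pr E]]]] ab.
exists {t : T & I t}, (fun t => G (tag t) (tagged t)).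
exists (fun t => rcomp (a (tag t)) (inn _ (tagged t))), (fun t => rcomp (pr _ (tagged t)) (b (tag t))) => L x.
rewrite [LHS]ab.
rewrite (eq_bigr (fun i => \sum_(t : I i) a i L (inn _ t L (pr _ t L (b i L x))))); last first.
  by move=> i _; rewrite -linear_sum -E.
by rewrite sig_big_dep.
Qed.

Lemma pair_ext (A B : Type) (x y : A * B) : x.1 = y.1 -> x.2 = y.2 -> x = y.
Proof. by case: x y => ? ? [? ?] /= -> ->. Qed.

Lemma tpure_suml (V W : lmodType k) (I : finType) (f : I -> V) (w : W) :
  tpure (\sum_i f i) w = \sum_i tpure (f i) w.
Proof.
apply: (big_morph (fun v => tpure v w)) => [v v'|]; first exact: tpureDl.
by rewrite -(scale0r 0) tpureZl scale0r.
Qed.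
Lemma tpure_sumr (V W : lmodType k) (I : finType) (v : V) (f : I -> W) :
  tpure v (\sum_i f i) = \sum_i tpure v (f i).
Proof.
apply: (big_morph (tpure v)) => [w w'|]; first exact: tpureDr.
by rewrite -(scale0r 0) tpureZr scale0r.
Qed.

Lemma U_sub (T : finGroupType) (K : {group T}) : U T -> U (subg_of K).
Proof.
move=> [aT pT]; have iK : K \isog [set: subg_of K] by apply: isog_subg.
rewrite /abelian_pgroup -(isog_abelian iK) -(isog_pgroup _ iK); split.
  by apply: (abelianS _ aT); apply: finset.subsetT.
by apply: (pgroupS _ pT); apply: finset.subsetT.
Qed.

Lemma U_prod (S T : finGroupType) : U S -> U T -> U (S * T)%type.
Proof.
move=> [aS pS] [aT pT]; split.
  apply/centsP => x _ y _; congr pair.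
    by move/centsP: aS => ->; rewrite ?inE.
  by move/centsP: aT => ->; rewrite ?inE.
by rewrite /pgroup cardsT card_prod pnatM -!cardsT; apply/andP.
Qed.

Section RprTens.
Variables G H : grp U.
Notation GH := (G * H)%type.
Definition subdirect (K : {group GH}) : bool :=
  [forall g : G, exists x in K, x.1 == g] && [forall h : H, exists x in K, x.2 == h].
Definition sd := {K : {group GH} | subdirect K}.
HB.instance Definition _ := Finite.on sd.
Definition sdG (K : sd) : grp U := Grp (@U_sub _ (sval K) (U_prod (grpP G) (grpP H))).

Lemma sd1_surj (K : sd) g : exists x : sdG K, (sgval x).1 = g.
Proof.
have /andP [/forallP h1 _] := valP K; have /existsP [x /andP [xK /eqP <-]] := h1 g.
by exists (subg (sval K) x); rewrite subgK.
Qed.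
Lemma sd2_surj (K : sd) g : exists x : sdG K, (sgval x).2 = g.
Proof.
have /andP [_ /forallP h1] := valP K; have /existsP [x /andP [xK /eqP <-]] := h1 g.
by exists (subg (sval K) x); rewrite subgK.
Qed.
Definition sd1 K : epi (sdG K) G := @mkepi (sdG K) G (fun x => (sgval x).1) (fun x y => erefl) (sd1_surj K).
Definition sd2 K : epi (sdG K) H := @mkepi (sdG K) H (fun x => (sgval x).2) (fun x y => erefl) (sd2_surj K).

Lemma sd_ex (L : grp U) (a : epi L G) (b : epi L H) : exists (K : sd) (c : epiT L (sdG K)),
  (forall x, sd1 K (c x) = a x) /\ (forall x, sd2 K (c x) = b x).
Proof.
pose f (x : L) : GH := (a x, b x).
have fM : {in [set: L] &, {morph f : x y / (x * y)%g}}.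
  by move=> x y _ _; congr pair; apply: epiM.
pose F := Morphism fM.
pose K := (F @* [set: L])%G.
have KP z : reflect (exists x, z = f x) (z \in K).
  apply: (iffP idP) => [/morphimP [x _ _ ->]|[x ->]]; first by exists x.
  by apply: (mem_morphim F); rewrite inE.
have sK : subdirect K.
  apply/andP; split; apply/forallP => y; apply/existsP.
    by have [x <-] := epi_surj a y; exists (f x); rewrite eqxx andbT; apply/KP; exists x.
  by have [x <-] := epi_surj b y; exists (f x); rewrite eqxx andbT; apply/KP; exists x.
pose K' : sd := exist (fun K => is_true (subdirect K)) K sK.
have fK x : f x \in K by apply/KP; exists x.
pose c0 (x : L) : sdG K' := @subg _ K (f x).
have c0E x : sgval (c0 x) = f x by apply: subgK.
have c0M : {morph c0 : x y / (x * y)%g}.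
  by move=> x y; apply: val_inj; rewrite /= !c0E; congr pair; apply: epiM.
have c0S y : exists x, c0 x = y.
  have /KP [x xE] : sgval y \in K by apply: subgP.
  by exists x; apply: val_inj; rewrite /= c0E.
exists K', (epiT_of (mkepi c0M c0S)); split=> x; rewrite epiT_ofE; exact: (congr1 _ (c0E x)).
Qed.

Lemma sd_eq (K : sd) (x y : sdG K) : sd1 K x = sd1 K y -> sd2 K x = sd2 K y -> x = y.
Proof. by move=> e1 e2; apply: val_inj; exact: pair_ext. Qed.

(** As a is surjective, (f, g) takes on M the same values as it does on L after composition with a,
    and these form K. *)
Lemma sd_desc (L M : grp U) (a : epi L M) (K : sd) (c : epiT L (sdG K)) (f : epiT M G) (g : epiT M H) :
  ecompT (sd1 K) c = ecompT f a -> ecompT (sd2 K) c = ecompT g a ->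
  exists c' : epiT M (sdG K), ecompT (sd1 K) c' = f /\ ecompT (sd2 K) c' = g.
Proof.
move=> e1 e2.
have E1 x : (sgval (c x)).1 = f (a x) by rewrite -[RHS]ecompTE -e1 ecompTE.
have E2 x : (sgval (c x)).2 = g (a x) by rewrite -[RHS]ecompTE -e2 ecompTE.
have /dchoiceT [d dP] : forall y, exists z : sdG K, (sgval z).1 = f y /\ (sgval z).2 = g y.
  by move=> y; have [x <-] := epi_surj a y; exists (c x); rewrite E1 E2.
have dM : {morph d : x y / (x * y)%g}.
  move=> x y; apply: sd_eq; rewrite epiM.
    exact: etrans (dP _).1 (etrans (epiM f x y) (congr2 mulg (esym (dP x).1) (esym (dP y).1))).
  exact: etrans (dP _).2 (etrans (epiM g x y) (congr2 mulg (esym (dP x).2) (esym (dP y).2))).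
have dS z : exists y, d y = z.
  have [x <-] := epi_surj c z; exists (a x); apply: sd_eq.
    exact: etrans (dP _).1 (esym (E1 x)).
  exact: etrans (dP _).2 (esym (E2 x)).
exists (epiT_of (mkepi dM dS)); split; apply: epiT_inj => y; rewrite ecompTE epiT_ofE.
  exact: (dP y).1.
exact: (dP y).2.
Qed.

(** K is recovered as the image of L in G x H. *)
Lemma sd_inj (L : grp U) (K K' : sd) (c : epiT L (sdG K)) (c' : epiT L (sdG K')) :
  ecompT (sd1 K) c = ecompT (sd1 K') c' -> ecompT (sd2 K) c = ecompT (sd2 K') c' ->
  Tagged (fun K => epiT L (sdG K)) c = Tagged (fun K => epiT L (sdG K)) c'.
Proof.
move=> e1 e2.
have E x : sgval (c x) = sgval (c' x).
  have E1 : (sgval (c x)).1 = (sgval (c' x)).1.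
    by rewrite -[LHS]/(sd1 K (c x)) -ecompTE e1 ecompTE.
  have E2 : (sgval (c x)).2 = (sgval (c' x)).2.
    by rewrite -[LHS]/(sd2 K (c x)) -ecompTE e2 ecompTE.
  exact: pair_ext.
have KE : K = K'.
  apply: val_inj; apply: val_inj; apply/setP => z; apply/idP/idP => zK.
    have [x xE] := epi_surj c (subg _ z); have <- : sgval (c x) = z by rewrite xE; exact: subgK.
    rewrite E; apply: subgP.
  have [x xE] := epi_surj c' (subg _ z); have <- : sgval (c' x) = z by rewrite xE; exact: subgK.
  rewrite -E; apply: subgP.
subst K'; congr Tagged; apply: epiT_inj => x; exact: subg_inj (E x).
Qed.

Lemma sd_ext (L : grp U) (K : sd) (c c' : epiT L (sdG K)) :
  ecompT (sd1 K) c = ecompT (sd1 K) c' -> ecompT (sd2 K) c = ecompT (sd2 K) c' -> c = c'.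
Proof. by move=> e1 e2; have := sd_inj e1 e2; apply: eq_from_Tagged. Qed.

Lemma ecompTA (L M N O : finGroupType) (c : epi N O) (b : epi M N) (a : epi L M) :
  ecompT (ecompT c b) a = ecompT c (ecompT b a).
Proof. by apply: epiT_inj => x; rewrite !ecompTE. Qed.

Section PrTens.
Variable K : sd.
Let B (L : grp U) (f : {ffun epiT L G -> k^o}) (g : {ffun epiT L H -> k^o}) : {ffun epiT L (sdG K) -> k^o} :=
  [ffun c : epiT L (sdG K) => f (ecompT (sd1 K) c) * g (ecompT (sd2 K) c)].
Let Bl L g : linear (fun f => @B L f g).
Proof. by move=> a f f'; apply/ffunP => c; rewrite !ffunE mulrDl -scalerAl. Qed.
Let Br L f : linear (@B L f).
Proof. by move=> a g g'; apply/ffunP => c; rewrite !ffunE mulrDr -scalerAr. Qed.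
Let pr L : {linear rtens (rpr k G) (rpr k H) L -> rpr k (sdG K) L} := tens_out (@Bl L) (@Br L).
Fact tpr_nat (L M : grp U) (a : epi L M) x :
  pr L (ract (rtens (rpr k G) (rpr k H)) a x) = ract (rpr k (sdG K)) a (pr M x).
Proof.
have E : pr L \o ract (rtens (rpr k G) (rpr k H)) a =1 ract (rpr k (sdG K)) a \o pr M.
  apply: tens_lin_ext => f g.
  change (tens_out (@Bl L) (@Br L) (tens_map (ract (rpr k G) a) (ract (rpr k H) a) (tpure f g)) =
    ract (rpr k (sdG K)) a (tens_out (@Bl M) (@Br M) (tpure f g))).
  rewrite tens_map_pure !tens_out_pure; apply/ffunP => c.
  rewrite ffunE !rpr_actE big_distrlr pair_big /=.
  have pE (c' : epiT M (sdG K)) : [pick d : epiT M (sdG K) | (ecompT (sd1 K) d == ecompT (sd1 K) c') && (ecompT (sd2 K) d == ecompT (sd2 K) c')] = Some c'.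
    case: pickP => [d /andP [/eqP d1 /eqP d2]|/(_ c')]; last by rewrite !eqxx.
    by congr Some; apply: sd_ext.
  (* By [sd_desc], the pairs on M that restrict along a to the components of c all come from maps M
     -> K, with the search by [pick] as inverse. *)
  rewrite (reindex_omap (fun c' : epiT M (sdG K) => (ecompT (sd1 K) c', ecompT (sd2 K) c'))
     (fun fg => [pick c' : epiT M (sdG K) | (ecompT (sd1 K) c' == fg.1) && (ecompT (sd2 K) c' == fg.2)])).
    apply: eq_big => [c'|c' _]; last by rewrite ffunE.
    rewrite /= (pE c').
    rewrite eqxx andbT !ecompTA; apply/andP/eqP => [[/eqP e1 /eqP e2]|<- //].
    exact: sd_ext.
  move=> [f' g'] /= /andP [/eqP /esym e1 /eqP /esym e2].
  have [c' [c1 c2]] := sd_desc e1 e2.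
  case: pickP => [d /andP [/eqP /= -> /eqP /= -> //]|/(_ c')].
  by rewrite c1 c2 !eqxx.
exact: (E x).
Qed.
Definition tpr : rhom (rtens (rpr k G) (rpr k H)) (rpr k (sdG K)) := RHom tpr_nat.
Lemma tprE (L : grp U) (f : rpr k G L) (g : rpr k H L) (c : epiT L (sdG K)) : (tpr L (tpure f g) : {ffun epiT L (sdG K) -> k^o}) c =
  (f : {ffun epiT L G -> k^o}) (ecompT (sd1 K) c) * (g : {ffun epiT L H -> k^o}) (ecompT (sd2 K) c).
Proof.
have -> : tpr L (tpure f g) = B f g by apply: tens_out_pure.
by rewrite ffunE.
Qed.
Definition tin : rhom (rpr k (sdG K)) (rtens (rpr k G) (rpr k H)) :=
  yo (tpure (ract (rpr k G) (sd1 K) (rdelta k G)) (ract (rpr k H) (sd2 K) (rdelta k H)) : rtens (rpr k G) (rpr k H) (sdG K)).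
Lemma tinE L (f : rpr k (sdG K) L) : tin L f = \sum_(c : epiT L (sdG K)) (f : {ffun epiT L (sdG K) -> k^o}) c *:
  (tpure (ract (rpr k G) (ecompT (sd1 K) c) (rdelta k G)) (ract (rpr k H) (ecompT (sd2 K) c) (rdelta k H)) : rtens (rpr k G) (rpr k H) L).
Proof.
pose e : rtens (rpr k G) (rpr k H) (sdG K) := tpure (ract (rpr k G) (sd1 K) (rdelta k G)) (ract (rpr k H) (sd2 K) (rdelta k H)).
transitivity (\sum_(c : epiT L (sdG K)) (f : {ffun epiT L (sdG K) -> k^o}) c *: ract (rtens (rpr k G) (rpr k H)) c e) => //.
apply: eq_bigr => c _.
congr (_ *: _).
rewrite (@ract_compT k p (rpr k G) _ _ _ (sd1 K) (c : epiT L (sdG K))).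
rewrite (@ract_compT k p (rpr k H) _ _ _ (sd2 K) (c : epiT L (sdG K))).
exact: tens_map_pure.
Qed.
End PrTens.

(* A pair of epimorphisms L -> G, L -> H is an epimorphism from L to a
   subdirect product, so e_G (x) e_H is the sum of the e_K over all subdirect
   products K of G and H. *)
Lemma fproj_rpr_tens : fproj (rtens (rpr k G) (rpr k H)).
Proof.
exists sd, sdG, tin, tpr => L x.
pose u := \big[@radd _ _ _ _/rzero (rtens (rpr k G) (rpr k H)) (rtens (rpr k G) (rpr k H))]_(K : sd) rcomp (tin K) (tpr K).
have uE z : u L z = \sum_K tin K L (tpr K L z) by rewrite rhom_sumE.
rewrite -uE; apply/esym; move: x; change (u L =1 (idfun : {linear rtens (rpr k G) (rpr k H) L -> rtens (rpr k G) (rpr k H) L})).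
have ub (a : epiT L G) (b : epiT L H) : u L (tpure (ract (rpr k G) a (rdelta k G)) (ract (rpr k H) b (rdelta k H))) =
    tpure (ract (rpr k G) a (rdelta k G)) (ract (rpr k H) b (rdelta k H)).
  have [K0 [c0 [c1 c2]]] := sd_ex a b.
  have c1' : ecompT (sd1 K0) c0 = a by apply: epiT_inj => x; rewrite ecompTE.
  have c2' : ecompT (sd2 K0) c0 = b by apply: epiT_inj => x; rewrite ecompTE.
  set x := tpure _ _.
  pose F (K : sd) (c : epiT L (sdG K)) : rtens (rpr k G) (rpr k H) L :=
    (tpr K L x : {ffun epiT L (sdG K) -> k^o}) c *:
    (tpure (ract (rpr k G) (ecompT (sd1 K) c) (rdelta k G)) (ract (rpr k H) (ecompT (sd2 K) c) (rdelta k H)) : rtens (rpr k G) (rpr k H) L).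
  transitivity (\sum_(K : sd) \sum_(c : epiT L (sdG K)) F K c).
    by rewrite uE; apply: eq_bigr => K _; apply: tinE.
  rewrite sig_big_dep (bigD1 (Tagged (fun K => epiT L (sdG K)) c0)) // big1.
    apply: etrans (addr0 _) _; rewrite /F /x tprE; rewrite c1' c2' !ract_delta !of_epiTK !eqxx mulr1 scale1r //.
  move=> [K c] /andP [_ ne]; rewrite /F /x tprE !ract_delta !of_epiTK -c1' -c2'.
  case: eqP => [e1|_]; last by rewrite mul0r scale0r.
  case: eqP => [e2|_]; last by rewrite mulr0 scale0r.
  by case/eqP: ne; apply: sd_inj.
apply: tens_lin_ext => v w; rewrite [v]rprE tpure_suml !linear_sum; apply: eq_bigr => a _.
rewrite tpureZl !linearZ; congr (_ *: _).
rewrite [w]rprE tpure_sumr !linear_sum; apply: eq_bigr => b _.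
by rewrite tpureZr !linearZ; congr (_ *: _); apply: ub.
Qed.

End RprTens.

Lemma fproj_retract_sum (R : rep) (R' : rep) (T T' : finType) (S : T -> rep) (S' : T' -> rep)
  (a : forall t, rhom (S t) R) (b : forall t, rhom R (S t))
  (a' : forall t, rhom (S' t) R') (b' : forall t, rhom R' (S' t)) :
  (forall G x, x = \sum_t a t G (b t G x)) -> (forall G x, x = \sum_t a' t G (b' t G x)) ->
  (forall t t', fproj (rtens (S t) (S' t'))) -> fproj (rtens R R').
Proof.
move=> ab ab' FS.
apply: (@fproj_sum (rtens R R') (T * T')%type (fun tt => rtens (S tt.1) (S' tt.2))
   (fun tt => rtens_map (a tt.1) (a' tt.2)) (fun tt => rtens_map (b tt.1) (b' tt.2))) => [tt|G x]; first exact: FS.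
pose u := \big[@radd _ _ _ _/rzero (rtens R R') (rtens R R')]_(tt : T * T')
  rcomp (rtens_map (a tt.1) (a' tt.2)) (rtens_map (b tt.1) (b' tt.2)).
have uE z : u G z = \sum_tt rtens_map (a tt.1) (a' tt.2) G (rtens_map (b tt.1) (b' tt.2) G z) by rewrite rhom_sumE.
rewrite -uE; apply/esym; move: x; change (u G =1 (idfun : {linear rtens R R' G -> rtens R R' G})).
apply: tens_lin_ext => v w; rewrite uE [RHS]/= {2}[v]ab tpure_suml.
rewrite -(pair_bigA _ (fun t t' => rtens_map (a t) (a' t') G (rtens_map (b t) (b' t') G (tpure v w)))) /=.
apply: eq_bigr => t _; rewrite {2}[w]ab' tpure_sumr; apply: eq_bigr => t' _.
change (tens_map (a t G) (a' t' G) (tens_map (b t G) (b' t' G) (tpure v w)) =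
  tpure (a t G (b t G v)) (a' t' G (b' t' G w))).
by rewrite !tens_map_pure.
Qed.

Lemma fproj_tens (R R' : rep) : fproj R -> fproj R' -> fproj (rtens R R').
Proof.
move=> [I [G [inn [pr E]]]] [I' [G' [inn' [pr' E']]]].
by apply: (fproj_retract_sum E E') => t t'; apply: fproj_rpr_tens.
Qed.

Lemma perfect_ctens (F F' : cplx) : perfect F -> perfect F' -> perfect (ctens F F').
Proof.
move=> [[N F0] Ff] [[N' F0'] Ff'].
have z0 (ij : int * int) : (N < `|ij.1|)%N || (N' < `|ij.2|)%N -> forall G (x : rtens (F ij.1) (F' ij.2) G), x = 0.
  move=> h G x; rewrite -(@tens_map_id _ _ _ (idfun : {linear F ij.1 G -> F ij.1 G}) (idfun : {linear F' ij.2 G -> F' ij.2 G}) x) //.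
  by case/orP: h => h; [apply: tens_map0l => v|apply: tens_map0r => v]; [apply: F0|apply: F0'].
split.
  exists (N + N')%N => n nN G x; apply: dsum_inj => -[i j].
  case: (eqVneq (i + j) n) => [ij|/eqP ij]; last by rewrite ctens_mem.
  by apply: (z0 (i, j)) => /=; move: nN; lia.
move=> n; pose r M := [seq m%:Z - M%:Z | m <- iota 0 (2 * M + 1)].
have rP M i : (`|i| <= M)%N -> i \in r M.
  move=> iM; apply/mapP; exists (absz (i + M%:Z)%R); last by move: iM; lia.
  by rewrite mem_iota; move: iM; lia.
pose s := undup [seq (i, j) | i <- r N, j <- r N'].
apply: (@fproj_rsum k p _ _ _ s) => [|[i j] ijs _|ij]; first exact: undup_uniq.
  apply: z0 => /=; rewrite !ltnNge -negb_and; apply: contra ijs => /andP [iN jN].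
  by rewrite mem_undup; apply: allpairs_f; apply: rP.
exact: fproj_tens.
Qed.

Lemma hret_ctens (T T' : cplx) : hret T -> hret T' -> hret (ctens T T').
Proof.
move=> [F [a [b [pF ba]]]] [F' [a' [b' [pF' ba']]]].
exists (ctens F F'), (ctens_map a a'), (ctens_map b b'); split; first exact: perfect_ctens.
apply: null_ext (ctens_htpy ba ba') => m H x.
by rewrite !csubE ctens_map_comp ctens_map_id.
Qed.

Lemma hret_compact (T : cplx) : hret T -> compact T.
Proof.
move=> [F [a [b [pF ba]]]]; apply: compact_retract (perfect_compact pF).
exists (dmap a), (dmap b); apply: deq_trans (deq_sym (deq_map_comp _ _)) _.
exact: htpy_deq.
Qed.

Lemma compact_ctens (X Y : cplx) : compact X -> compact Y -> compact (ctens X Y).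
Proof.
move=> /compact_res [T [q [_ qq _ hT]]] /compact_res [T' [q' [_ qq' _ hT']]].
exact/(compact_qis (ctens_qis qq qq'))/hret_compact/hret_ctens.
Qed.

(** Take cycles x, y that are not boundaries and functionals l, m equal to 1 on them and 0 on
    boundaries. Then l (x) m kills the boundaries in its bidegree but not the cycle given by the
    pair x, y. *)
Lemma acycG_ctens_inv (X Y : cplx) G : acycG (ctens X Y) G -> acycG X G \/ acycG Y G.
Proof.
move=> aXY; apply: contrapT => /not_orP [/existsNP [a /existsNP [x /not_implyP [dx nx]]] /existsNP [b /existsNP [y /not_implyP [dy ny]]]].
have [l [l0 l1]] := boundary_functional nx; have [m [m0 m1]] := boundary_functional ny.
have Bl w : linear (fun v : X (a + 1) G => l v * m w) by move=> c u v; rewrite linearP mulrDl -scalerAl.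
have Br v : linear (fun w : Y (b + 1) G => l v * m w) by move=> c u w; rewrite linearP mulrDr -scalerAr.
pose lm := tens_out Bl Br.
(* The cycle has degree (a + 1) + (b + 1), which is n + 1. *)
pose n : int := a + b + 1.
pose P (ij : int * int) := ij.1 + ij.2 == n + 1.
pose T (ij : int * int) := rtens (X ij.1) (Y ij.2).
pose z : ctens X Y (n + 1) G := rinP P T (a + 1, b + 1) G (tpure x y).
have zE ij : z ij = if P ij then dsum_in_fun (V := fun j => T j G) (tpure x y : T (a + 1, b + 1) G) ij else 0 by [].
have Pab : P (a + 1, b + 1) by rewrite /P /n /=; apply/eqP; lia.
have zab : z (a + 1, b + 1) = tpure x y by rewrite zE Pab; apply: dsum_in_id.
have zne ij : ij <> (a + 1, b + 1) -> z ij = 0.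
  move=> ne; rewrite zE; case: ifP => // _; apply: dsum_in_ne => e; exact: ne.
have dz : cd (ctens X Y) n G z = 0.
  apply: dsum_inj => -[i j]; rewrite ctens_dE.
  have -> : tens_map (cd X i G) idfun (z (i + 1, j)) = 0.
    case: (pselect ((i, j) = (a, b + 1))) => [[ia jb]|ne].
      by subst i j; rewrite zab tens_map_pure dx; apply: tpi_eq; apply: tens_0.
    by rewrite zne ?linear0 // => -[/addIr ia jb]; apply: ne; rewrite ia jb.
  have -> : tens_map idfun (cd Y j G) (z (i, j + 1)) = 0.
    case: (pselect ((i, j) = (a + 1, b))) => [[ia jb]|ne].
      by subst i j; rewrite zab tens_map_pure dy -(scale0r 0) tpureZr scale0r.
    by rewrite zne ?linear0 // => -[ia /addIr jb]; apply: ne; rewrite ia jb.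
  by rewrite scaler0 addr0.
have [w wE] := aXY n z dz.
suff : lm (tpure x y) = 0 by rewrite tens_out_pure l1 m1 mulr1 => /eqP; rewrite oner_eq0.
rewrite -zab wE ctens_dE linearD linearZ_LR.
have e1 : lm \o tens_map (cd X (a + 1) G) (idfun : {linear Y (b + 1) G -> Y (b + 1) G}) =1 \0.
  apply: tens_lin_ext => u v; apply: (etrans (congr1 lm (tens_map_pure _ _ _ _))); by rewrite tens_out_pure l0 mul0r.
have e2 : lm \o tens_map (idfun : {linear X (a + 1) G -> X (a + 1) G}) (cd Y (b + 1) G) =1 \0.
  apply: tens_lin_ext => u v; apply: (etrans (congr1 lm (tens_map_pure _ _ _ _))); by rewrite tens_out_pure m0 mulr0.
have -> : lm (tens_map (cd X (a + 1) G) idfun (w (a + 1 + 1, b + 1))) = 0 by apply: e1.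
have -> : lm (tens_map idfun (cd Y (b + 1) G) (w (a + 1, b + 1 + 1))) = 0 by apply: e2.
by rewrite scaler0 addr0.
Qed.
End TensProj.

(** * Generating tuples *)

Definition tgen (M : finGroupType) (b : nat) (t : {ffun 'I_b -> M}) : {group M} :=
  <<[set t i | i : 'I_b]>>%G.

Lemma tgen_in (M : finGroupType) b (t : {ffun 'I_b -> M}) i : t i \in tgen t.
Proof. by apply: mem_gen; apply: imset_f. Qed.

Lemma tgen_sub (M : finGroupType) b (t : {ffun 'I_b -> M}) (K : {group M}) :
  (tgen t \subset K) = [forall i, t i \in K].
Proof.
rewrite gen_subG; apply/fintype.subsetP/forallP => [h i|h x /imsetP [i _ ->] //].
by apply: h; apply: imset_f.
Qed.

Lemma tgen_ex (M : finGroupType) b (K : {group M}) : (#|K| <= b)%N ->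
  exists t : {ffun 'I_b -> M}, tgen t = K.
Proof.
move=> Kb; exists [ffun i : 'I_b => nth 1%g (enum K) i]; apply: val_inj => /=; apply/eqP; rewrite finset.eqEsubset; apply/andP; split.
  rewrite tgen_sub; apply/forallP => i; rewrite ffunE.
  case: (ltnP i (size (enum K))) => iK; last by rewrite nth_default.
  by rewrite -mem_enum; apply: mem_nth.
apply/fintype.subsetP => x xK; have xi : (index x (enum K) < b)%N.
  by apply: leq_trans Kb; rewrite cardE index_mem mem_enum.
have <- : [ffun i : 'I_b => nth 1%g (enum K) i] (Ordinal xi) = x.
  by rewrite ffunE nth_index ?mem_enum.
exact: tgen_in.
Qed.

Section Gaschutz.
Variables (M' M : finGroupType) (f : {morphism [set: M'] >-> M}) (b : nat).
Implicit Types (K L : {group M'}) (t : {ffun 'I_b -> M}).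

Definition tmap (t' : {ffun 'I_b -> M'}) : {ffun 'I_b -> M} := [ffun i => f (t' i)].

Lemma tgen_map (t' : {ffun 'I_b -> M'}) : tgen (tmap t') = (f @* tgen t')%G.
Proof.
apply: val_inj; rewrite /= morphim_gen ?finset.subsetT // morphimEsub ?finset.subsetT //.
congr <<_>>%g; rewrite -imset_comp; apply: eq_imset => i; exact: ffunE.
Qed.

Definition lifts K t := [set t' : {ffun 'I_b -> M'} | (tgen t' == K) && (tmap t' == t)].

(* Gaschuetz: all fibres of K^b -> f(K)^b have the same size, and induction deals
   with the tuples that generate a proper subgroup. *)
Lemma card_lifts K t1 t2 : tgen t1 = (f @* K)%G -> tgen t2 = (f @* K)%G ->
  #|lifts K t1| = #|lifts K t2|.
Proof.
have [n] := ubnP #|K|; elim: n => // n IH in K * => /ltnSE Kn e1 e2.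
(* Tuples in K above t that need not generate K: a coset of the kernel for each coordinate, so their
   number does not depend on t. *)
pose all_ t := [set t' : {ffun 'I_b -> M'} | (tgen t' \subset K) && (tmap t' == t)].
have all1 t : tgen t = (f @* K)%G -> #|all_ t| = (#|('ker_K f)%g| ^ b)%N.
  move=> tK; pose F i : pred M' := [pred x | (x \in K) && (f x == t i)].
  have -> : #|all_ t| = #|family F|.
    apply: eq_card => t'; rewrite inE tgen_sub; apply/andP/familyP => [[/forallP h /eqP tE] i|h].
      by apply/andP; rewrite h -tE ffunE.
    split; first by apply/forallP => i; case/andP: (h i).
    by apply/eqP/ffunP => i; rewrite ffunE; case/andP: (h i) => _ /eqP.
  rewrite card_family /image_mem (eq_map (g := fun=> #|('ker_K f)%g|)); last first.
    move=> i.
    have := tgen_in t i; rewrite tK => /morphimP [x _ xK xE].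
    have -> : #|F i| = #|('ker_K f :* x)%g|.
      apply: eq_card => y; rewrite inE mem_rcoset inE xE.
      rewrite groupMr ?groupV //; congr (_ && _).
      rewrite (sameP (kerP f (finset.in_setT (y * x^-1)%g)) eqP).
      by rewrite morphM ?finset.in_setT // morphV ?finset.in_setT // -eq_mulgV1.
    exact: card_rcoset.
  have -> : (#|('ker_K f)%g| ^ b)%N = (#|('ker_K f)%g| ^ size (enum 'I_b))%N by rewrite size_enum_ord.
  by elim: (enum _) => //= _ s ->; rewrite expnS.
have all2 t : tgen t = (f @* K)%G -> #|all_ t| = (\sum_(L : {group M'} | L \subset K) #|lifts L t|)%N.
  move=> tK; rewrite -sum1_card (partition_big (fun t' : {ffun 'I_b -> M'} => tgen t') (fun L => L \subset K)) => [|t']; last by rewrite inE => /andP [].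
  apply: eq_bigr => L LK; rewrite -sum1_card; apply: eq_bigl => t'; rewrite !inE.
  case: (tgen t' =P L) => [->|]; last by rewrite andbF.
  by rewrite LK andbT.
have := all1 t1 e1; rewrite -(all1 t2 e2) !all2 // (bigD1 K) //= [RHS](bigD1 K) //=.
suff -> : (\sum_(L : {group M'} | (L \subset K) && (L != K)) #|lifts L t1| =
          \sum_(L : {group M'} | (L \subset K) && (L != K)) #|lifts L t2|)%N by move/addIn.
apply: eq_bigr => L /andP [LK LnK].
case: (eqVneq (f @* L)%G (f @* K)%G) => [e|ne].
  apply: IH; rewrite ?e //; apply: leq_trans Kn; apply: proper_card.
  by rewrite finset.properEneq LK andbT; apply: contra LnK => /eqP LK'; apply/eqP/val_inj.
have z t : tgen t = (f @* K)%G -> #|lifts L t| = 0%N.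
  move=> tK; apply/eqP; rewrite cards_eq0; apply/eqP/setP => t'; rewrite !inE.
  apply/negP => /andP [/eqP tL /eqP tE]; case/eqP: ne.
  by rewrite -tK -tE tgen_map tL.
by rewrite !z.
Qed.

(** K itself has a generating b-tuple; the fibre over its image is nonempty, and all fibres are
    equinumerous. *)
Lemma lifts_gt0 K t : (#|K| <= b)%N -> tgen t = (f @* K)%G -> (0 < #|lifts K t|)%N.
Proof.
move=> Kb tK; have [t0 t0K] := tgen_ex Kb.
rewrite (@card_lifts K t (tmap t0)) ?tgen_map ?t0K //.
by rewrite card_gt0; apply/set0Pn; exists t0; rewrite inE t0K !eqxx.
Qed.
End Gaschutz.

(** * Free modules of finite rank over Z/p^(n+1) *)

Section FreeV.
Variable p n : nat.
Hypothesis p_prime : prime p.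
Notation U := (abelian_pgroup p).
Notation m := (p ^ n.+1)%N.

(** The exponent is p^(n+1), so that the index 0 belongs to the elementary abelian groups and the
    modulus exceeds 1, as needed for ['Z_m] to have m elements. *)
Definition killed (H : finGroupType) := forall x : H, (x ^+ m = 1)%g.

Lemma m_gt1 : (1 < m)%N.
Proof. by apply: leq_trans (prime_gt1 p_prime) _; rewrite -{1}[p]expn1 leq_exp2l ?prime_gt1. Qed.

Lemma cardZ : #|[set: 'Z_m]| = m.
Proof. by rewrite cardsT card_ord Zp_cast // m_gt1. Qed.

Lemma U_Z : U 'Z_m.
Proof.
split; first by apply/centsP => x _ y _; apply: Zp_addC.
by rewrite /pgroup cardZ pnatX pnat_id.
Qed.
Lemma killed_Z : killed 'Z_m.
Proof. by move=> x; have := expg_cardG (finset.in_setT x); rewrite cardZ. Qed.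

(* V is a free Z/p^(n+1)-module with basis e. *)
Definition freeP b (V : grp U) (e : {ffun 'I_b -> V}) := [/\ killed V, tgen e = [set: V]%G &
  forall (H : grp U) (t : 'I_b -> H), killed H ->
    exists2 f : V -> H, {morph f : x y / (x * y)%g} & forall i, f (e i) = t i].

Lemma free_ex b : exists (V : grp U) (e : {ffun 'I_b -> V}), freeP e.
Proof.
elim: b => [|b [V [e [kV gV uV]]]].
  exists (Grp (@U_sub p _ (1%G : {group 'Z_m}) U_Z)), [ffun i => 1%g].
  have T (x : subg_of (1%G : {group 'Z_m})) : x = 1%g.
    by apply: subg_inj; apply/set1gP/subgP.
  split=> [x|| H t kH]; first by rewrite (T x) expg1n.
    by apply/val_inj/setP => x; rewrite (T x) !inE group1.
  by exists (fun=> 1%g) => [x y|[]//]; rewrite mulg1.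
pose V' : grp U := Grp (@U_prod p _ _ U_Z (grpP V)).
pose e' : {ffun 'I_b.+1 -> V'} := [ffun i => if unlift ord0 i is Some j then (1%g, e j) else (Zp1, 1%g)].
exists V', e'; split.
- move=> [z v]; have E j : (((z, v) : V') ^+ j)%g = ((z ^+ j)%g, (v ^+ j)%g) by elim: j => // j IH; rewrite !expgS IH.
  by rewrite E kV killed_Z.
- apply/val_inj/setP => -[z v]; rewrite !inE.
  have h1 : (1%g, v) \in tgen e'.
    have s : (@pair1g 'Z_m V @* tgen e)%G \subset tgen e'.
      rewrite -tgen_map tgen_sub; apply/forallP => i; rewrite ffunE.
      by have := tgen_in e' (lift ord0 i); rewrite [X in X \in _]ffunE liftK.
    apply: (fintype.subsetP s); apply: (mem_morphim (pair1g_morphism 'Z_m V)); rewrite ?inE // gV inE //.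
  have h2 : (Zp1, 1%g) \in tgen e' by have := tgen_in e' ord0; rewrite ffunE unlift_none.
  have -> : (z, v) = ((Zp1, 1) ^+ z * (1, v))%g :> V'.
    have E j : (((Zp1, 1%g) : V') ^+ j)%g = ((Zp1 ^+ j)%g, 1%g) by elim: j => // j IH; rewrite expgS IH; congr pair; [rewrite expgS|exact: mulg1].
    rewrite E; congr pair; last exact: (esym (mul1g v)). by rewrite mulg1 Zp1_expgz.
  by rewrite groupM ?groupX.
move=> H t kH; have [f fM fE] := uV H (fun i => t (lift ord0 i)) kH.
exists (fun zv : V' => t ord0 ^+ (nat_of_ord zv.1) * f zv.2)%g.
  move=> [z v] [z' v'] /=; rewrite fM.
  rewrite expg_mod ?expgD; last by rewrite Zp_cast ?m_gt1.
  by rewrite -!mulgA; congr (_ * _)%g; rewrite !mulgA; congr (_ * _)%g; apply: grpC.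
have f1 : f 1%g = 1%g by apply: (mulgI (f 1%g)); rewrite mulg1 -fM mulg1.
move=> i; rewrite ffunE; case: unliftP => [j ->|->] /=.
  by rewrite fE expg0 mul1g.
by rewrite f1 mulg1 -[RHS]expg1; congr (_ ^+ _)%g; rewrite /= modn_small // Zp_cast ?m_gt1.
Qed.
End FreeV.

(** * Quotients of coinduced diagrams *)

Section Psi.
Variables (k : fieldType) (p n s b : nat) (Z : rep k (abelian_pgroup p)).
Notation U := (abelian_pgroup p).
Notation m := (p ^ n.+1)%N.
Hypotheses (k0 : [pchar k] =i pred0) (sb : (s * s <= b)%N).
Hypothesis Zs : forall (H : grp U) (z : Z H), z = 0 \/ (#|H| <= s)%N /\ killed p n H.
Variables (V : grp U) (e : {ffun 'I_b -> V}).
Hypothesis freeV : freeP n e.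
Variable Q : grp U.
Hypotheses (kQ : killed p n Q) (Qs : (#|Q| <= s)%N).
Variable rho : epi V Q.
Notation M H := (Q * H)%type.
Notation W := (Z Q).
Implicit Types H : grp U.

Lemma free_eq H (v1 v2 : epi V H) : (forall i, v1 (e i) = v2 (e i)) -> v1 =1 v2.
Proof.
move=> v12 x; have [_ gV _] := freeV.
have gE : group_set [set x | v1 x == v2 x].
  apply/group_setP; split; first by rewrite inE !epi1.
  by move=> y z; rewrite !inE !epiM => /eqP -> /eqP ->.
have : x \in tgen e by rewrite gV inE.
have /fintype.subsetP s1 : tgen e \subset Group gE.
  by rewrite tgen_sub; apply/forallP => i; rewrite inE v12.
by move=> /s1; rewrite inE => /eqP.
Qed.

Lemma free_im H (t : {ffun 'I_b -> H}) (f : V -> H) : {morph f : x y / (x * y)%g} ->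
  (forall i, f (e i) = t i) -> forall h, h \in tgen t -> exists x, f x = h.
Proof.
move=> fM fE h; have [_ gV _] := freeV.
have fM' : {in [set: V] &, {morph f : x y / (x * y)%g}} by move=> x y _ _; apply: fM.
have -> : t = tmap (Morphism fM') e by apply/ffunP => i; rewrite ffunE /= fE.
by rewrite tgen_map => /morphimP [x _ _ ->]; exists x.
Qed.

Definition tau H (v : epiT V H) : {ffun 'I_b -> M H} := [ffun i => (rho (e i), v (e i))].
(** As e generates V, these are the v for which (rho, v) : V -> Q x H has image K. *)
Definition fibK H (K : {group M H}) := [set v : epiT V H | tgen (tau v) == K].
Definition avg H (f : epiT V H -> W) (K : {group M H}) : W :=
  #|fibK K|%:R^-1 *: \sum_(v in fibK K) f v.
Definition adj H (q : Q) (K : {group M H}) : {group M H} := (<[((q, 1%g) : M H)]> <*> K)%G.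
Fixpoint Gl H (g : {group M H} -> W) (l : seq Q) (K : {group M H}) : W :=
  if l is q :: l' then Gl g l' K - Gl g l' (adj q K) else g K.

Fact graph_group H (phi : epi H Q) : group_set [set z : M H | z.1 == phi z.2].
Proof.
apply/group_setP; split; first by rewrite inE epi1.
by move=> x y; rewrite !inE => /eqP xE /eqP yE; apply/eqP; rewrite epiM -xE -yE.
Qed.
Definition graph H (phi : epi H Q) : {group M H} := Group (graph_group phi).
Lemma graphE H (phi : epi H Q) z : (z \in graph phi) = (z.1 == phi z.2).
Proof. by rewrite inE. Qed.

Definition lQ : seq Q := [seq q <- enum Q | q != 1%g].
Lemma lQE q : (q \in lQ) = (q != 1%g).
Proof. by rewrite mem_filter mem_enum inE andbT. Qed.

(* The product of the (1 - adj q) over q != 1 kills the value at every K that meets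
   Q x 1 nontrivially. This is what makes psi natural: along a : H' -> H, a graph
   of H' -> Q becomes a subgroup of Q x H which is a graph or meets Q x 1. *)
Definition psi_fun H (f : irep V W H) : Z H :=
  \sum_(phi : epiT H Q) ract Z phi (Gl (avg (f : {ffun epiT V H -> W})) lQ (graph phi)).

Lemma Gl_lin H (c : k) (g g' h : {group M H} -> W) l K :
  (forall K, h K = c *: g K + g' K) -> Gl h l K = c *: Gl g l K + Gl g' l K.
Proof.
move=> hE; elim: l K => [|q l IH] K //=.
by rewrite !IH scalerBr opprD addrACA.
Qed.

Fact psi_lin H : linear (@psi_fun H).
Proof.
move=> c f g; rewrite /psi_fun scaler_sumr -big_split; apply: eq_bigr => phi _.
rewrite (@Gl_lin H c (avg (f : {ffun epiT V H -> W})) (avg (g : {ffun epiT V H -> W}))) ?linearP // => K.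
rewrite /avg scalerA mulrC -scalerA -scalerDr; congr (_ *: _); rewrite scaler_sumr -big_split.
by apply: eq_bigr => v _; rewrite !ffunE.
Qed.

Lemma Gl_eq H (g g' : {group M H} -> W) l (K : {group M H}) :
  (forall K' : {group M H}, K \subset K' -> g K' = g' K') -> Gl g l K = Gl g' l K.
Proof.
elim: l K => [|q l IH] K gg /=; first exact: gg.
rewrite IH //; congr (_ - _); apply: IH => K' KK'; apply: gg.
by apply: (fintype.subset_trans _ KK'); apply: joing_subr.
Qed.

(** [adj q] fixes every subgroup containing (q, 1), so the factor 1 - [adj q] vanishes there; the
    other factors only enlarge the subgroup. *)
Lemma Gl_kill H (g : {group M H} -> W) l q (K : {group M H}) : q \in l -> (q, 1%g) \in K -> Gl g l K = 0.
Proof.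
elim: l K => // q' l IH K; rewrite inE => /orP [/eqP <-|ql] qK /=.
  have -> : adj q K = K by apply/val_inj/joing_idPr; rewrite cycle_subG.
  by rewrite subrr.
rewrite !IH ?subrr //; apply: (fintype.subsetP (joing_subr _ _)) qK.
Qed.

Lemma Gl_id H (g : {group M H} -> W) l K : (forall q, q \in l -> q != 1%g) ->
  (forall q (K' : {group M H}), q != 1%g -> (q, 1%g) \in K' -> g K' = 0) -> Gl g l K = g K.
Proof.
move=> l1 g0; elim: l l1 K => // q l IH l1 K /=.
have l1' : forall q', q' \in l -> q' != 1%g by move=> q' q'l; apply: l1; rewrite inE q'l orbT.
rewrite !IH // (g0 q (adj q K)) ?subr0 //; first by apply: l1; rewrite mem_head.
by apply: (fintype.subsetP (joing_subl _ _)); apply: cycle_id.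
Qed.

Section Nat.
Variables (H' H : grp U) (a : epi H' H).
Let pm (z : M H') : M H := (z.1, a z.2).
Fact pmM : {in [set: M H'] &, {morph pm : x y / (x * y)%g}}.
Proof. by move=> x y _ _; congr pair; apply: epiM. Qed.
Let pi := Morphism pmM.

Lemma Gl_map (g : {group M H} -> W) l K' : Gl (fun K => g (pi @* K)%G) l K' = Gl g l (pi @* K')%G.
Proof.
elim: l K' => //= q l IH K'; rewrite !IH; congr (_ - Gl _ _ _).
apply: val_inj; rewrite /= morphimY ?finset.subsetT // morphim_cycle ?finset.in_setT //.
by rewrite /= /pm /= epi1.
Qed.

Lemma tau_map (v' : epiT V H') : tmap pi (tau v') = tau (ecompT a v').
Proof. by apply/ffunP => i; rewrite [LHS]ffunE [tau v' i]ffunE [RHS]ffunE ecompTE. Qed.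

Hypotheses (H's : (#|H'| <= s)%N) (kH' : killed p n H').

(* By freeness of V, epimorphisms from V are generating tuples, and these have
   equinumerous fibres by [card_lifts]; hence averages are compatible with a. *)
Lemma fib_lift (K' : {group M H'}) (v : epiT V H) : (forall h, exists2 z, z \in K' & z.2 = h) ->
  tgen (tau v) = (pi @* K')%G ->
  #|[set v' : epiT V H' | (v' \in fibK K') && (ecompT a v' == v)]| = #|lifts pi K' (tau v)|.
Proof.
move=> K'S vK.
have [_ gV uV] := freeV.
rewrite -(@card_imset _ _ (@tau H')); last first.
    move=> v1 v2 vv; apply: epiT_inj; apply: free_eq => i.
  have := congr1 (fun t : {ffun 'I_b -> M H'} => (t i).2) vv.
  by rewrite !ffunE.
apply: eq_card => t'; apply/imsetP/idP => [[v']|].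
  rewrite !inE => /andP [/eqP gK /eqP <-] ->; rewrite gK eqxx; apply/eqP; exact: tau_map.
rewrite inE => /andP [/eqP gK /eqP tE].
have [f fM fE] := uV H' (fun i => (t' i).2) kH'.
have fS h : exists x, f x = h.
  have [z zK <-] := K'S h.
  apply: (free_im (t := [ffun i => (t' i).2]) fM) => [i|]; first by rewrite ffunE.
  have -> : [ffun i => (t' i).2] = tmap (snd_morphism Q H') t' by apply/ffunP => i; rewrite !ffunE.
  by rewrite tgen_map gK; apply: (mem_morphim (snd_morphism Q H')); rewrite ?inE.
have tauf : tau (epiT_of (mkepi fM fS)) = t'.
  apply/ffunP => i; rewrite ffunE epiT_ofE /= fE.
  have := congr1 (fun t : {ffun 'I_b -> M H} => (t i).1) tE; rewrite !ffunE /= => <-.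
  by case: (t' i).
exists (epiT_of (mkepi fM fS)) => //.
rewrite !inE tauf gK eqxx /=; apply/eqP/epiT_inj; apply: free_eq => i.
rewrite ecompTE epiT_ofE /= fE.
have := congr1 (fun t : {ffun 'I_b -> M H} => (t i).2) tE.
by rewrite !ffunE.
Qed.

Lemma avg_map (f : irep V W H) (K' : {group M H'}) : (forall h, exists2 z, z \in K' & z.2 = h) ->
  avg (ract (irep V W) a f : {ffun epiT V H' -> W}) K' = avg (f : {ffun epiT V H -> W}) (pi @* K')%G.
Proof.
move=> K'S; rewrite /avg.
have fibpi (v' : epiT V H') : v' \in fibK K' -> ecompT a v' \in fibK (pi @* K')%G.
  rewrite !inE => /eqP <-; rewrite -tgen_map; apply/eqP; congr tgen; exact/esym/tau_map.
pose c v := #|[set v' : epiT V H' | (v' \in fibK K') && (ecompT a v' == v)]|.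
(* The origin of the bound s * s: K' is a subgroup of Q x H', both factors having order at most
   s. *)
have K'b : (#|K'| <= b)%N.
  apply: leq_trans sb; apply: leq_trans (leq_mul Qs H's).
  by rewrite -card_prod max_card.
have [c0 cE] : exists c0, forall v, v \in fibK (pi @* K')%G -> c v = c0 /\ (0 < c0)%N.
  case: (set_0Vmem (fibK (pi @* K')%G)) => [->|[v0]]; first by exists 0%N => v; rewrite inE.
  rewrite inE => /eqP v0K; exists (c v0) => v; rewrite inE => /eqP vK.
  rewrite /c !fib_lift //; split; last exact: lifts_gt0.
  by apply: card_lifts.
(* Stated over any commutative monoid: with natural numbers and F = 1 it computes the order of
   [fibK K'], with W it computes the sum in the average. *)
have sumE (R : nmodType) (F : epiT V H -> R) : \sum_(v' : epiT V H' | v' \in fibK K') F (ecompT a v') =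
    (\sum_(v in fibK (pi @* K')%G) F v) *+ c0.
  rewrite (partition_big (fun v' : epiT V H' => ecompT a v') (mem (fibK (pi @* K')%G))) //=.
  rewrite -sumrMnl; apply: eq_bigr => v vK.
  rewrite (eq_bigr (fun=> F v)); last by move=> v' /andP [_ /eqP ->].
  rewrite sumr_const -(cE v vK).1; congr (_ *+ _).
  by rewrite /c cardsE.
case: (posnP #|fibK (pi @* K')%G|) => [z|gt0].
  have z' : fibK K' = finset.set0.
    apply/finset.setP => v'; rewrite [RHS]finset.in_set0; apply/negP => /fibpi.
    by move/eqP: z; rewrite cards_eq0 => /eqP ->; rewrite finset.in_set0.
  have zz : fibK (pi @* K')%G = finset.set0 by apply/eqP; rewrite -cards_eq0 z.
  by rewrite zz z' !big_set0 !scaler0.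
have [v0 v0K] : exists v0, v0 \in fibK (pi @* K')%G by apply/finset.set0Pn; rewrite -card_gt0.
have c0gt := (cE v0 v0K).2.
have cardE : #|fibK K'| = (#|fibK (pi @* K')%G| * c0)%N.
  have := sumE nat (fun=> 1%N); rewrite !sum1_card => ->.
  by elim: (c0) => [|c' IH]; rewrite ?muln0 // mulrS IH mulnS.
rewrite (eq_bigr (fun v' : epiT V H' => f (ecompT a v'))); last by move=> v' _; rewrite irep_actE.
rewrite sumE cardE -scaler_nat scalerA natrM invfM mulfVK //.
by move/pcharf0P: k0 => ->; rewrite -lt0n.
Qed.

Lemma graph_surj (phi : epi H' Q) (K' : {group M H'}) : graph phi \subset K' ->
  forall h, exists2 z, z \in K' & z.2 = h.
Proof.
move=> /fintype.subsetP gK h; exists (phi h, h) => //.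
by apply: gK; rewrite graphE.
Qed.

Lemma graph_comp (phi : epiT H Q) : (pi @* graph (ecompT phi a))%G = graph phi.
Proof.
apply/val_inj/finset.setP => z; apply/morphimP/idP => [[z' _]|].
  rewrite graphE ecompTE => /eqP z1 ->; rewrite graphE; exact/eqP.
rewrite graphE => /eqP z1; have [x xE] := epi_surj a z.2.
exists (phi z.2, x); rewrite ?finset.in_setT //; first by rewrite graphE ecompTE xE.
by apply: pair_ext; [exact: z1|exact/esym/xE].
Qed.

(** If phi' does not factor through a, it is nontrivial at some x in the kernel of a, and (phi' x,
    x) is sent to (phi' x, 1). *)
Lemma graph_nofact (phi' : epiT H' Q) : (forall phi : epiT H Q, ecompT phi a != phi') ->
  exists2 q, q != 1%g & (q, 1%g) \in (pi @* graph phi')%G.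
Proof.
move=> nf; apply: contrapT => nq.
have ker x : a x = 1%g -> phi' x = 1%g.
  move=> ax; apply: contrapT => /eqP px; apply: nq; exists (phi' x) => //.
  have -> : (phi' x, 1%g) = pi (phi' x, x) by rewrite /= /pm /= ax.
  by apply: mem_morphim; rewrite ?finset.in_setT // graphE.
have /dchoiceT [d dE] : forall h, exists q, forall x, a x = h -> phi' x = q.
  move=> h; have [x xE] := epi_surj a h; exists (phi' x) => y yE.
  have aV : {morph a : x / x^-1%g} by move=> z; apply: (mulgI (a z)); rewrite -epiM !mulgV epi1.
  apply: (mulIg (phi' x^-1)%g); rewrite -!epiM mulgV ker ?epi1 //.
  by rewrite epiM aV xE yE mulgV.
have dM : {morph d : x y / (x * y)%g}.
  move=> h1 h2; have [x1 E1] := epi_surj a h1; have [x2 E2] := epi_surj a h2.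
  by rewrite -(dE _ _ E1) -(dE _ _ E2) -epiM; apply/esym/dE; rewrite epiM E1 E2.
have dS q : exists h, d h = q.
  by have [x <-] := epi_surj phi' q; exists (a x); apply/esym/dE.
move/negP: (nf (epiT_of (mkepi dM dS))); apply; apply/eqP/epiT_inj => x.
by rewrite ecompTE epiT_ofE; apply/esym/dE.
Qed.

Lemma psi_nat_good (f : irep V W H) : psi_fun (ract (irep V W) a f) = ract Z a (psi_fun f).
Proof.
pose F (phi' : epiT H' Q) := ract Z phi' (Gl (avg (f : {ffun epiT V H -> W})) lQ (pi @* graph phi')%G).
have -> : psi_fun (ract (irep V W) a f) = \sum_phi' F phi'.
  apply: eq_bigr => phi' _; congr (ract Z _ _); rewrite -Gl_map; apply: Gl_eq => K' gK'.
  exact/avg_map/graph_surj/gK'.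
have -> : ract Z a (psi_fun f) = \sum_(phi : epiT H Q) F (ecompT phi a).
  rewrite linear_sum; apply: eq_bigr => phi _.
  by rewrite /F graph_comp ract_compT.
pose I := [set ecompT phi a | phi : epiT H Q].
rewrite (bigID (mem I)) /= [X in _ + X]big1 ?addr0.
  by rewrite big_imset //= => phi1 phi2 _ _; apply: ecompT_inj.
move=> phi' nI; have [|q q1 qK] := @graph_nofact phi'.
  by move=> phi; apply: contraNneq nI => <-; apply: imset_f.
by rewrite /F (@Gl_kill _ _ _ q) ?linear0 // lQE.
Qed.
End Nat.

Fact psi_nat (H' H : grp U) (a : epi H' H) f : psi_fun (ract (irep V W) a f) = ract Z a (psi_fun f).
Proof.
(* Boundedness of Z applied to the difference itself: either it is zero, or H' is as small as the
   counting argument requires. *)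
case: (Zs (psi_fun (ract (irep V W) a f) - ract Z a (psi_fun f))) => [/eqP|[H's kH']].
  by rewrite subr_eq0 => /eqP.
exact: psi_nat_good.
Qed.
Definition psi : rhom (irep V W) Z := mkrhom psi_lin psi_nat.

Lemma graph_inj H (phi phi' : epiT H Q) : graph phi = graph phi' -> phi = phi'.
Proof.
move=> gg; apply: epiT_inj => x; apply/eqP.
by rewrite -(graphE phi' (phi x, x)) -gg graphE.
Qed.

(** For an isomorphism phi, let f be w on the fibre of the graph of phi and 0 elsewhere. Its average
    is supported at that graph, which meets Q x 1 trivially, so the factors 1 - [adj q] leave it
    unchanged. *)
Lemma psi_surj H (phi : epiT H Q) (phi' : epi Q H) (w : W) : (forall x, phi' (phi x) = x) ->
  (forall y, phi (phi' y) = y) -> exists f : irep V W H, psi H f = ract Z phi w.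
Proof.
move=> phK phK'; pose f : {ffun epiT V H -> W} := [ffun v => if v \in fibK (graph phi) then w else 0].
exists f.
have avgE K : avg f K = if K == graph phi then w else 0.
  rewrite /avg; case: (eqVneq K (graph phi)) => [->|ne].
    (* The fibre is nonempty, so the division by its order is legitimate. *)
    have v0 : ecompT phi' rho \in fibK (graph phi).
      rewrite inE; apply/eqP.
      have grM : {in [set: V] &, {morph (fun x => (rho x, phi' (rho x)) : M H) : x y / (x * y)%g}}.
        by move=> x y _ _; congr pair; rewrite ?epiM.
      have -> : tau (ecompT phi' rho) = tmap (Morphism grM) e.
        by apply/ffunP => i; rewrite [LHS]ffunE [RHS]ffunE ecompTE.
      have [_ gV _] := freeV.
      rewrite tgen_map gV; apply/val_inj/finset.setP => z; apply/morphimP/idP => [[x _ _ ->]|].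
        by rewrite graphE phK'.
      rewrite graphE => /eqP z1; have [x xE] := epi_surj rho z.1.
      exists x; rewrite ?finset.in_setT //; apply: pair_ext => /=; first exact/esym/xE.
      by rewrite xE z1 phK.
    rewrite (eq_bigr (fun=> w)); last by move=> v vK; rewrite ffunE vK.
    rewrite sumr_const -scaler_nat scalerA mulVf ?scale1r //.
    move/pcharf0P: k0 => ->; rewrite -lt0n card_gt0; apply/finset.set0Pn; by eexists; exact: v0.
  rewrite big1 ?scaler0 // => v; rewrite inE => /eqP vK; rewrite ffunE inE vK.
  by rewrite (negPf ne).
have gE (chi : epiT H Q) : Gl (avg f) lQ (graph chi) = if chi == phi then w else 0.
  rewrite Gl_id ?avgE => [|q|q K' q1 qK].
  - case: eqP => [/graph_inj ->|ne]; first by rewrite eqxx.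
    by case: eqP => // chiE; case: ne; rewrite chiE.
  - by rewrite lQE.
  rewrite avgE; case: eqP => // KE; case/eqP: q1; rewrite -(epi1 phi); apply/eqP.
  by rewrite -(graphE phi (q, 1%g)) -KE.
rewrite /= /psi_fun (bigD1 phi) //= big1 ?addr0; first by rewrite gE eqxx.
by move=> chi /negPf ne; rewrite gE ne linear0.
Qed.
End Psi.

Section Cover.
Variables (k : fieldType) (p n : nat).
Notation U := (abelian_pgroup p).
Notation rep := (rep k U).
Notation cplx := (cplx k U).
Hypothesis k0 : [pchar k] =i pred0.

Section IrepMap.
Variables (V : grp U) (E F : lmodType k) (l : {linear E -> F}).
Fact irep_map_lin (H : grp U) : linear (fun f : irep V E H => [ffun v : epiT V H => l ((f : {ffun epiT V H -> E}) v)] : irep V F H).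
Proof. by move=> c f g; apply/ffunP => v; rewrite !ffunE linearP. Qed.
Fact irep_map_nat (G H : grp U) (a : epi G H) (f : irep V E H) :
  ([ffun v : epiT V G => l ((ract (irep V E) a f : {ffun epiT V G -> E}) v)] : irep V F G) =
  ract (irep V F) a [ffun v : epiT V H => l ((f : {ffun epiT V H -> E}) v)].
Proof. by apply/ffunP => v; rewrite irep_actE !ffunE. Qed.
Definition irep_map : rhom (irep V E) (irep V F) := mkrhom irep_map_lin irep_map_nat.
Lemma irep_mapE H (f : irep V E H) v :
  (irep_map H f : {ffun epiT V H -> F}) v = l ((f : {ffun epiT V H -> E}) v).
Proof. by rewrite ffunE. Qed.
End IrepMap.

Lemma killed_epi (G H : grp U) (a : epi G H) : killed p n G -> killed p n H.
Proof.
move=> kG y; have [x <-] := epi_surj a y.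
have E j : (a x ^+ j = a (x ^+ j))%g by elim: j => [|j IH]; rewrite ?epi1 // !expgS IH epiM.
by rewrite E kG epi1.
Qed.

Definition bounded s (Z : rep) := forall (H : grp U) (z : Z H), z = 0 \/ (#|H| <= s)%N /\ killed p n H.

(** Sum the maps [psi] over representatives Q of the small groups, with E the sum of the values of Z
    at them. An element at H is reached through the representative isomorphic to H. *)
Lemma cover s b (Z : rep) (V : grp U) (e : {ffun 'I_b -> V}) : bounded s Z -> (s * s <= b)%N -> freeP n e ->
  exists (E : lmodType k) (f : rhom (irep V E) Z), forall H z, exists x, f H x = z.
Proof.
move=> Zs sb fV; have [I [Gs GsP]] := @exhaust p s.
have /dchoice [P PP] : forall i, exists P : rhom (irep V (Z (Gs i))) Z, (#|Gs i| <= s)%N -> killed p n (Gs i) ->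
    forall (H : grp U) (phi : epiT H (Gs i)) (phi' : epi (Gs i) H) (w : Z (Gs i)), (forall x, phi' (phi x) = x) ->
    (forall y, phi (phi' y) = y) -> exists f, P H f = ract Z phi w.
  move=> i; case: (pselect ((#|Gs i| <= s)%N /\ killed p n (Gs i))) => [[Qs kQ]|]; last first.
    by move=> h; exists (rzero _ _) => h1 h2; case: h.
  (* Since s <= s * s <= b, the group Q is generated by b elements and so receives an epimorphism
     rho from V. *)
  have Qb : (#|[set: Gs i]%G| <= b)%N.
    rewrite cardsT; apply: leq_trans sb; apply: leq_trans Qs _.
    by case: (s) => // s'; rewrite leq_pmulr.
  have [t tQ] := tgen_ex Qb; have [_ _ uV] := fV.
  have [f fM fE] := uV (Gs i) t kQ.
  have fS h : exists x, f x = h.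
    by apply: (free_im fV fM fE); rewrite tQ finset.in_setT.
  exists (psi k0 sb Zs fV Qs (mkepi fM fS)) => _ _ H phi phi' w.
  exact: psi_surj.
pose E : lmodType k := dsum predT (fun i => Z (Gs i) : lmodType k).
pose pr i : {linear E -> Z (Gs i)} :=
  @mklin k E (Z (Gs i)) (fun x : dsum predT (fun i => Z (Gs i) : lmodType k) => x i) (fun a x y => erefl).
exists E, (\big[@radd _ _ _ Z/rzero (irep V E) Z]_i rcomp (P i) (irep_map V (pr i))) => H z.
case: (Zs H z) => [->|[Hs kH]]; first by exists 0; rewrite linear0.
have [i [a [a' aK]]] := GsP H Hs.
have aK' y : a (a' y) = y by have [x <-] := epi_surj a y; rewrite aK.
have [||x||f fE] := PP i _ _ H (epiT_of a) a' (ract Z a' z).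
- exact: leq_trans (epi_leq a) Hs.
- exact: killed_epi a kH.
- by rewrite epiT_ofE.
- by move=> y; rewrite epiT_ofE.
exists ([ffun v : epiT V H => dsum_in (fun i => Z (Gs i) : lmodType k) i ((f : {ffun epiT V H -> Z (Gs i)}) v)] : irep V E H).
rewrite rhom_sumE (bigD1 i) // big1.
  apply: etrans (addr0 _) _.
  set F := (X in rcomp _ _ _ X = _); change (P i H (irep_map V (pr i) H F) = z).
  have -> : irep_map V (pr i) H F = f; rewrite /F.
    apply/ffunP => v; rewrite irep_mapE ffunE; exact: dsum_in_id.
  rewrite fE -ract_comp -[RHS]ract_id; apply: ract_ext => x; rewrite /= ffunE; exact: aK.
move=> j /andP [_ /eqP ji].
set F := (X in rcomp _ _ _ X = _); change (P j H (irep_map V (pr j) H F) = 0).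
have -> : irep_map V (pr j) H F = 0; rewrite /F.
  apply/ffunP => v; rewrite irep_mapE !ffunE; apply: dsum_in_ne => /esym; exact: ji.
exact: linear0.
Qed.

Section Ker.
Variables (X Y : rep) (f : rhom X Y).
Let ker (G : grp U) := [pred x : X G | f G x == 0].
Fact ker_closed G : submod_closed (ker G).
Proof.
split; first by rewrite inE linear0.
by move=> c x y; rewrite !inE => /eqP x0 /eqP y0; rewrite linearP x0 y0 scaler0 addr0.
Qed.
HB.instance Definition _ G := GRing.isSubmodClosed.Build k (X G) (ker G) (ker_closed G).
Definition kerT G := {x : X G | x \in ker G}.
HB.instance Definition _ G := [isSub of kerT G for @sval _ _].
HB.instance Definition _ G := [Choice of kerT G by <:].
HB.instance Definition _ G := [SubChoice_isSubLmodule of kerT G by <:].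

Let kract_sub (G H : grp U) (a : epi G H) (x : kerT H) : ract X a (val x) \in ker G.
Proof. by have := valP x; rewrite !inE rnat => /eqP ->; rewrite linear0. Qed.
Let kract_fun (G H : grp U) (a : epi G H) (x : kerT H) : kerT G := Sub (ract X a (val x)) (kract_sub a x).
Let kract_lin (G H : grp U) (a : epi G H) : linear (kract_fun a).
Proof. by move=> c x y; apply: val_inj; rewrite /= !linearP. Qed.
Let kract (G H : grp U) (a : epi G H) := mklin (kract_lin a).
Fact rker_id (G : grp U) x : kract (epi_id G) x = x.
Proof. by apply: val_inj; rewrite /= ract_id. Qed.
Fact rker_comp (G H K : grp U) (b : epi H K) (a : epi G H) x :
  kract (epi_comp b a) x = kract a (kract b x).
Proof. by apply: val_inj; rewrite /= ract_comp. Qed.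
Fact rker_conj (G H : grp U) (a b : epi G H) (h : H) :
  (forall g, b g = (a g ^ h)%g) -> kract a =1 kract b.
Proof. by move=> ab x; apply: val_inj; exact: ract_conj ab _. Qed.
Definition rker : rep := Rep rker_id rker_comp rker_conj.
Definition rker_in : rhom rker X := @mkrhom k U rker X (fun G x => val x) (fun G c x y => erefl) (fun G H a x => erefl).

Lemma rker_lift (R : rep) (g : rhom R X) : (forall G x, f G (g G x) = 0) ->
  exists g' : rhom R rker, forall G x, rker_in G (g' G x) = g G x.
Proof.
move=> fg; have gk G x : g G x \in ker G by rewrite inE fg.
have gL G : linear (fun x => Sub (g G x) (gk G x) : kerT G).
  by move=> c x y; apply: val_inj; rewrite /= linearP.
have gN (G H : grp U) (a : epi G H) x : Sub (g G (ract R a x)) (gk G _) = ract rker a (Sub (g H x) (gk H x) : kerT H).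
  by apply: val_inj; rewrite /= rnat.
by exists (@mkrhom k U R rker (fun G x => Sub (g G x) (gk G x) : kerT G) gL gN).
Qed.

Lemma rker_inK G (x : rker G) : f G (rker_in G x) = 0.
Proof. by have := valP x; rewrite inE => /eqP. Qed.
End Ker.

(** * Detection of acyclicity on free groups *)

Section Syz.
Variable T : cplx.
Hypothesis PT : forall n, Pj (T n).
Definition nontriv j (Z : rep) (f : rhom (T (j + 1)) Z) :=
  (forall G x, f G (cd T (j + 1) G x) = 0) /\
  ~ exists u : rhom (T j) Z, forall G x, f G x = u G (cd T j G x).

Lemma irep_bounded (V : grp U) E : killed p n V -> bounded #|V| (irep V E).
Proof.
move=> kV H f; case: (pselect (exists v : epiT V H, True)) => [[v _]|nv].
  by right; split; [apply: epi_leq v|apply: killed_epi v kV].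
by left; apply/ffunP => v; case: nv; exists v.
Qed.

(* Maps into irep V E are linear maps from the value at V. *)
Lemma irep_factor (V : grp U) E j (g : rhom (T (j + 1)) (irep V E)) : acycG T V ->
  (forall G x, g G (cd T (j + 1) G x) = 0) ->
  exists h : rhom (T j) (irep V E), forall G x, g G x = h G (cd T j G x).
Proof.
move=> aT gd.
pose l0 (x : T (j + 1) V) : E := (g V x : {ffun epiT V V -> E}) (epiT_of (epi_id V)).
have l0L : linear l0 by move=> c x y; rewrite /l0 linearP !ffunE.
pose l := mklin l0L.
have gE L x : g L x = coyo l L x.
  apply/ffunP => v; rewrite coyoE /= /l0 rnat irep_actE; congr (_ _).
  by apply: epiT_inj => y; rewrite ecompTE epiT_ofE.
(* By exactness at V, l vanishes on all cycles, so it equals (l s) d. *)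
have [s sE] := ginv (cd T j V).
exists (coyo (l \o s)) => G x; rewrite gE; apply/ffunP => v; rewrite !coyoE /= -rnat.
set y := ract _ _ x.
have [|w wE] := aT j (y - s (cd T j V y)); first by rewrite linearB sE subrr.
have : l (y - s (cd T j V y)) = 0 by rewrite wE /= /l0 gd ffunE.
by rewrite linearB => /eqP; rewrite subr_eq0 => /eqP.
Qed.

Lemma syzygy s j (Z : rep) (f : rhom (T (j + 1)) Z) : bounded s Z -> nontriv f ->
  (forall B, exists b (V : grp U) (e : {ffun 'I_b -> V}), [/\ (B <= b)%N, freeP n e & acycG T V]) ->
  exists s' (Z' : rep) (f' : rhom (T (j + 1 + 1)) Z'), bounded s' Z' /\ nontriv f'.
Proof.
move=> Zs [fd fN] hV; have [b [V [e [sb fV aV]]]] := hV (s * s)%N.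
have [E [P Ps]] := cover Zs sb fV.
have [|G x|F FE] := @PT (j + 1) _ _ _ P (rzero Z Z) _ f => //.
have [|f' f'E] := @rker_lift _ _ P _ (rcomp F (cd T (j + 1))).
  by move=> G x; rewrite /= FE fd.
have [kV _ _] := fV.
(* The kernel sits inside a diagram living on quotients of V, so the next bound is the order of V.
   This growth forces the hypothesis at arbitrarily large ranks. *)
exists #|V|, (rker P), f'; split; last split.
- move=> H z; case: (irep_bounded kV (rker_in P H z)) => [z0|]; [left|by right].
  exact: val_inj.
- by move=> G x; apply: val_inj; apply: (etrans (f'E G _)); rewrite /= cdd linear0.
move=> [u uE].
(* If f' were u d, then F - u would vanish on boundaries and hence equal h d. As P kills u, this
   would give f = (P h) d. *)
have [|h hE] := irep_factor (g := radd F (rscale (-1) (rcomp (rker_in P) u))) aV.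
  move=> G x; rewrite /= scaleN1r.
  have := f'E G x; rewrite uE /= => <-; exact: subrr.
apply: fN; exists (rcomp P h) => G x.
rewrite /= -hE /= linearD linearZ_LR.
have -> : P G (sval (u G x)) = 0 by apply: (@rker_inK _ _ P G (u G x)).
by rewrite scaler0 addr0 FE.
Qed.
End Syz.

Theorem acycG_killed (X : cplx) : compact X ->
  (forall B, exists b (V : grp U) (e : {ffun 'I_b -> V}), [/\ (B <= b)%N, freeP n e & acycG X V]) ->
  forall G : grp U, killed p n G -> acycG X G.
Proof.
move=> cX hX G kG; have [T [q [KT qq PT hT]]] := compact_res cX.
have hV B : exists b (V : grp U) (e : {ffun 'I_b -> V}), [/\ (B <= b)%N, freeP n e & acycG T V].
  by have [b [V [e [h1 h2 h3]]]] := hX B; exists b, V, e; split=> //; apply/(qis_acycG V qq).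
apply/(qis_acycG G qq); apply: contrapT => /existsNP [a /existsNP [x /not_implyP [dx nx]]].
have [l [l0 l1]] := boundary_functional nx.
pose St := {j : int & {Z : rep & rhom (T (j + 1)) Z}}.
pose ok (y : St) := (exists s, bounded s (projT1 (projT2 y))) /\ nontriv (projT2 (projT2 y)).
pose x0 : St := existT _ a (existT _ (irep G k^o) (coyo l)).
have ok0 : ok x0.
  split; first by exists #|G|; apply: irep_bounded.
  split=> [H y|[u uE]].
    apply/ffunP => v; rewrite coyoE -rnat ffunE; exact: l0.
  have c0 : coyo l G x = 0 by apply: (etrans (uE G x)); rewrite dx linear0.
  have := coyo_id l x; rewrite c0 ffunE l1 => /eqP.
  by rewrite eq_sym oner_eq0.
have /dchoiceT [nxt nxtP] : forall y : St, exists y' : St, ok y -> ok y' /\ projT1 y' = projT1 y + 1.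
  move=> [j [Z f]]; case: (pselect (ok (existT _ j (existT _ Z f)))) => [okf|]; last by exists x0.
  have [[s Zs] fN] := okf; have [s' [Z' [f' [Zs' fN']]]] := syzygy PT Zs fN hV.
  by exists (existT _ (j + 1) (existT _ Z' f')) => _; split=> //; split=> //; exists s'.
pose st i := iter i nxt x0.
have stP i : ok (st i) /\ projT1 (st i) = a + i%:Z.
  elim: i => [|i [oki ji]]; first by rewrite addr0.
  by have [ok' j'] := nxtP _ oki; split=> //; rewrite /st iterS j' ji; lia.
pose J i := projT1 (st i); pose Z i := projT1 (projT2 (st i)); pose f i : rhom (T (J i + 1)) (Z i) := projT2 (projT2 (st i)).
(* The i-th syzygy map, extended by zero outside its own degree a + i + 1. *)
pose c i := single (fun N => rzero (T N) (Z i)) (f i).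
have cE i : c i (J i + 1) = f i by apply: singleE.
have cN i N : J i + 1 <> N -> c i N = rzero (T N) (Z i) by apply: single_ne.
have cd0 i N H y : c i N H (cd T N H y) = 0.
  apply: (@single_ind (fun N => rhom (T N) (Z i)) (fun N => rzero (T N) (Z i)) _ (f i)
    (fun N g => forall y, g H (cd T N H y) = 0)) => // y'.
  by have [[_ [fd _]] _] := stP i; apply: fd.
pose Cc i := cst (Z i).
have gP N H y : dsum_pred predT (fun i => c i N H y).
  (* In degree N only the index i = N - 1 - a can contribute, so the map to the coproduct is well
     defined. *)
  split=> // ; apply: sub_finite_set (finite_set1 (absz (N - 1 - a)%R)) => i /=.
  case: (pselect (J i + 1 = N)) => [JN _|/cN ->]; last by rewrite eqxx.
  by have [_ ji] := stP i; move: JN; rewrite /J ji; lia.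
pose g0 N : rhom (T N) (coprod Cc N) := @rinto k U _ predT (fun i => Cc i N) (T N) (fun i => c i N) (gP N).
have gd N H y : g0 N H (cd T N H y) = cd (coprod Cc) N H (g0 (N + 1) H y).
  by apply: dsum_inj => i; apply: (etrans (cd0 i N H y)).
have [S fS [h hE]] := hret_hcompact hT (CMap gd).
have [i nS] := finite_nat_ne fS.
have [[_ [_ fN]] _] := stP i; apply: fN.
(* The target has zero differentials, so the i-th component of the null homotopy reads [f i] = h d,
   the factorization that is excluded. *)
exists (rcomp (rproj predT (fun i => Cc i (J i + 1)) i) (h (J i))) => H y.
have := congr1 (fun z : coprod Cc (J i + 1) H => z i) (hE (J i) H y).
rewrite ctruncE asboolT // => E; rewrite -/(f i) -cE; apply: (etrans E).
exact: add0r.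
Qed.
End Cover.

(** * The chain of primes *)

Section Primes.
Variables (p : nat) (k : fieldType).
Hypotheses (p_prime : prime p) (k0 : [pchar k] =i pred0).
Notation U := (abelian_pgroup p).
Notation rep := (rep k U).
Notation cplx := (cplx k U).

Lemma diso_acycG (X Y : cplx) G : diso X Y -> acycG X G <-> acycG Y G.
Proof. by move=> /diso_retract [h1 h2]; split; apply: acycG_retract. Qed.

Lemma fproj_rpr (G : grp U) : fproj (rpr k G).
Proof.
exists unit, (fun=> G), (fun=> rid _), (fun=> rid _) => L x.
by rewrite (big_pred1 tt) // => -[].
Qed.

Section Conc.
Variable R : rep.
Definition conc_rep : int -> rep := single (T := fun=> rep) (fun=> rep0 k p) (m := 0) R.
Definition conc : cplx := @Cplx k U conc_rep (fun n => rzero (conc_rep (n + 1)) (conc_rep n)) (fun n G x => erefl).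

Lemma conc0 : conc 0 = R.
Proof. exact: singleE. Qed.
Lemma conc_ne n : 0 <> n -> conc n = rep0 k p.
Proof. exact: single_ne. Qed.

Lemma conc_perfect : fproj R -> perfect conc.
Proof.
move=> fR; split.
  exists 0%N => n n0; rewrite conc_ne; first by move=> G x; apply: rep0_eq.
  by move: n0; lia.
move=> n; case: (pselect (0 = n)) => [<-|/conc_ne ->]; first by rewrite conc0.
exact: fproj_rep0.
Qed.

Lemma conc_acycG G : acycG conc G <-> forall x : R G, x = 0.
Proof.
split=> [aR|R0 n x _].
  have X0 : forall n (x : conc n G), x = 0 by apply: intS_ind => n x; have [|y ->] := aR n x.
  by move: (X0 0); rewrite conc0.
exists 0; rewrite linear0; move: x.
case: (pselect (0 = n + 1)) => [<-|/conc_ne ->]; first by rewrite conc0.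
by move=> x; apply: rep0_eq.
Qed.
End Conc.

Definition cyc n : grp U := Grp (U_Z n p_prime).

Definition vanish n (X : cplx) := compact X /\ forall G : grp U, killed p n G -> acycG X G.

Lemma killedS i j (G : grp U) : (i <= j)%N -> killed p i G -> killed p j G.
Proof.
move=> ij kG x; have -> : (p ^ j.+1 = p ^ i.+1 * p ^ (j - i))%N.
  by rewrite -expnD addSn subnKC.
by rewrite expgM kG expg1n.
Qed.

(** The projective represented by the cyclic group of order p^(j+1), in degree 0: the object that
    separates the j-th ideal from the larger ones. *)
Definition cyc_cplx j := conc (rpr k (cyc j)).

Lemma cyc_compact j : compact (cyc_cplx j).
Proof. exact/perfect_compact/conc_perfect/fproj_rpr. Qed.

Lemma cyc_nvanish j : ~ vanish j (cyc_cplx j).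
Proof.
move=> [_ /(_ (cyc j) (@killed_Z p j p_prime)) /conc_acycG].
move/(_ (rdelta k (cyc j)))/(congr1 (fun f : {ffun epiT (cyc j) (cyc j) -> k^o} => f (epiT_of (epi_id (cyc j))))).
by rewrite !ffunE eqxx => /eqP; rewrite oner_eq0.
Qed.

(** A group of exponent dividing p^(i+1) has no epimorphism onto a cyclic group of order p^(j+1),
    whose generator would be killed too early. *)
Lemma cyc_vanish i j : (i < j)%N -> vanish i (cyc_cplx j).
Proof.
move=> ij; split; first exact: cyc_compact.
move=> G kG; apply/conc_acycG => x; apply/ffunP => v.
have := @killed_epi p i G (cyc j) (v : epiT G (cyc j)) kG (Zp1 : 'Z_(p ^ j.+1)).
move=> /eqP; rewrite -order_dvdn order_Zp1 Zp_cast ?m_gt1 // => /dvdn_leq.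
by rewrite expn_gt0 prime_gt0 // leq_exp2l ?prime_gt1 // ltnNge ij => /(_ isT).
Qed.

Lemma vanish_prime n : prime_ideal (vanish n).
Proof.
split.
- split.
  + by move=> X [].
  + by move=> X X0; split; [apply: compact_zero|move=> G _; apply: acycG_zero].
  + move=> X Y Z [Y' [Z' [f [dX dY dZ]]]] [cY aY] [cZ aZ]; split.
      by apply/(compact_diso dX)/compact_fib; [apply/(compact_diso dY)|apply/(compact_diso dZ)].
    move=> G kG; apply/(diso_acycG G dX)/fib_acyc1; [apply/(diso_acycG G dY)|apply/(diso_acycG G dZ)]; auto.
  + move=> X Y Z [Y' [Z' [f [dX dY dZ]]]] [cX aX] [cZ aZ]; split.
      by apply/(compact_diso dY)/(@compact_fibl _ _ _ _ f); [apply/(compact_diso dX)|apply/(compact_diso dZ)].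
    move=> G kG; apply/(diso_acycG G dY)/(@fib_acyc2 _ _ _ _ f); [apply/(diso_acycG G dX)|apply/(diso_acycG G dZ)]; auto.
  + move=> X Y Z [Y' [Z' [f [dX dY dZ]]]] [cX aX] [cY aY]; split.
      by apply/(compact_diso dZ)/(@compact_fibr _ _ _ _ f); [apply/(compact_diso dX)|apply/(compact_diso dY)].
    move=> G kG; apply/(diso_acycG G dZ)/(@fib_acyc3 _ _ _ _ f); [apply/(diso_acycG G dX)|apply/(diso_acycG G dY)]; auto.
  + move=> X Y rXY [cY aY]; split; first exact: compact_retract cY.
    by move=> G kG; apply: acycG_retract (aY G kG).
  by move=> X Y [cX aX] cY; split; [apply: compact_ctens|move=> G kG; apply/ctens_acyc/aX].
- exists (cyc_cplx n); [exact: cyc_compact|exact: cyc_nvanish].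
move=> X Y cX cY [_ aXY]; apply: contrapT => /not_orP [nX nY].
(* The contrapositive of [acycG_killed]: outside the ideal, acyclicity fails at all free groups of
   large rank, not merely at some group. *)
have bad Z : compact Z -> ~ vanish n Z -> exists B, forall b (V : grp U) (e : {ffun 'I_b -> V}),
    (B <= b)%N -> freeP n e -> ~ acycG Z V.
  move=> cZ nZ; apply: contrapT => nB; apply: nZ; split=> //.
  apply: (acycG_killed k0 cZ) => B; apply: contrapT => nb; apply: nB; exists B => b V e Bb fV aV.
  by apply: nb; exists b, V, e.
have [B hB] := bad X cX nX; have [B' hB'] := bad Y cY nY.
(* A rank that is bad for both factors at once. *)
have [V [e fV]] := free_ex n p_prime (maxn B B').
have [kV _ _] := fV.
case: (acycG_ctens_inv (aXY V kV)) => [/hB|/hB'].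
  by move/(_ _ e (leq_maxl _ _)); apply.
by move/(_ _ e (leq_maxr _ _)); apply.
Qed.

Definition vanish_pt n : Spc k U := MkSpc (vanish_prime n).

Lemma vanishS i j X : (i <= j)%N -> vanish j X -> vanish i X.
Proof. by move=> ij [cX aX]; split=> // G kG; apply/aX/(killedS ij). Qed.

Lemma vanish_pt_lt i j : (i < j)%N -> spc_lt (vanish_pt j) (vanish_pt i).
Proof.
move=> ij; split=> [X|h]; first exact/vanishS/ltnW.
exact/(@cyc_nvanish j)/h/cyc_vanish.
Qed.

Lemma krull_vanish : krull_dim_infinite k U.
Proof.
(* The ideals decrease with the index, so the chain runs through them backwards. *)
move=> N; exists (fun i : 'I_N.+1 => vanish_pt (N - i)) => i j ij.
by apply: vanish_pt_lt; have := ltn_ord j; lia.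
Qed.

(** Induction on m for all j >= m together: when j >= m + 1, both the j-th prime and its predecessor
    lie in the m-th derivative, and every neighbourhood of the former contains the latter. *)
Lemma vanish_pt_cb m j : (m <= j)%N -> cb_iter (@spc_open k U) (iter m osucc ozero) (vanish_pt j).
Proof.
elim: m j => // m IH j mj; split; first by apply: IH; apply: ltnW.
move=> [_ [O Oo [Oj Ouniq]]]; have [X [_ nsX sO]] := Oo _ Oj.
have j1 : (j.-1 < j)%N by case: (j) mj.
have OQ : O (vanish_pt j.-1).
  apply: sO => nQ; apply: nsX => vX; apply: nQ; apply: vanishS vX.
  exact: ltnW.
have e : vanish_pt j.-1 = vanish_pt j by apply: Ouniq => //; apply: IH; case: (j) mj.
by have [_] := vanish_pt_lt j1; rewrite e; apply.
Qed.

(** All finite derivatives are nonempty, so a rank, when it exists, is above every finite ordinal;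
    otherwise it is infinite. *)
Lemma cb_rank_omega : cb_rank_ge (@spc_open k U) oomega.
Proof.
rewrite /cb_rank_ge /cb_rank; case: pselect => // e i.
by case: cid => r [h _] /=; apply: h; exists (vanish_pt i); apply: vanish_pt_cb.
Qed.

End Primes.

Theorem theorem3 (p : nat) (k : fieldType) (p_prime : prime p)
    (k_char0 : [pchar k]%R =i pred0) :
  krull_dim_infinite k (abelian_pgroup p) /\
  (inhabited (Spc k (abelian_pgroup p)) /\
   cb_rank_ge (@spc_open k (abelian_pgroup p)) oomega).
Proof.
split; [exact: krull_vanish|split; [exact: (inhabits (vanish_pt p_prime k_char0 0))|exact: cb_rank_omega]].
Qed.
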